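(* Let $V$ be a finite-dimensional real Euclidean space and let $G\subset \mathbf{O}(V)$ be a compact Lie group acting linearly on $V$, with Lie algebra $\mathfrak{g}\cong\mathfrak{su}_2$ and identity component $G^0$. Let $n_1\ge\dots\ge n_l>1=n_{l+1}=\dots=n_L$ be the dimensions of the irreducible components (counted with multiplicity) of the real representation of $\mathfrak{g}$ on $V$. If $G=G^0$, $l=2$, $n_1=5$ and $n_2=3$, then $V/G\cong\mathbb{R}^5$.
   Context: $V/G$ denotes the orbit space with the quotient topology, and $\cong$ means homeomorphic. The conclusion is given as printed in the paper; the paper's proof begins by saying that one may take the subspace $V_0=\{v\in V:\mathfrak{g}v=0\}$ to be trivial, and then treats the direct sum of the irreducible representations of dimensions 5 and 3.
   Formalization: The printed conclusion fails when trivial summands occur (L > l), since then V/G is the product of R^5 with R^(L-l); the formal conclusion is V/G homeomorphic to R^(5+(L-l)), which is R^5 exactly when L = l. *)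

(* Defs.v *)
From HB Require Import structures.
From mathcomp Require Import all_boot all_order all_algebra.
From mathcomp Require Import all_classical all_reals all_analysis.
From mathcomp Require Import complex.

Set Implicit Arguments.
Unset Strict Implicit.
Unset Printing Implicit Defensive.

Import Order.TTheory GRing.Theory Num.Theory.
Import numFieldNormedType.Exports.

Local Open Scope classical_set_scope.
Local Open Scope ring_scope.
Local Open Scope quotient_scope.

Definition homeomorphic (T U : topologicalType) : Prop :=
  exists (f : T -> U) (g : U -> T),
    [/\ continuous f, continuous g, cancel f g & cancel g f].

(* Subgroups of O(V), where V = R^n is the space of column vectors with its
   standard inner product and a matrix A acts by v |-> A *m v. *)
Record orthoGroup (R : realType) (n : nat) := OrthoGroup {
  og_set :> set 'M[R]_n;
  og_ortho : forall A, og_set A -> A^T *m A = 1%:M;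
  og_one : og_set 1%:M;
  og_mul : forall A B, og_set A -> og_set B -> og_set (A *m B);
  og_inv : forall A, og_set A -> og_set (invmx A)
}.

Section OrbitSpace.
Context (R : realType) (n : nat) (G : orthoGroup R n).

Definition orbit_rel : rel 'cV[R]_n :=
  fun u v => `[< exists2 A, og_set G A & A *m u = v >].

Lemma orbit_rel_equiv : equiv_class_of orbit_rel.
Proof.
split.
- by move=> u; apply/asboolP; exists 1%:M; [exact: og_one | rewrite mul1mx].
- have H u v : orbit_rel u v -> orbit_rel v u.
    move=> /asboolP [A GA Auv]; apply/asboolP; exists (invmx A).
      exact: og_inv.
    by rewrite -Auv mulKmx//; have [] := mulmx1_unit (og_ortho GA).
  by move=> u v; apply/idP/idP; exact: H.
- move=> v u w /asboolP [A GA Auv] /asboolP [B GB Bvw]; apply/asboolP.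
  by exists (B *m A); [exact: og_mul | rewrite -mulmxA Auv].
Qed.

Canonical orbit_equiv : equiv_rel 'cV[R]_n :=
  EquivRelPack orbit_rel_equiv.

Definition orbit_space : topologicalType :=
  quotient_topology {eq_quot orbit_equiv}.

End OrbitSpace.

Definition expmx (R : realType) (n : nat) (X : 'M[R]_n) : 'M[R]_n :=
  limn (series (fun k : nat => (k`!%:R)^-1 *: X ^+ k)).

(* For a closed subgroup of GL(V), the tangent space at the identity is
   { X | exp(tX) lies in G for all real t }. *)
Definition lie_alg (R : realType) (n : nat) (G : set 'M[R]_n) : set 'M[R]_n :=
  [set X | forall t : R, G (expmx (t *: X))].

Definition mxbracket (K : pzRingType) (n : nat) (X Y : 'M[K]_n) : 'M[K]_n :=
  X *m Y - Y *m X.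

Definition su (R : realType) (n : nat) : set 'M[R[i]]_n :=
  [set A | (map_mx Num.conj A)^T = - A /\ \tr A = 0].
Arguments su : clear implicits.

(* g and h are real Lie algebras of matrices; complex matrices are regarded as
   a real vector space through the embedding of R in R[i]. *)
Definition lie_isomorphic (R : realType) (m n : nat)
    (g : set 'M[R]_m) (h : set 'M[R[i]]_n) : Prop :=
  exists f : 'M[R]_m -> 'M[R[i]]_n,
    [/\ set_bij g h f,
        (forall (a : R) X Y, g X -> g Y ->
           f (a *: X + Y) = real_complex R a *: f X + f Y) &
        (forall X Y, g X -> g Y ->
           f (mxbracket X Y) = mxbracket (f X) (f Y))].

Section IrreducibleComponents.
Context (R : realType) (n : nat).
Implicit Types (g : set 'M[R]_n) (U W : {vspace 'cV[R]_n}).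

Definition lie_stable g U : Prop :=
  forall X u, g X -> u \in U -> X *m u \in U.

Definition lie_irreducible g U : Prop :=
  [/\ lie_stable g U, U != 0%VS &
      forall W, (W <= U)%VS -> lie_stable g W -> W = 0%VS \/ W = U].

Definition irreducible_dims g (ns : seq nat) : Prop :=
  sorted geq ns /\
  exists U : 'I_(size ns) -> {vspace 'cV[R]_n},
    [/\ forall i, lie_irreducible g (U i),
        forall i, \dim (U i) = nth 0%N ns i,
        directv (\sum_i U i) &
        (\sum_i U i)%VS = fullv].

End IrreducibleComponents.

(* Main.v *)
Require Import Defs.
From HB Require Import structures.
From mathcomp Require Import all_boot all_order all_algebra.
From mathcomp Require Import all_classical all_reals all_analysis.
From mathcomp Require Import complex ring lra.

Set Implicit Arguments.
Unset Strict Implicit.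
Unset Printing Implicit Defensive.

Import Order.TTheory GRing.Theory Num.Theory.
Import numFieldNormedType.Exports.

Local Open Scope classical_set_scope.
Local Open Scope ring_scope.

(** In a suitable basis su(2) acts on V = Sym_0(R^3) + R^3 + R^k by infinitesimal
    rotations on the first two summands and trivially on R^k.  The rotations h_R
    belong to G because they are exponentials.  If R(g) denotes the rotation that
    g in G induces on the Lie algebra, then g |-> h_{R(g)}^-1 g is a continuous
    map into the centralizer of the Lie algebra in G, which is discrete; as G is
    connected, G = { h_R : R in SO(3) }.

    Given (S, v) let l1 >= l2 >= l3 be the eigenvalues of S, s_i = l_i - l_(i+1),
    r = |v|^2, and let z1 >= z2 be the eigenvalues of the compression of S to the
    orthogonal of v.  By interlacing rho_i = r (l_i + l_(i+1) - 2 z_i) satisfies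
    |rho_i| <= r s_i.  The map
      F(S, v) = (rho_1, rho_2, r - s_1, r - s_2, r^(3/2) det (v, S v, S^2 v))
    is continuous, invariant and proper.  When its first four coordinates are
    fixed, 64 r^3 det (v, S v, S^2 v)^2 is a polynomial that is strictly
    increasing in r; hence F separates the orbits, and by the intermediate value
    theorem it attains every value whose last coordinate is nonzero.  A proper
    continuous map with dense image whose fibres are the orbits induces a
    homeomorphism. *)

(** * Matrix limits and the exponential *)

(** [expmx] is a limit of partial sums, and no logarithm or Baker-Campbell-Hausdorff formula is
    developed. One limit serves throughout: [(1 + Y_j / k_j)^k_j] tends to [expmx X] when [Y_j -> X]
    and [k_j -> oo]. It turns limits of difference quotients in G into elements of the Lie algebra,
    and it evaluates the exponentials that occur.

    The z_i are undefined at v = 0 and eigenvectors jump where eigenvalues meet, so F uses only r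
    z_i and extreme eigenvalues. Taking r - s_i instead of s_i lets these coordinates range over all
    reals and makes r s_i increase strictly with r once they are fixed. The determinant changes sign
    under v -> -v, so it tells SO(3)-orbits from O(3)-orbits; the factor r^(3/2) makes its square a
    function of r and the other four coordinates. Values with last coordinate 0 are those where
    |rho_i| < r s_i fails for some i; closedness of the image takes care of them.

    The irreducible summands are independent but not assumed orthogonal, so the change of basis is
    merely invertible. The coordinates on R^k pass through unchanged, whence the target R^(5 +
    k). *)

Lemma cvg_mxP (R : realType) (T : Type) (F : set_system T) (FF : Filter F) m n
    (f : T -> 'M[R]_(m, n)) (M : 'M[R]_(m, n)) :
  f @ F --> M <-> forall i j, (fun x => f x i j) @ F --> M i j.
Proof.
split=> [fM i j|fM].
  exact: (continuous_cvg _ (@coord_continuous R m n i j M) fM).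
apply/cvgrPdist_lt => e e0.
near=> x.
rewrite /Num.Def.normr/= mx_normrE bigmax_lt//= => -[i j] _ /=.
rewrite !mxE/=; move: i j; near: x.
have : forall p : 'I_m * 'I_n, \forall x \near F, `|M p.1 p.2 - f x p.1 p.2| < e.
  by move=> p; move/cvgrPdist_lt : (fM p.1 p.2) => /(_ _ e0).
by move/filter_forall; apply: filterS => x H i j; exact: (H (i, j)).
Unshelve. all: by end_near. Qed.

Lemma entry_le_mxnorm (R : realType) m n (A : 'M[R]_(m, n)) i j :
  `|A i j| <= `|A|.
Proof.
rewrite [leRHS]/Num.Def.normr/= mx_normrE.
exact: (le_bigmax _ (fun p : 'I_m * 'I_n => `|A p.1 p.2|) (i, j)).
Qed.

Section MatrixLimits.
Context (R : realType) (T : Type) (F : set_system T) (FF : Filter F).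

Lemma cvg_mulmx m n p (f : T -> 'M[R]_(m, n)) (g : T -> 'M[R]_(n, p))
    (A : 'M[R]_(m, n)) (B : 'M[R]_(n, p)) :
  f @ F --> A -> g @ F --> B -> (fun x => f x *m g x) @ F --> A *m B.
Proof.
move=> /cvg_mxP fA /cvg_mxP gB; apply/cvg_mxP => i j.
under eq_fun do rewrite mxE; rewrite mxE.
by apply: cvg_big => [|k _]; [exact: add_continuous|apply: cvgM].
Qed.

Lemma cvg_trmx m n (f : T -> 'M[R]_(m, n)) (A : 'M[R]_(m, n)) :
  f @ F --> A -> (fun x => (f x)^T) @ F --> A^T.
Proof.
move=> /cvg_mxP fA; apply/cvg_mxP => i j.
by under eq_fun do rewrite mxE; rewrite mxE; exact: fA.
Qed.

End MatrixLimits.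

Section RowSumNorm.
Context (R : realType) (n : nat).
Implicit Types A B X Y : 'M[R]_n.

(* The operator norm for the sup norm on vectors: unlike the entrywise norm of
   the library it satisfies |AB| <= |A||B| and |1| <= 1. *)
Definition opnorm A : R := \big[Num.max/0]_i \sum_j `|A i j|.

Lemma opnorm_ge0 A : 0 <= opnorm A.
Proof. exact: bigmax_ge_id. Qed.

Lemma le_opnorm A i : \sum_j `|A i j| <= opnorm A.
Proof. by rewrite /opnorm; apply: (le_bigmax _ (fun i => \sum_j `|A i j|)). Qed.

Lemma opnorm_le A c : 0 <= c -> (forall i, \sum_j `|A i j| <= c) -> opnorm A <= c.
Proof. by move=> c0 H; apply: bigmax_le. Qed.

Lemma entry_le_opnorm A i j : `|A i j| <= opnorm A.
Proof.
apply: le_trans (le_opnorm A i); rewrite (bigD1 j)//= lerDl.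
by apply: sumr_ge0.
Qed.

Lemma opnormD A B : opnorm (A + B) <= opnorm A + opnorm B.
Proof.
apply: opnorm_le => [|i]; first by rewrite addr_ge0 ?opnorm_ge0.
apply: le_trans (lerD (le_opnorm A i) (le_opnorm B i)).
by rewrite -big_split/=; apply: ler_sum => j _; rewrite mxE ler_normD.
Qed.

Lemma opnormZ c A : opnorm (c *: A) <= `|c| * opnorm A.
Proof.
apply: opnorm_le => [|i]; first by rewrite mulr_ge0 ?opnorm_ge0.
apply: le_trans (ler_wpM2l (normr_ge0 c) (le_opnorm A i)).
by rewrite mulr_sumr; apply: ler_sum => j _; rewrite mxE normrM.
Qed.

Lemma opnormM A B : opnorm (A *m B) <= opnorm A * opnorm B.
Proof.
apply: opnorm_le => [|i]; first by rewrite mulr_ge0 ?opnorm_ge0.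
apply: (@le_trans _ _ (\sum_j \sum_k `|A i k| * `|B k j|)).
  apply: ler_sum => j _; rewrite mxE; apply: le_trans (ler_norm_sum _ _ _) _.
  by apply: ler_sum => k _; rewrite normrM.
rewrite exchange_big/=.
apply: le_trans (ler_wpM2r (opnorm_ge0 B) (le_opnorm A i)).
rewrite mulr_suml; apply: ler_sum => k _; rewrite -mulr_sumr.
by rewrite ler_wpM2l// le_opnorm.
Qed.

Lemma opnorm1 : opnorm (1%:M : 'M[R]_n) <= 1.
Proof.
apply: opnorm_le => // i; rewrite (bigD1 i)//= !mxE eqxx normr1 big1 ?addr0//.
by move=> j ji; rewrite !mxE eq_sym (negbTE ji) normr0.
Qed.

Lemma opnormX A k : opnorm (A ^+ k) <= opnorm A ^+ k.
Proof.
elim: k => [|k IH]; first by rewrite !expr0 opnorm1.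
rewrite !exprS; apply: le_trans (opnormM _ _) _.
by rewrite ler_wpM2l ?opnorm_ge0.
Qed.

Lemma opnorm_le_mxnorm A : opnorm A <= n%:R * `|A|.
Proof.
apply: opnorm_le => [|i]; first by rewrite mulr_ge0.
apply: (@le_trans _ _ (\sum_(j < n) `|A|)); last first.
  by rewrite sumr_const card_ord mulr_natl.
by apply: ler_sum => j _; exact: entry_le_mxnorm.
Qed.

Lemma opnorm_sum (I : Type) (r : seq I) (F : I -> 'M[R]_n) :
  opnorm (\sum_(i <- r) F i) <= \sum_(i <- r) opnorm (F i).
Proof.
elim/big_ind2: _ => // [|A a B b Aa Bb].
  by apply: opnorm_le => // i; rewrite big1// => j _; rewrite mxE normr0.
by apply: le_trans (opnormD _ _) (lerD Aa Bb).
Qed.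

(** Telescoping, which needs no commutation of [A] and [B]: each of the [k.+1] summands replaces one
    factor [A] by [B]. *)
Lemma opnorm_subX A B (c : R) k : 0 <= c -> opnorm A <= c -> opnorm B <= c ->
  opnorm (A ^+ k.+1 - B ^+ k.+1) <= k.+1%:R * opnorm (A - B) * c ^+ k.
Proof.
move=> c0 Ac Bc; elim: k => [|k IH]; first by rewrite !expr1 expr0 mul1r mulr1.
have -> : A ^+ k.+2 - B ^+ k.+2 =
    A *m (A ^+ k.+1 - B ^+ k.+1) + (A - B) *m B ^+ k.+1.
  by rewrite (exprS A k.+1) (exprS B k.+1) mulmxBr mulmxBl addrA subrK.
apply: le_trans (opnormD _ _) _.
apply: le_trans (lerD (opnormM _ _) (opnormM _ _)) _.
have -> : k.+2%:R * opnorm (A - B) * c ^+ k.+1 =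
    c * (k.+1%:R * opnorm (A - B) * c ^+ k) + opnorm (A - B) * c ^+ k.+1.
  by rewrite (exprS c) -[in LHS]addn1 natrD; ring.
apply: lerD; first by apply: ler_pM; rewrite ?opnorm_ge0.
rewrite ler_wpM2l ?opnorm_ge0//.
apply: le_trans (opnormX _ _) _.
by rewrite ler_pXn2r// nnegrE ?opnorm_ge0.
Qed.

Lemma cvg_opnorm (T : Type) (F : set_system T) (FF : Filter F) (f : T -> 'M[R]_n) (A : 'M[R]_n) :
  f @ F --> A <-> (fun x => opnorm (f x - A)) @ F --> 0.
Proof.
split=> [fA|fA].
  have H : (fun x => n%:R * `|f x - A|) @ F --> 0.
    rewrite -(mulr0 n%:R); apply: cvgM; first exact: cvg_cst.
    by rewrite -(normr0 'M[R]_n) -(subrr A); apply: cvg_norm; apply: cvgB => //; exact: cvg_cst.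
  apply: (squeeze_cvgr _ (cvg_cst 0) H); near=> x.
  by rewrite opnorm_ge0 opnorm_le_mxnorm.
apply/cvg_mxP => i j; apply/subr_cvg0; apply: norm_cvg0.
apply: (squeeze_cvgr _ (cvg_cst 0) fA); near=> x.
by rewrite normr_ge0/= (le_trans _ (entry_le_opnorm _ i j))// !mxE.
Unshelve. all: by end_near. Qed.

End RowSumNorm.

Section MatrixExponential.
Context (R : realType) (n : nat).
Implicit Types X Y : 'M[R]_n.

Lemma scalemxX (a : R) X k : (a *: X) ^+ k = a ^+ k *: X ^+ k.
Proof.
elim: k => [|k IH]; first by rewrite !expr0 scale1r.
rewrite !exprS IH [LHS](_ : _ = (a *: X) *m (a ^+ k *: X ^+ k))//.
by rewrite -scalemxAl -scalemxAr scalerA.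
Qed.

(** [expmx] is a [limn], meaningful only once convergence is known. Each entry is dominated by the
    scalar exponential series at [opnorm X]. *)
Lemma expmx_cvg X :
  series (fun k => (k`!%:R)^-1 *: X ^+ k) @ \oo --> expmx X.
Proof.
have H i j : cvgn (series (fun k => ((k`!%:R)^-1 *: X ^+ k) i j)).
  apply: normed_cvg.
  apply: (series_le_cvg _ _ _ (is_cvg_series_exp_coeff (opnorm X))) => k.
  - exact: normr_ge0.
  - by rewrite exp_coeff_ge0// opnorm_ge0.
  - rewrite /= mxE normrM ger0_norm ?invr_ge0// mulrC ler_wpM2r ?invr_ge0//.
    exact: le_trans (entry_le_opnorm _ i j) (opnormX _ _).
suff : cvgn (series (fun k => (k`!%:R)^-1 *: X ^+ k)) by [].
apply/cvg_ex; exists (\matrix_(i, j) limn (series (fun k => ((k`!%:R)^-1 *: X ^+ k) i j))).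
apply/cvg_mxP => i j; rewrite mxE.
rewrite (_ : (fun x => _) = series (fun k => ((k`!%:R)^-1 *: X ^+ k) i j)).
  exact: H.
by apply/funext => m; rewrite /series/= summxE.
Qed.

Lemma expR_series_le (x : R) m : 0 <= x -> series (exp_coeff x) m <= expR x.
Proof.
move=> x0; apply: nondecreasing_cvgn_le; last exact: is_cvg_series_exp_coeff.
by apply: nondecreasing_series => k _ _; exact: exp_coeff_ge0.
Qed.

Lemma bernoulli_ineq (t : R) m : 0 <= t <= 1 -> 1 - m%:R * t <= (1 - t) ^+ m.
Proof.
move=> /andP[t0 t1]; elim: m => [|m IH]; first by rewrite expr0 mul0r subr0.
rewrite exprS; apply: le_trans (ler_wpM2l _ IH); last by rewrite subr_ge0.
rewrite -natr1 -subr_ge0.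
have -> : (1 - t) * (1 - m%:R * t) - (1 - (m%:R + 1) * t) = m%:R * t ^+ 2 by ring.
by rewrite mulr_ge0// exprn_ge0.
Qed.

(** With u = x/m, [expR u * (1 - u) <= 1] gives [expR u * (1 - u^2) <= 1 + u]. Raise this to the
    power m and bound [(1 - u^2)^m] below by Bernoulli. *)
Lemma expR_compound_ge (x : R) m : 0 <= x -> (0 < m)%N -> x <= m%:R ->
  expR x * (1 - x ^+ 2 / m%:R) <= (1 + x / m%:R) ^+ m.
Proof.
move=> x0 m0 xm; have m0' : 0 < m%:R :> R by rewrite ltr0n.
set u := x / m%:R.
have u0 : 0 <= u by rewrite divr_ge0 // ltW.
have u1 : u <= 1 by rewrite ler_pdivrMr// mul1r.
have -> : x = u * m%:R by rewrite divfK// gt_eqF.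
have -> : (u * m%:R) ^+ 2 / m%:R = m%:R * u ^+ 2 by field; rewrite gt_eqF.
rewrite expRM_natr.
apply: (@le_trans _ _ (expR u ^+ m * (1 - u ^+ 2) ^+ m)).
  rewrite ler_wpM2l ?exprn_ge0 ?expR_ge0// bernoulli_ineq//.
  by rewrite exprn_ge0//= exprn_ile1.
rewrite -exprMn; apply: lerXn2r; rewrite ?nnegrE.
- by rewrite mulr_ge0 ?expR_ge0// subr_ge0 exprn_ile1.
- by rewrite addr_ge0.
have -> : 1 - u ^+ 2 = (1 - u) * (1 + u) by ring.
rewrite mulrA ler_piMl ?addr_ge0//.
rewrite -[leRHS](mulfV (lt0r_neq0 (expR_gt0 u))) ler_wpM2l ?expR_ge0//.
by rewrite -expRN expR_ge1Dx.
Qed.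

Lemma expR_compound_le (x : R) m : 0 <= x -> (0 < m)%N ->
  (1 + x / m%:R) ^+ m <= expR x.
Proof.
move=> x0 m0.
have -> : expR x = expR (x / m%:R) ^+ m.
  by rewrite -expRM_natr divfK// pnatr_eq0 -lt0n.
by apply: lerXn2r; rewrite ?nnegrE ?expR_ge0 ?addr_ge0 ?divr_ge0// expR_ge1Dx.
Qed.

(* The coefficients 1/k! - C(m,k)/m^k are nonnegative, so the matrix estimate
   reduces to the scalar one. *)
Lemma opnorm_series_sub_compound X m : (0 < m)%N -> opnorm X <= m%:R ->
  opnorm (series (fun k => (k`!%:R)^-1 *: X ^+ k) m.+1 -
          (1%:M + m%:R^-1 *: X) ^+ m) <= expR (opnorm X) * opnorm X ^+ 2 / m%:R.
Proof.
move=> m0 Xm; set x := opnorm X in Xm *.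
have x0 : 0 <= x by exact: opnorm_ge0.
pose c k : R := (k`!%:R)^-1 - 'C(m, k)%:R / m%:R ^+ k.
have c0 k : 0 <= c k.
  rewrite subr_ge0 ler_pdivrMr ?exprn_gt0 ?ltr0n// mulrC ler_pdivlMr ?ltr0n ?fact_gt0//.
  rewrite -natrM -natrX ler_nat bin_ffact.
  by elim: k => [|k IH] //; rewrite ffactnSr expnSr leq_mul// leq_subr.
have E (A : 'M[R]_n) : series (fun k => (k`!%:R)^-1 *: A ^+ k) m.+1 -
    (1%:M + m%:R^-1 *: A) ^+ m = \sum_(k < m.+1) c k *: A ^+ k.
  rewrite exprDn_comm; last by rewrite /GRing.comm mul1r mulr1.
  rewrite /series/= big_mkord -sumrB; apply: eq_bigr => k _.
  rewrite (_ : 1%:M ^+ _ = 1%:M); last exact: expr1n.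
  rewrite (_ : 1%:M * _ = (m%:R^-1 *: A) ^+ k); last exact: mul1mx.
  have nat_scale (B : 'M[R]_n) q : B *+ q = q%:R *: B by rewrite scaler_nat.
  by rewrite scalemxX nat_scale scalerA exprVn scalerBl.
have e : series (exp_coeff x) m.+1 - (1 + m%:R^-1 * x) ^+ m = \sum_(k < m.+1) c k * x ^+ k.
  rewrite exprDn_comm; last by rewrite /GRing.comm mul1r mulr1.
  rewrite /series/= big_mkord -sumrB; apply: eq_bigr => k _.
  by rewrite expr1n mul1r exprMn exprVn /c /exp_coeff/= -mulr_natl; ring.
rewrite E; apply: le_trans (opnorm_sum _ _) _.
apply: (@le_trans _ _ (\sum_(k < m.+1) c k * x ^+ k)).
  apply: ler_sum => k _; apply: le_trans (opnormZ _ _) _.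
  by rewrite ger0_norm// ler_wpM2l// opnormX.
rewrite -e; apply: (@le_trans _ _ (expR x - expR x * (1 - x ^+ 2 / m%:R))).
  by apply: lerB; [exact: expR_series_le | rewrite [_^-1 * _]mulrC expR_compound_ge].
by rewrite le_eqVlt; apply/orP; left; apply/eqP; ring.
Qed.

(** The point is uniformity in [m]: the factor m from telescoping cancels the step 1/m, and the
    remaining powers of [1 + M/m] stay below [expR M]. *)
Lemma opnorm_sub_compound X Y (M : R) m : (0 < m)%N ->
  opnorm X <= M -> opnorm Y <= M ->
  opnorm ((1%:M + m%:R^-1 *: X) ^+ m - (1%:M + m%:R^-1 *: Y) ^+ m) <=
    expR M * opnorm (X - Y).
Proof.
case: m => // m _ XM YM; have M0 : 0 <= M := le_trans (opnorm_ge0 X) XM.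
have bnd (A : 'M[R]_n) : opnorm A <= M ->
    opnorm (1%:M + m.+1%:R^-1 *: A) <= 1 + M / m.+1%:R.
  move=> AM; apply: le_trans (opnormD _ _) _; apply: lerD; first exact: opnorm1.
  apply: le_trans (opnormZ _ _) _.
  by rewrite ger0_norm// mulrC ler_wpM2r.
have c0 : 0 <= 1 + M / m.+1%:R by rewrite addr_ge0// divr_ge0.
apply: le_trans (opnorm_subX _ c0 (bnd _ XM) (bnd _ YM)) _.
rewrite opprD addrACA subrr add0r -scalerBr.
apply: (@le_trans _ _ (opnorm (X - Y) * (1 + M / m.+1%:R) ^+ m)).
  rewrite ler_wpM2r ?exprn_ge0//.
  apply: le_trans (ler_wpM2l _ (opnormZ _ _)) _ => //.
  by rewrite ger0_norm// mulrA mulfV ?mul1r// pnatr_eq0.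
rewrite mulrC ler_wpM2r ?opnorm_ge0//.
apply: le_trans (expR_compound_le M0 (ltn0Sn m)).
by rewrite exprS ler_peMl ?exprn_ge0// lerDl divr_ge0.
Qed.

(** Letting the base [Y j] and the exponent [k j] vary is what makes this usable for group elements:
    any [z] is [1 + (1/k) (k (z - 1))], so powers of elements near the identity converge to
    exponentials. *)
Lemma cvg_compound_expmx (k : nat -> nat) (Y : nat -> 'M[R]_n) X :
  k @ \oo --> \oo -> Y @ \oo --> X ->
  (fun j => (1%:M + (k j)%:R^-1 *: Y j) ^+ k j) @ \oo --> expmx X.
Proof.
move=> koo /cvg_opnorm YX; apply/cvg_opnorm.
pose S m : 'M[R]_n := series (fun k => (k`!%:R)^-1 *: X ^+ k) m.
(* The three summands control the tail of the series, the gap between the series and the compound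
   power of [X], and the replacement of [X] by [Y j]. *)
pose g j := opnorm (S (k j).+1 - expmx X) +
   expR (opnorm X) * opnorm X ^+ 2 / (k j)%:R +
   expR (opnorm X + 1) * opnorm (Y j - X).
have kpos : \forall j \near \oo, (0 < k j)%N.
  by apply: (koo (fun m => (0 < m)%N)); exists 1%N.
have kR : (fun j => (k j)%:R : R) @ \oo --> +oo.
  exact: (cvg_comp k (fun i => i%:R : R) koo cvgr_idn).
have g0 : g @ \oo --> 0.
  rewrite -[0]addr0 -[0 in X in _ --> X + _]addr0; apply: cvgD; first apply: cvgD.
  - have := @expmx_cvg X; rewrite -cvg_shiftS => H.
    have := cvg_comp k _ koo H.
    by move/cvg_opnorm.
  - rewrite -[0](mulr0 (expR (opnorm X) * opnorm X ^+ 2)); apply: cvgMr.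
    by apply/gtr0_cvgV0 => //; near=> j; rewrite ltr0n; near: j.
  - by rewrite -[0](mulr0 (expR (opnorm X + 1))); apply: cvgMr.
apply: (squeeze_cvgr _ (cvg_cst 0) g0); near=> j.
rewrite opnorm_ge0/=.
have k0 : (0 < k j)%N by near: j.
have kX : opnorm X <= (k j)%:R by near: j; move/cvgryPge : kR; exact.
have YX1 : opnorm (Y j - X) <= 1.
  by near: j; move/cvgr0_norm_le : YX => /(_ 1 ltr01); apply: filterS => j; rewrite ger0_norm ?opnorm_ge0.
have YM : opnorm (Y j) <= opnorm X + 1.
  apply: (@le_trans _ _ (opnorm (X + (Y j - X)))); first by rewrite addrC subrK.
  by apply: le_trans (opnormD _ _) _; rewrite lerD2l.
have XM : opnorm X <= opnorm X + 1 by rewrite lerDl.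
have zid (A B C D : 'M[R]_n) : A - B = (C - B) - (C - D) + (A - D).
  by apply/matrixP => a b; rewrite !mxE; ring.
rewrite (zid _ _ (S (k j).+1) ((1%:M + (k j)%:R^-1 *: X) ^+ k j)).
apply: le_trans (opnormD _ _) _; apply: lerD; last exact: opnorm_sub_compound.
apply: le_trans (opnormD _ _) _; apply: lerD => //.
rewrite -scaleN1r; apply: le_trans (opnormZ _ _) _; rewrite normrN1 mul1r.
exact: opnorm_series_sub_compound.
Unshelve. all: by end_near. Qed.

End MatrixExponential.

(** * The Lie algebra of a closed subgroup of O(n) *)

Lemma cvg_ext (T : Type) (U : topologicalType) (F : set_system T) (f g : T -> U) (l : U) :
  f =1 g -> f @ F --> l -> g @ F --> l.
Proof. by move=> /funext ->. Qed.

Lemma cvg_natV (R : realType) : (fun j => j%:R^-1 : R) @ \oo --> 0.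
Proof.
by apply/gtr0_cvgV0; [near=> j; rewrite ltr0n; near: j; exists 1%N | exact: cvgr_idn].
Unshelve. all: by end_near. Qed.

Section ExpDerivative.
Context (R : realType) (n : nat).
Implicit Types X Y : 'M[R]_n.

(** Second-order Taylor remainder: the terms left after the first two are compared with [Y^2] times
    the exponential series through [k! <= (k+2)!]. It yields the derivative of the exponential at
    0. *)
Lemma opnorm_expmx_sub Y :
  opnorm (expmx Y - 1%:M - Y) <= opnorm Y ^+ 2 * expR (opnorm Y).
Proof.
have y0 := opnorm_ge0 Y; set y := opnorm Y in y0 *.
pose S m : 'M[R]_n := series (fun k => (k`!%:R)^-1 *: Y ^+ k) m.
have SE m : opnorm (S m.+2 - 1%:M - Y) <= y ^+ 2 * expR y.
  have -> : S m.+2 - 1%:M - Y = \sum_(k < m) (k.+2`!%:R)^-1 *: Y ^+ k.+2.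
    rewrite /S /series/= big_mkord 2!big_ord_recl/= !invr1 expr0 expr1 !scale1r.
    rewrite [_ + (_ + _)]addrC addrK addrC addrA addNr add0r.
    exact: eq_bigr.
  apply: le_trans (opnorm_sum _ _) _.
  apply: le_trans (ler_wpM2l (exprn_ge0 2 y0) (expR_series_le m y0)).
  rewrite /series/= big_mkord mulr_sumr; apply: ler_sum => k _.
  apply: le_trans (opnormZ _ _) _.
  rewrite ger0_norm ?invr_ge0// /exp_coeff/= mulrC mulrA -exprD add2n.
  apply: ler_pM; rewrite ?opnorm_ge0 ?invr_ge0//; first exact: opnormX.
  by rewrite lef_pV2 ?posrE ?ltr0n ?fact_gt0// ler_nat 2!factS mulnA leq_pmull.
apply/ler_addgt0Pr => e e0.
have /cvg_opnorm H := @expmx_cvg R n Y.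
have : \forall m \near \oo, opnorm (S m - expmx Y) <= e.
  by move/cvgr0_norm_le : H => /(_ e e0); apply: filterS => m; rewrite ger0_norm ?opnorm_ge0.
move=> [N _ HN]; have {}HN := HN N.+2 (leqW (leqnSn N)).
have -> : expmx Y - 1%:M - Y = (S N.+2 - 1%:M - Y) + (-1) *: (S N.+2 - expmx Y).
  by apply/matrixP => a b; rewrite !mxE; ring.
apply: le_trans (opnormD _ _) _; apply: lerD => //.
by apply: le_trans (opnormZ _ _) _; rewrite normrN1 mul1r.
Qed.

Lemma expmx0 : expmx (0 : 'M[R]_n) = 1%:M.
Proof.
have opnorm0 : opnorm (0 : 'M[R]_n) = 0.
  by apply/eqP; rewrite eq_le opnorm_ge0 andbT; apply: opnorm_le => // i; rewrite big1// => j _; rewrite mxE normr0.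
have := opnorm_expmx_sub 0; rewrite opnorm0 expr2 mul0r mul0r subr0 => H.
apply/matrixP => i j; apply/eqP; rewrite -subr_eq0 -normr_eq0 eq_le normr_ge0 andbT.
apply: le_trans H; apply: le_trans (entry_le_opnorm _ i j) => //.
by rewrite !mxE.
Qed.

(** No Cauchy product is formed: [(1 + X/j)^j (1 - X/j)^j] is [(1 - X^2/j^2)^j], again a compound
    power, whose base direction [- X^2/j] tends to 0. *)
Lemma expmxN X : expmx X *m expmx (- X) = 1%:M.
Proof.
have H : (fun j => (1%:M + j%:R^-1 *: X) ^+ j *m (1%:M + j%:R^-1 *: - X) ^+ j) @ \oo -->
    expmx X *m expmx (- X).
  by apply: cvg_mulmx; apply: cvg_compound_expmx => //; exact: cvg_cst.
have H0 : (fun j => (1%:M + j%:R^-1 *: (- (j%:R^-1 *: (X *m X)))) ^+ j) @ \oo --> expmx (0 : 'M[R]_n).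
  apply: cvg_compound_expmx => //.
  rewrite -[0]oppr0; apply: cvgN; rewrite -[0](scale0r (X *m X)).
  apply: cvgZ; last exact: cvg_cst.
  exact: cvg_natV.
have E : (fun j => (1%:M + j%:R^-1 *: X) ^+ j *m (1%:M + j%:R^-1 *: - X) ^+ j) =
  fun j => (1%:M + j%:R^-1 *: (- (j%:R^-1 *: (X *m X)))) ^+ j; last first.
  by rewrite E in H; rewrite -expmx0; exact: (cvg_unique _ H H0).
apply/funext => j; set a : R := j%:R^-1.
have comm : GRing.comm (1%:M + a *: X) (1%:M + a *: - X).
  rewrite /GRing.comm -[LHS]/(_ *m _) -[RHS]/(_ *m _).
  rewrite !mulmxDl !mulmxDr !mul1mx !mulmx1 scalerN !mulmxN !mulNmx.
  by rewrite !addrA; congr (_ - _); rewrite -!addrA; congr (_ + _); rewrite addrC.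
rewrite [LHS](_ : _ = (1%:M + a *: X) ^+ j * (1%:M + a *: - X) ^+ j)//.
rewrite -exprMn_comm//; congr (_ ^+ j).
rewrite [LHS](_ : _ = (1%:M + a *: X) *m (1%:M + a *: - X))//.
rewrite mulmxDl !mulmxDr !mul1mx !mulmx1 !scalerN mulmxN -scalemxAl -scalemxAr.
by rewrite addrA subrK.
Qed.

Lemma expmx_deriv X (d : nat -> R) : (forall j, d j != 0) -> d @ \oo --> 0 ->
  (fun j => (d j)^-1 *: (expmx (d j *: X) - 1%:M)) @ \oo --> X.
Proof.
move=> dn0 d0; apply/cvg_opnorm.
have H : (fun j => `|d j| * (opnorm X ^+ 2 * expR (opnorm X))) @ \oo --> 0.
  rewrite -[0](mul0r (opnorm X ^+ 2 * expR (opnorm X))); apply: cvgMl.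
  by rewrite -(normr0 R); apply: cvg_norm.
apply: (squeeze_cvgr _ (cvg_cst 0) H); near=> j.
rewrite opnorm_ge0/=.
have d1 : `|d j| <= 1 by near: j; move/cvgr0_norm_le : d0 => /(_ 1 ltr01).
have -> : (d j)^-1 *: (expmx (d j *: X) - 1%:M) - X =
   (d j)^-1 *: (expmx (d j *: X) - 1%:M - d j *: X).
  by rewrite [RHS]scalerBr scalerA mulVf// scale1r.
apply: le_trans (opnormZ _ _) _.
apply: le_trans (ler_wpM2l (normr_ge0 _) (opnorm_expmx_sub _)) _.
have dX : opnorm (d j *: X) <= `|d j| * opnorm X by exact: opnormZ.
apply: (@le_trans _ _ (`|(d j)^-1| * ((`|d j| * opnorm X) ^+ 2 * expR (opnorm X)))).
  apply: ler_wpM2l => //; apply: ler_pM; rewrite ?exprn_ge0 ?opnorm_ge0 ?expR_ge0//.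
    by apply: lerXn2r; rewrite ?nnegrE ?opnorm_ge0 ?mulr_ge0 ?opnorm_ge0.
  by rewrite ler_expR; apply: le_trans dX _; rewrite ler_piMl ?opnorm_ge0.
rewrite normfV le_eqVlt; apply/orP; left; apply/eqP; field.
by rewrite normr_eq0.
Unshelve. all: by end_near. Qed.

End ExpDerivative.

(** [A B - B A] is the commutator of [A - 1] and [B - 1]. Hence the group commutator, rescaled by
    the square of the step, is the bracket of two difference quotients up to a factor tending to
    1. *)
Lemma commutator_rescale (R : fieldType) n (A B : 'M[R]_n) (a : R) :
  A *m A^T = 1%:M -> B *m B^T = 1%:M ->
  (a ^+ 2)^-1 *: (A *m B *m A^T *m B^T - 1%:M) =
  ((a^-1 *: (A - 1%:M)) *m (a^-1 *: (B - 1%:M)) -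
   (a^-1 *: (B - 1%:M)) *m (a^-1 *: (A - 1%:M))) *m (A^T *m B^T).
Proof.
move=> AA BB.
have E : (A - 1%:M) *m (B - 1%:M) - (B - 1%:M) *m (A - 1%:M) = A *m B - B *m A.
  rewrite !mulmxBr !mulmxBl !mul1mx !mulmx1.
  set P := A *m B; set Q := B *m A.
  by apply/matrixP => i j; rewrite !mxE; ring.
have -> : (A *m B *m A^T *m B^T - 1%:M) = (A *m B - B *m A) *m (A^T *m B^T).
  by rewrite mulmxBl !mulmxA -(mulmxA B A) AA mulmx1 BB.
rewrite -E -!scalemxAl -!scalemxAr !scalerA -scalerBr -scalemxAl.
by rewrite expr2 invfM.
Qed.

Section ClosedGroup.
Context (R : realType) (n : nat) (G : orthoGroup R n).
Hypothesis Gclosed : closed (G : set 'M[R]_n).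
Implicit Types X Y A : 'M[R]_n.

Lemma og_invE A : og_set G A -> invmx A = A^T.
Proof.
move=> GA; have AA := og_ortho GA; have [_ Au] := mulmx1_unit AA.
by rewrite -[invmx A]mul1mx -AA mulmxK.
Qed.

Lemma og_tr A : og_set G A -> og_set G A^T.
Proof. by move=> GA; rewrite -og_invE//; exact: og_inv. Qed.

Lemma og_mulT A : og_set G A -> A *m A^T = 1%:M.
Proof. by move=> GA; apply: mulmx1C; exact: (og_ortho GA). Qed.

Lemma og_exp A k : og_set G A -> og_set G (A ^+ k).
Proof.
move=> GA; elim: k => [|k IH]; first exact: og_one.
by rewrite exprS; exact: (og_mul GA IH).
Qed.

(* Sampling the group along the powers z_j ^ floor(t / d_j) and using closedness. *)
Lemma lie_alg_limit (z : nat -> 'M[R]_n) (d : nat -> R) X :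
  (forall j, og_set G (z j)) -> (forall j, 0 < d j) -> d @ \oo --> 0 ->
  (fun j => (d j)^-1 *: (z j - 1%:M)) @ \oo --> X -> lie_alg G X.
Proof.
move=> Gz d_gt0 d0 zX.
have pos (t : R) : 0 < t -> og_set G (expmx (t *: X)).
  move=> t0; pose k j := Num.truncn (t / d j).
  have kP j : (k j)%:R <= t / d j < (k j).+1%:R.
    by apply: truncn_itv; rewrite divr_ge0// ltW.
  have dV : (fun j => t / d j) @ \oo --> +oo.
    apply/gtr0_cvgV0; first by near=> j; rewrite divr_gt0.
    suff : (fun j => (t / d j)^-1) @ \oo --> 0 by [].
    rewrite (_ : (fun j => (t / d j)^-1) = fun j => t^-1 * d j).
      by rewrite -[0](mulr0 t^-1); apply: cvgMr.
    by apply/funext => j /=; rewrite invf_div mulrC.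
  have koo : k @ \oo --> \oo.
    move=> P [N _ NP]; move/cvgryPge : dV => /(_ N.+1%:R); apply: filterS => j Nj.
    apply: NP => /=; rewrite -ltnS; have /andP[_] := kP j.
    by move/(le_lt_trans Nj); rewrite ltr_nat => /ltnW.
  have kd : (fun j => (k j)%:R * d j) @ \oo --> t.
    have td : (fun j => t - d j) @ \oo --> t.
      by rewrite -[X in _ --> X]subr0; apply: cvgB => //; exact: cvg_cst.
    apply: (squeeze_cvgr _ td (cvg_cst t)); near=> j.
    have /andP[k1 k2] := kP j; apply/andP; split.
      rewrite lerBlDr -[X in _ + X]mul1r -mulrDl natr1 -ler_pdivrMr//; exact: ltW.
    by rewrite -ler_pdivlMr.
  have H : (fun j => (1%:M + (k j)%:R^-1 *: ((k j)%:R *: (z j - 1%:M))) ^+ k j) @ \oo -->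
      expmx (t *: X).
    apply: cvg_compound_expmx => //.
    rewrite (_ : (fun j => _) = fun j => ((k j)%:R * d j) *: ((d j)^-1 *: (z j - 1%:M))).
      exact: cvgZ.
    by apply/funext => j; rewrite scalerA mulfK// gt_eqF.
  apply: (closed_cvg _ Gclosed _ _ H).
  near=> j; have k0 : (0 < k j)%N by near: j; apply: (koo (fun m => (0 < m)%N)); exists 1%N.
  rewrite scalerA mulVf ?pnatr_eq0 -?lt0n// scale1r addrC subrK.
  exact: og_exp.
move=> t; case: (ltgtP 0 t) => [/pos//|t0|<-]; last by rewrite scale0r expmx0; exact: og_one.
have /og_inv : og_set G (expmx ((- t) *: X)) by apply: pos; rewrite oppr_gt0.
rewrite (_ : invmx _ = expmx (t *: X))//.
have := expmxN ((- t) *: X); rewrite scaleNr opprK => E.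
by have [u _] := mulmx1_unit E; rewrite -[LHS]mulmx1 -E mulKmx.
Unshelve. all: by end_near. Qed.

Lemma lie_alg_oppZ (a : R) X : lie_alg G X -> lie_alg G (a *: X).
Proof. by move=> gX t; rewrite scalerA. Qed.

Lemma lie_alg_expmx X : lie_alg G X -> og_set G (expmx X).
Proof. by move=> /(_ 1); rewrite scale1r. Qed.

Let h j : R := j.+1%:R^-1.
Let h_gt0 j : 0 < h j. Proof. by rewrite invr_gt0. Qed.
Let h_neq0 j : h j != 0. Proof. by rewrite gt_eqF. Qed.
Let h_cvg : h @ \oo --> 0. Proof. exact: cvg_harmonic. Qed.

Let e X j := expmx (h j *: X).
Let eD X : (fun j => (h j)^-1 *: (e X j - 1%:M)) @ \oo --> X.
Proof. exact: expmx_deriv. Qed.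
Let e1 X : e X @ \oo --> (1%:M : 'M[R]_n).
Proof.
have : (fun j => h j *: ((h j)^-1 *: (e X j - 1%:M)) + 1%:M) @ \oo --> 0 *: X + 1%:M.
  by apply: cvgD; [apply: cvgZ | exact: cvg_cst].
rewrite scale0r add0r; apply: cvg_ext => j.
by rewrite scalerA mulfV// scale1r subrK.
Qed.
Let eG X j : lie_alg G X -> og_set G (e X j).
Proof. by move=> gX; apply: lie_alg_expmx; exact: lie_alg_oppZ. Qed.

(** [exp(hX) exp(hY)] lies in the group and its difference quotients tend to [X + Y]. Brackets and
    conjugates are obtained below by the same scheme. *)
Lemma lie_algD X Y : lie_alg G X -> lie_alg G Y -> lie_alg G (X + Y).
Proof.
move=> gX gY; apply: (@lie_alg_limit (fun j => e X j *m e Y j) h) => //.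
  by move=> j; exact: (og_mul (eG j gX) (eG j gY)).
have -> : (fun j => (h j)^-1 *: (e X j *m e Y j - 1%:M)) =
    fun j => ((h j)^-1 *: (e X j - 1%:M)) *m e Y j + (h j)^-1 *: (e Y j - 1%:M).
  apply/funext => j; rewrite -scalemxAl -scalerDr; congr (_ *: _).
  by rewrite mulmxBl mul1mx addrA subrK.
by apply: cvgD => //; rewrite -[X in _ --> X]mulmx1; exact: cvg_mulmx.
Qed.

(** The group commutator of [exp(hX)] and [exp(hY)] differs from 1 only at order h^2, so the step is
    [h j ^+ 2] here. *)
Lemma lie_alg_bracket X Y : lie_alg G X -> lie_alg G Y -> lie_alg G (mxbracket X Y).
Proof.
move=> gX gY.
apply: (@lie_alg_limit (fun j => e X j *m e Y j *m (e X j)^T *m (e Y j)^T) (fun j => h j ^+ 2)).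
- move=> j; have GX := eG j gX; have GY := eG j gY.
  exact: (og_mul (og_mul (og_mul GX GY) (og_tr GX)) (og_tr GY)).
- by move=> j; rewrite exprn_gt0.
- rewrite -[0](mulr0 0); apply: (@cvg_ext _ _ _ (fun j => h j * h j)) => [j|].
    by rewrite expr2.
  exact: cvgM.
have -> : (fun j => (h j ^+ 2)^-1 *: (e X j *m e Y j *m (e X j)^T *m (e Y j)^T - 1%:M)) =
   fun j => (((h j)^-1 *: (e X j - 1%:M)) *m ((h j)^-1 *: (e Y j - 1%:M)) -
             ((h j)^-1 *: (e Y j - 1%:M)) *m ((h j)^-1 *: (e X j - 1%:M))) *m
     ((e X j)^T *m (e Y j)^T).
  by apply/funext => j; apply: commutator_rescale; apply: og_mulT; exact: eG.
rewrite -[mxbracket X Y]mulmx1; apply: cvg_mulmx.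
  by apply: cvgB; apply: cvg_mulmx.
by rewrite -[1%:M](mulmx1) -{1}trmx1 -{2}trmx1; apply: cvg_mulmx; apply: cvg_trmx.
Qed.

Lemma lie_alg_conj A X : og_set G A -> lie_alg G X -> lie_alg G (A *m X *m A^T).
Proof.
move=> GA gX; apply: (@lie_alg_limit (fun j => A *m e X j *m A^T) h) => //.
  by move=> j; exact: (og_mul (og_mul GA (eG j gX)) (og_tr GA)).
have -> : (fun j => (h j)^-1 *: (A *m e X j *m A^T - 1%:M)) =
    fun j => A *m ((h j)^-1 *: (e X j - 1%:M)) *m A^T.
  apply/funext => j; rewrite -scalemxAr -scalemxAl mulmxBr mulmxBl mulmx1.
  by rewrite og_mulT.
by apply: cvg_mulmx; [apply: cvg_mulmx => // |]; exact: cvg_cst.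
Qed.

(** Orthogonality gives [(e^T - 1)/h = - ((e - 1)/h) e^T] for [e = exp(hX)]; let h tend to 0. *)
Lemma lie_alg_skew X : lie_alg G X -> X^T = - X.
Proof.
move=> gX.
have H1 : (fun j => (h j)^-1 *: ((e X j)^T - 1%:M)) @ \oo --> X^T.
  apply: (@cvg_ext _ _ _ (fun j => ((h j)^-1 *: (e X j - 1%:M))^T)) => [j|]; last exact: cvg_trmx.
  by rewrite linearZ linearB/= trmx1.
have H2 : (fun j => (h j)^-1 *: ((e X j)^T - 1%:M)) @ \oo --> - X.
  rewrite (_ : (fun j => _) = fun j => - ((h j)^-1 *: (e X j - 1%:M) *m (e X j)^T)).
    apply: cvgN; rewrite -[X in _ --> X]mulmx1 -{2}trmx1.
    by apply: cvg_mulmx => //; exact: cvg_trmx.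
  apply/funext => j; rewrite -scalemxAl -scalerN mulmxBl mul1mx og_mulT; last exact: eG.
  by rewrite opprB.
exact: (cvg_unique _ H1 H2).
Qed.

End ClosedGroup.

(** * Orbit spaces through invariant maps *)

Lemma continuous_entry (R : realType) (T : topologicalType) m n
    (f : T -> 'M[R]_(m, n)) i j :
  continuous f -> continuous (fun x => f x i j).
Proof.
by move=> fc x; exact: (continuous_cvg _ (@coord_continuous R m n i j (f x)) (fc x)).
Qed.

Section RealValued.
Context (R : realType) (T : topologicalType).
Implicit Types f g : T -> R.

Lemma continuous_add f g : continuous f -> continuous g -> continuous (fun x => f x + g x).
Proof. by move=> fc gc x; apply: (@cvgD _ _ _ _ (nbhs_filter x)); [exact: fc | exact: gc]. Qed.

Lemma continuous_sub f g : continuous f -> continuous g -> continuous (fun x => f x - g x).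
Proof. by move=> fc gc x; apply: (@cvgB _ _ _ _ (nbhs_filter x)); [exact: fc | exact: gc]. Qed.

Lemma continuous_mul f g : continuous f -> continuous g -> continuous (fun x => f x * g x).
Proof. by move=> fc gc x; apply: (@cvgM _ _ _ (nbhs_filter x)); [exact: fc | exact: gc]. Qed.

End RealValued.

Lemma continuous_cst (T U : topologicalType) (k : U) : continuous (fun _ : T => k).
Proof. by move=> x; exact: cvg_cst. Qed.

Lemma continuous_idfun (T : topologicalType) : continuous (fun x : T => x).
Proof. by move=> x; exact: cvg_id. Qed.

Lemma continuous_mulmx (R : realType) (T : topologicalType) m n p
    (f : T -> 'M[R]_(m, n)) (g : T -> 'M[R]_(n, p)) :
  continuous f -> continuous g -> continuous (fun x => f x *m g x).
Proof. by move=> fc gc x; apply: (cvg_mulmx (nbhs_filter x)); [exact: fc | exact: gc]. Qed.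

Lemma continuous_mx (R : realType) (T : topologicalType) m n (f : T -> 'M[R]_(m, n)) :
  (forall i j, continuous (fun x => f x i j)) -> continuous f.
Proof. by move=> fc x; apply/(cvg_mxP (nbhs_filter x)) => i j; exact: fc. Qed.

(** Heine-Borel, transported from row vectors along [vec_mx]. *)
Lemma mx_bounded_closed_compact (R : realType) m n (A : set 'M[R]_(m, n)) (K : R) :
  (forall x, A x -> forall i j, `|x i j| <= K) -> closed A -> compact A.
Proof.
move=> AK Acl.
have vc : continuous (vec_mx : 'rV[R]_(m * n) -> 'M[R]_(m, n)).
  apply: continuous_mx => i j.
  rewrite (_ : (fun x => _) = fun x : 'rV[R]_(m * n) => x 0 (mxvec_index i j)); last first.
    by apply/funext => x; rewrite mxE.
  exact: coord_continuous.
have -> : A = vec_mx @` (vec_mx @^-1` A).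
  rewrite eqEsubset; split => [x Ax|_ [v Av <-]//].
  by exists (mxvec x); rewrite /= mxvecK.
apply: continuous_compact; first exact: continuous_subspaceT.
apply: bounded_closed_compact; last exact: (closed_comp _ Acl).
exists `|K|; split; first exact: num_real.
move=> M KM v /= Av; rewrite [leLHS]/Num.Def.normr/= mx_normrE.
have M0 : 0 <= M by apply: le_trans (ltW KM).
apply: bigmax_le => // -[i j] _ /=; rewrite ord1 -[v]vec_mxK.
have [p q] := mxvec_indexP j; rewrite mxvecE.
by apply: le_trans (AK _ Av p q) (le_trans (ler_norm K) (ltW KM)).
Qed.

Lemma ltr_mxnorm (R : realType) m n (x : 'M[R]_(m, n)) e : 0 < e ->
  (forall i j, `|x i j| < e) -> `|x| < e.
Proof.
move=> e0 H; rewrite [ltLHS]/Num.Def.normr/= mx_normrE.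
by apply: bigmax_lt => // -[i j] _; exact: H.
Qed.

Section OrbitSpaceHomeomorphism.
Local Open Scope quotient_scope.

(** Properness makes [F] a closed map. Closedness with dense image gives surjectivity, and it also
    gives continuity of the inverse, since the quotient topology is tested on closed sets. *)
Lemma invariant_map_homeomorphic (R : realType) n m (G : orthoGroup R n)
    (F : 'cV[R]_n -> 'cV[R]_m) :
  continuous F ->
  (forall u v, F u = F v <-> exists2 A, og_set G A & A *m u = v) ->
  (forall K : R, exists K' : R, forall u, (forall i, `|F u i 0| <= K) -> forall i, `|u i 0| <= K') ->
  (forall (y : 'cV[R]_m) (e : R), 0 < e -> exists u, forall i, `|F u i 0 - y i 0| < e) ->
  homeomorphic (orbit_space G) 'cV[R]_m.
Proof.
move=> Fc fib prop dens.
have Fclosed C : closed C -> closed (F @` C).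
  move=> Ccl y yC.
  (* Only points of [C] mapped into the unit ball around [y] matter for closure at [y]; they all lie
     in this compact piece. *)
  pose D := C `&` [set u | forall i, `|F u i 0| <= `|y| + 1].
  have Dcl : closed D.
    apply: closedI => //.
    rewrite (_ : [set u | _] = \bigcap_(i in setT) [set u | `|F u i 0| <= `|y| + 1]).
      apply: closed_bigI => i _.
      apply: (@closed_comp _ _ (fun u => `|F u i 0|) [set x | x <= `|y| + 1]); last exact: closed_le.
      have Hc : continuous (fun u => F u i 0) by exact: continuous_entry.
      by move=> u _; apply: cvg_norm; [exact: nbhs_filter | exact: Hc].
    by rewrite eqEsubset; split => u /= H i; [move=> _; exact: H | exact: (H i)].
  have [K' HK'] := prop (`|y| + 1).
  have Dco : compact D.
    apply: (@mx_bounded_closed_compact _ _ _ _ K') => // u [_ uD] i j.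
    by rewrite ord1; exact: HK'.
  have FDcl : closed (F @` D).
    apply: compact_closed; first exact: norm_hausdorff.
    by apply: continuous_compact => //; exact: continuous_subspaceT.
  have : closure (F @` D) y.
    move=> U Uy; have [] := yC (U `&` ball y 1).
      by apply: filterI => //; exact: nbhsx_ballx.
    move=> _ [[u Cu <-] [UFu Bu]]; exists (F u); split => //; exists u => //; split => // i.
    have := Bu; rewrite -ball_normE /= => B.
    have {}B : `|F u - y| <= 1 by rewrite distrC ltW.
    have -> : F u i 0 = (F u - y) i 0 + y i 0 by rewrite !mxE subrK.
    apply: le_trans (ler_normD _ _) _; rewrite addrC; apply: lerD.
      exact: entry_le_mxnorm.
    exact: le_trans (entry_le_mxnorm _ _ _) B.
  by move=> /FDcl [u [Cu _] <-]; exists u.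
have Fsurj y : exists u, F u = y.
  have [] : (F @` setT) y; last by move=> u _; exists u.
  apply: (Fclosed setT); first exact: closedT.
  move=> U /nbhs_ballP [e e0 eU]; have [u Hu] := dens y e e0.
  exists (F u); split; first by exists u.
  apply: eU; rewrite -ball_normE/=; apply: ltr_mxnorm => // i j.
  by rewrite ord1 !mxE distrC; exact: Hu.
pose Q := quotient_topology {eq_quot orbit_equiv G}.
have piE u v : \pi_Q u = \pi_Q v <-> F u = F v.
  rewrite fib; split.
    by move/eqquotP => /asboolP.
  by move=> H; apply/eqquotP/asboolP.
have reprE u : F (repr (\pi_Q u)) = F u by apply/piE; rewrite reprK.
(* An arbitrary choice of preimages, in general discontinuous; only the orbit of [h y] enters. *)
pose h y := sval (cid (Fsurj y)).
have hE y : F (h y) = y by rewrite /h; case: cid.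
exists (F \o repr : Q -> _), (fun y => \pi_Q (h y)); split.
- apply/quotient_continuous.
  by rewrite (_ : _ \o _ = F)//; apply/funext => u /=; exact: reprE.
- apply/continuous_closedP => C Ccl.
  rewrite (_ : _ @^-1` C = F @` (\pi_Q @^-1` C)).
    by apply: Fclosed; apply: (closed_comp _ Ccl) => u _; exact: pi_continuous.
  rewrite eqEsubset; split => [y /= Cy|_ [u /= Cu <-]]; first by exists (h y).
  by rewrite (_ : \pi_Q _ = \pi_Q u)//; apply/piE.
- by move=> a /=; rewrite -[RHS]reprK; apply/piE.
- by move=> y /=; rewrite reprE.
Qed.

End OrbitSpaceHomeomorphism.

(** * Real algebra of the invariants *)

(* At u_i = r s_i and t_i = rho_i this is 64 r^3 det (v, S v, S^2 v)^2. *)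
Definition gram (R : pzRingType) (u1 u2 t1 t2 : R) : R :=
  (u1 ^+ 2 - t1 ^+ 2) * (u2 ^+ 2 - t2 ^+ 2) * (2 * u1 + u2 + t2) * (2 * u2 + u1 - t1).

Section RealAlgebra.
Context (R : realType).
Implicit Types a b c x y z r u v t s w e K : R.

(** Under the interlacing bounds the four factors are nonnegative, and each increases strictly with
    the [u_i]. *)
Lemma gram_lt u1 u2 v1 v2 t1 t2 : `|t1| <= u1 -> `|t2| <= u2 -> u1 < v1 -> u2 < v2 ->
  gram u1 u2 t1 t2 < gram v1 v2 t1 t2.
Proof.
rewrite !ler_norml => /andP[a1 b1] /andP[a2 b2] uv1 uv2.
have sq (u v t : R) : - u <= t -> t <= u -> u < v ->
    0 <= u ^+ 2 - t ^+ 2 /\ u ^+ 2 - t ^+ 2 < v ^+ 2 - t ^+ 2 by move=> *; split; nra.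
have [A0 AB] := sq _ _ _ a1 b1 uv1; have [C0 CD] := sq _ _ _ a2 b2 uv2.
have E0 := mulr_ge0 A0 C0; have EF := ltr_pM A0 C0 AB CD.
have G0 : 0 <= 2 * u1 + u2 + t2 by lra.
have GH : 2 * u1 + u2 + t2 < 2 * v1 + v2 + t2 by lra.
have I0 := mulr_ge0 E0 G0; have IJ := ltr_pM E0 G0 EF GH.
by rewrite /gram; apply: ltr_pM => //; lra.
Qed.

(** [r * (r - c)] is strictly increasing in [r] where both factors are nonnegative, so [gram_lt]
    forbids two different radii. The [c_i] stand for the invariants r - s_i. *)
Lemma gram_radius_inj r r' c1 c2 t1 t2 :
  0 <= r -> 0 <= r' -> 0 <= r - c1 -> 0 <= r - c2 -> 0 <= r' - c1 -> 0 <= r' - c2 ->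
  `|t1| <= r * (r - c1) -> `|t2| <= r * (r - c2) ->
  `|t1| <= r' * (r' - c1) -> `|t2| <= r' * (r' - c2) ->
  gram (r * (r - c1)) (r * (r - c2)) t1 t2 = gram (r' * (r' - c1)) (r' * (r' - c2)) t1 t2 ->
  r = r'.
Proof.
move=> *; have [rr|rr|//] := ltgtP r r'; exfalso.
  suff : gram (r * (r - c1)) (r * (r - c2)) t1 t2 < gram (r' * (r' - c1)) (r' * (r' - c2)) t1 t2.
    by move=> h; lra.
  by apply: gram_lt => //; nra.
suff : gram (r' * (r' - c1)) (r' * (r' - c2)) t1 t2 < gram (r * (r - c1)) (r * (r - c2)) t1 t2.
  by move=> h; lra.
by apply: gram_lt => //; nra.
Qed.

(** Beyond 10 K + 10 both [u_i = r (r - c_i)] exceed 10 K + 10. Then each [u_i^2 - t_i^2] is at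
    least [64 K^2 + 64] and the linear factors are at least 1. The bound is tuned to beat [64 e^2]
    for [|e| <= K], which yields both properness and the upper end point for the intermediate value
    theorem. *)
Lemma gram_large r c1 c2 t1 t2 K : 0 <= K -> 10 * K + 10 < r ->
  `|t1| <= K -> `|t2| <= K -> `|c1| <= K -> `|c2| <= K ->
  64 * K ^+ 2 + 64 <= gram (r * (r - c1)) (r * (r - c2)) t1 t2.
Proof.
move=> K0 rK; rewrite !ler_norml => /andP[a1 b1] /andP[a2 b2] /andP[a3 b3] /andP[a4 b4].
have u1 : 10 * K + 10 <= r * (r - c1) by nra.
have u2 : 10 * K + 10 <= r * (r - c2) by nra.
set v1 := r * (r - c1) in u1 *; set v2 := r * (r - c2) in u2 *.
have sv v t : 10 * K + 10 <= v -> - K <= t -> t <= K -> 64 * K ^+ 2 + 64 <= v ^+ 2 - t ^+ 2.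
  move=> vK l1 l2; have h1 : t ^+ 2 <= K ^+ 2 by nra.
  have h2 : (10 * K + 10) ^+ 2 <= v ^+ 2 by nra.
  nra.
have A1 := sv _ _ u1 a1 b1.
have A2 : 1 <= v2 ^+ 2 - t2 ^+ 2 by have := sv _ _ u2 a2 b2; nra.
have grow (A B : R) : 64 * K ^+ 2 + 64 <= A -> 1 <= B -> 64 * K ^+ 2 + 64 <= A * B.
  move=> NA B1; apply: (le_trans NA); rewrite ler_peMr//; apply: (le_trans _ NA).
  by rewrite addr_ge0// mulr_ge0// sqr_ge0.
have A3 : 1 <= 2 * v1 + v2 + t2 by lra.
have A4 : 1 <= 2 * v2 + v1 - t1 by lra.
exact: (grow _ _ (grow _ _ (grow _ _ A1 A2) A3) A4).
Qed.

Lemma gram_radius_bounded r c1 c2 t1 t2 e K : 0 <= K ->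
  `|t1| <= K -> `|t2| <= K -> `|c1| <= K -> `|c2| <= K -> `|e| <= K ->
  64 * e ^+ 2 = gram (r * (r - c1)) (r * (r - c2)) t1 t2 -> r <= 10 * K + 10.
Proof.
move=> K0 h1 h2 h3 h4 + E; rewrite ler_norml => /andP[a5 b5].
rewrite leNgt; apply/negP => rK; have := gram_large K0 rK h1 h2 h3 h4.
rewrite -E; nra.
Qed.

(** Intermediate value theorem between r = 0 and a large radius. As [e != 0] the target value is
    positive, which puts the solution in the region where every inequality is strict. *)
Lemma gram_radius_exists c1 c2 t1 t2 e : e != 0 ->
  exists r, [/\ 0 < r, 0 < r - c1, 0 < r - c2,
     `|t1| < r * (r - c1) /\ `|t2| < r * (r - c2) &
      gram (r * (r - c1)) (r * (r - c2)) t1 t2 = 64 * e ^+ 2].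
Proof.
move=> e0.
(* Clipping makes the function vanish until both factors become positive. *)
pose pos y : R := (y + `|y|) / 2.
have pos_ge0 y : 0 <= pos y.
  by rewrite divr_ge0// -lerBlDl sub0r -normrN ler_norm.
have posE y : 0 < pos y -> 0 < y.
  by rewrite /pos; case: (ger0P y) => [y0 h|_]; lra.
have pos_id y : 0 < y -> pos y = y.
  by move=> y0; rewrite /pos gtr0_norm//; lra.
have pos_cont (f : R -> R) : continuous f -> continuous (fun r => pos (f r)).
  move=> fc r; apply: cvgMl; apply: cvgD; first exact: fc.
  by apply: cvg_norm; exact: fc.
(* This stands for the factor [u - |t|] of [u^2 - t^2] with [u = r (r - c)]; the cofactors [u + |t|]
   appear in [g]. *)
pose m c t r := pos (r * pos (r - c) - `|t|).
pose g r := m c1 t1 r * m c2 t2 r *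
  ((r * (r - c1) + `|t1|) * (r * (r - c2) + `|t2|) *
   (2 * (r * (r - c1)) + r * (r - c2) + t2) * (2 * (r * (r - c2)) + r * (r - c1) - t1)).
pose K : R := `|c1| + `|c2| + `|t1| + `|t2| + `|e|.
have K0 : 0 <= K by rewrite !addr_ge0.
have gc : continuous g.
  have idc : continuous (id : R -> R) by move=> ?; exact: cvg_id.
  have cst k : continuous (fun _ : R => k : R) by move=> ?; exact: cvg_cst.
  have D (f h : R -> R) : continuous f -> continuous h -> continuous (fun r => f r + h r).
    by move=> fc hc r; apply: cvgD; [exact: fc | exact: hc].
  have B (f h : R -> R) : continuous f -> continuous h -> continuous (fun r => f r - h r).
    by move=> fc hc r; apply: cvgB; [exact: fc | exact: hc].
  have M (f h : R -> R) : continuous f -> continuous h -> continuous (fun r => f r * h r).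
    by move=> fc hc r; apply: cvgM; [exact: fc | exact: hc].
  have mc c t : continuous (m c t) by apply: (pos_cont); apply: (B) => //; apply: (M) => //; apply: (pos_cont); exact: (B).
  have uc c : continuous (fun r => r * (r - c)) by apply: (M) => //; exact: (B).
  apply: (M); first exact: (M).
  apply: (M); first apply: (M); first apply: (M); first exact: (D); first exact: (D).
    by apply: (D) => //; apply: (D) => //; apply: (M).
  by apply: (B) => //; apply: (D) => //; apply: (M).
have g0 : g 0 = 0.
  by rewrite /g /m mul0r sub0r /pos normrN normr_id addNr !mul0r.
have mP c t r : 0 <= r -> 0 < m c t r ->
    [/\ 0 < r, 0 < r - c, `|t| < r * (r - c) & m c t r = r * (r - c) - `|t|].
  move=> r0 m0; have := posE _ m0; rewrite subr_gt0 => tr.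
  have : 0 < r * pos (r - c) by apply: le_lt_trans tr.
  move: r0; rewrite le_eqVlt => /orP[/eqP <-|r0]; first by rewrite mul0r ltxx.
  rewrite pmulr_rgt0// => p0; have rc := posE _ p0.
  by move: tr m0; rewrite /m pos_id// => tr _; split => //; rewrite pos_id// subr_gt0.
have gE r : 0 <= r -> 0 < m c1 t1 r -> 0 < m c2 t2 r ->
   gram (r * (r - c1)) (r * (r - c2)) t1 t2 = g r.
  move=> r0 m1 m2; have [_ _ _ E1] := mP _ _ _ r0 m1; have [_ _ _ E2] := mP _ _ _ r0 m2.
  by rewrite /g E1 E2 /gram -(real_normK (num_real t1)) -(real_normK (num_real t2)); ring.
have gP r : 0 <= r -> 0 < g r -> [/\ 0 < r, 0 < r - c1, 0 < r - c2,
     `|t1| < r * (r - c1) /\ `|t2| < r * (r - c2) &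
      gram (r * (r - c1)) (r * (r - c2)) t1 t2 = g r].
  move=> r0 gr.
  have m1 : 0 < m c1 t1 r.
    by rewrite lt_def pos_ge0 andbT; apply: contraTneq gr; rewrite /g => ->; rewrite !mul0r ltxx.
  have m2 : 0 < m c2 t2 r.
    by rewrite lt_def pos_ge0 andbT; apply: contraTneq gr; rewrite /g => ->; rewrite mulr0 !mul0r ltxx.
  have [? ? ? _] := mP _ _ _ r0 m1; have [_ ? ? _] := mP _ _ _ r0 m2.
  by split => //; exact: gE.
have [c1K c2K] : `|c1| <= K /\ `|c2| <= K.
  by have := (normr_ge0 c1, normr_ge0 c2, normr_ge0 t1, normr_ge0 t2, normr_ge0 e) => -[[[[]]]] *; rewrite /K; split; lra.
have [[t1K t2K] eK] : (`|t1| <= K /\ `|t2| <= K) /\ `|e| <= K.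
  by have := (normr_ge0 c1, normr_ge0 c2, normr_ge0 t1, normr_ge0 t2, normr_ge0 e) => -[[[[]]]] *; rewrite /K; split; [split|]; lra.
(* One unit beyond the threshold of [gram_large], whose hypothesis on the radius is strict. *)
have gK : 64 * e ^+ 2 <= g (10 * K + 11).
  have mK c t : `|c| <= K -> `|t| <= K -> 0 < m c t (10 * K + 11).
    rewrite ler_norml => /andP[cl cu] tK.
    have rc : 0 < 10 * K + 11 - c by lra.
    have h : 0 < (10 * K + 11) * (10 * K + 11 - c) - `|t| by nra.
    by rewrite /m (pos_id _ rc) pos_id.
  rewrite -gE; [|lra|exact: mK|exact: mK].
  have := @gram_large (10 * K + 11) c1 c2 t1 t2 K K0 _ t1K t2K c1K c2K.
  have : e ^+ 2 <= K ^+ 2 by rewrite -(real_normK (num_real e)); have := normr_ge0 e; nra.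
  move=> h1 h2; have := h2 _; nra.
have [] := @IVT R g 0 (10 * K + 11) (64 * e ^+ 2).
- lra.
- by apply: continuous_subspaceT.
- by rewrite g0 ge_min le_max mulr_ge0 ?sqr_ge0//= gK orbT.
move=> r; rewrite in_itv/= => /andP[r0 _] gr; exists r.
have [] := gP r r0; first by rewrite gr mulr_gt0// exprn_even_gt0.
by rewrite gr; split.
Qed.

(* Invariants of the pair (diag(a, b, c), (x, y, z)); disc is r^2 times the
   squared gap between the eigenvalues of the compression of the diagonal
   matrix to the orthogonal of (x, y, z). *)
Definition disc (r p q t : R) : R := p ^+ 2 - 4 * r * (q - t / 2 * r).

Section Diagonal.
Variables (a b c x y z : R).
Hypotheses (tr0 : a + b + c = 0) (ab : b <= a) (bc : c <= b).
Let r := x ^+ 2 + y ^+ 2 + z ^+ 2.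
Let p := a * x ^+ 2 + b * y ^+ 2 + c * z ^+ 2.
Let q := a ^+ 2 * x ^+ 2 + b ^+ 2 * y ^+ 2 + c ^+ 2 * z ^+ 2.
Let t := a ^+ 2 + b ^+ 2 + c ^+ 2.
(** [f Z] is r^2 times the characteristic polynomial, at Z / r, of the compression of diag(a, b, c)
    to the orthogonal of (x, y, z). For a traceless matrix S that compression has trace - p / r, and
    its determinant comes from the adjugate [S^2 - t/2]. The roots [Z1 >= Z2] are thus r z1 and r
    z2, and they still make sense at r = 0. *)
Let f (Z : R) := Z ^+ 2 + p * Z + r * (q - t / 2 * r).
Let w := Num.sqrt (disc r p q t).
Let Z1 := (- p + w) / 2.
Let Z2 := (- p - w) / 2.

Let cE : c = - a - b. Proof. by move: tr0; lra. Qed.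

(** The signs of [f] at r a, r b, r c are +, -, +, which is the source of interlacing. The product
    of the three values contains the squared Vandermonde determinant, hence the squared Krylov
    determinant. *)
Let fa : f (r * a) = r * (x ^+ 2 * (a - b) * (a - c)).
Proof. by rewrite /f /r /q /t /p cE; field. Qed.
Let fb : f (r * b) = - (r * (y ^+ 2 * (a - b) * (b - c))).
Proof. by rewrite /f /r /q /t /p cE; field. Qed.
Let fc : f (r * c) = r * (z ^+ 2 * (a - c) * (b - c)).
Proof. by rewrite /f /r /q /t /p cE; field. Qed.

Let r_ge0 : 0 <= r. Proof. by rewrite !addr_ge0 ?sqr_ge0. Qed.

Let ab_ge0 : 0 <= a - b. Proof. by rewrite subr_ge0. Qed.
Let bc_ge0 : 0 <= b - c. Proof. by rewrite subr_ge0. Qed.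
Let ac_ge0 : 0 <= a - c. Proof. by rewrite subr_ge0 (le_trans bc). Qed.

Let prod_ge0 (A B C : R) : 0 <= B -> 0 <= C -> 0 <= r * (A ^+ 2 * B * C).
Proof. by move=> B0 C0; exact: (mulr_ge0 r_ge0 (mulr_ge0 (mulr_ge0 (sqr_ge0 A) B0) C0)). Qed.

Let fb_le0 : f (r * b) <= 0.
Proof. by rewrite fb oppr_le0 prod_ge0. Qed.

(** The discriminant is [f'(r b)^2 - 4 f(r b)], and [f(r b) <= 0]. *)
Lemma disc_ge0 : 0 <= disc r p q t.
Proof.
have -> : disc r p q t = (2 * (r * b) + p) ^+ 2 - 4 * f (r * b).
  by rewrite /disc /f; ring.
by have := fb_le0; have := sqr_ge0 (2 * (r * b) + p); lra.
Qed.

Let wE : w ^+ 2 = disc r p q t. Proof. by rewrite sqr_sqrtr// disc_ge0. Qed.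

Let fE Z : f Z = (Z - Z1) * (Z - Z2).
Proof.
have -> : (Z - Z1) * (Z - Z2) = Z ^+ 2 + p * Z + (p ^+ 2 - w ^+ 2) / 4.
  by rewrite /Z1 /Z2; field.
by rewrite wE /disc /f; field.
Qed.

Let interlace : [/\ r * b <= Z1, Z1 <= r * a, Z2 <= r * b & r * c <= Z2].
Proof.
have w0 : 0 <= w by rewrite sqrtr_ge0.
have ZZ : Z2 <= Z1 by rewrite /Z1 /Z2; lra.
have rab : r * b <= r * a by rewrite ler_wpM2l.
have rbc : r * c <= r * b by rewrite ler_wpM2l.
have S : Z1 + Z2 = - p by rewrite /Z1 /Z2; field.
(* [f (r a) >= 0] alone would allow both roots to lie above r a; this bound on their sum excludes
   that, and [pg] does the same at r c. *)
have pl : - p <= r * a + r * b.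
  rewrite -subr_ge0 (_ : _ - _ = (a - c) * x ^+ 2 + (b - c) * y ^+ 2).
    by apply: addr_ge0; apply: mulr_ge0; rewrite ?sqr_ge0.
  by rewrite /p /r cE; ring.
have pg : r * b + r * c <= - p.
  rewrite -subr_ge0 (_ : _ - _ = (a - b) * y ^+ 2 + (a - c) * z ^+ 2).
    by apply: addr_ge0; apply: mulr_ge0; rewrite ?sqr_ge0.
  by rewrite /p /r cE; ring.
have Pb : (r * b - Z1) * (r * b - Z2) <= 0 by rewrite -fE.
have Pa : 0 <= (r * a - Z1) * (r * a - Z2).
  by rewrite -fE fa prod_ge0.
have Pc : 0 <= (r * c - Z1) * (r * c - Z2).
  by rewrite -fE fc prod_ge0.
move: (r * a) (r * b) (r * c) rab rbc pl pg Pa Pb Pc => A B C *.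
have B1 : B <= Z1 by rewrite leNgt; apply/negP => ?; nra.
have B2 : Z2 <= B by rewrite leNgt; apply/negP => ?; nra.
split => //; rewrite leNgt; apply/negP => h.
  have : A <= Z2 by rewrite leNgt; apply/negP => ?; nra.
  lra.
have : Z1 <= C by rewrite leNgt; apply/negP => ?; nra.
lra.
Qed.

(** As the trace vanishes, the two expressions are [r a + r b - 2 Z1] and [r b + r c - 2 Z2], that
    is rho_1 and rho_2; interlacing bounds them. *)
Lemma diag_bounds : `|- r * c + p - w| <= r * (a - b) /\ `|- r * a + p + w| <= r * (b - c).
Proof.
have [h1 h2 h3 h4] := interlace.
have -> : - r * c + p - w = r * a + r * b - 2 * Z1 by rewrite /Z1 cE; field.
have -> : - r * a + p + w = r * b + r * c - 2 * Z2 by rewrite /Z2 cE; field.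
by rewrite !ler_norml; split; apply/andP; split; lra.
Qed.

(** In terms of the roots the factors of [gram] are [4 (ra - Z1)(Z1 - rb)], [4 (rb - Z2)(Z2 - rc)],
    [2 (ra - Z2)] and [2 (Z1 - rc)]. Their product is [- 64 f(ra) f(rb) f(rc)]. *)
Lemma diag_gram :
  gram (r * (a - b)) (r * (b - c)) (- r * c + p - w) (- r * a + p + w) =
  64 * (r ^+ 3 * (x * y * z * ((a - b) * (b - c) * (a - c))) ^+ 2).
Proof.
have -> : - r * c + p - w = r * a + r * b - 2 * Z1 by rewrite /Z1 cE; field.
have -> : - r * a + p + w = r * b + r * c - 2 * Z2 by rewrite /Z2 cE; field.
have -> : r ^+ 3 * (x * y * z * ((a - b) * (b - c) * (a - c))) ^+ 2 =
   - (f (r * a) * f (r * b) * f (r * c)) by rewrite fa fb fc; ring.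
by rewrite !fE /gram; ring.
Qed.

End Diagonal.

(** The gaps and the zero trace fix a, b, c; the [t_i] fix the roots of [f]; and the values of [f]
    at r a, r b, r c then give the squares of the coordinates. Strict interlacing makes these
    squares positive. *)
Lemma diag_realize r s1 s2 t1 t2 : 0 < r -> 0 < s1 -> 0 < s2 ->
  `|t1| < r * s1 -> `|t2| < r * s2 ->
  exists a b c x y z, [/\ a + b + c = 0, a - b = s1, b - c = s2 &
    [/\ 0 < x, 0 < y, 0 < z, x ^+ 2 + y ^+ 2 + z ^+ 2 = r &
     let p := a * x ^+ 2 + b * y ^+ 2 + c * z ^+ 2 in
     let q := a ^+ 2 * x ^+ 2 + b ^+ 2 * y ^+ 2 + c ^+ 2 * z ^+ 2 in
     let w := Num.sqrt (disc r p q (a ^+ 2 + b ^+ 2 + c ^+ 2)) in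
     - r * c + p - w = t1 /\ - r * a + p + w = t2]].
Proof.
move=> r0 s10 s20; rewrite !ltr_norml => /andP[l1 u1] /andP[l2 u2].
pose a := (2 * s1 + s2) / 3; pose b := (s2 - s1) / 3; pose c := - (s1 + 2 * s2) / 3.
pose Z1 := (r * (a + b) - t1) / 2; pose Z2 := (r * (b + c) - t2) / 2.
(* Solved from [f (r a) = r x^2 (a - b)(a - c)]; [Y] and [Z] come from r b and r c in the same
   way. *)
pose X := (r * a - Z1) * (r * a - Z2) / (r * (s1 * (s1 + s2))).
pose Y := (Z1 - r * b) * (r * b - Z2) / (r * (s1 * s2)).
pose Z := (Z1 - r * c) * (Z2 - r * c) / (r * (s2 * (s1 + s2))).
have rs1 := mulr_gt0 r0 s10; have rs2 := mulr_gt0 r0 s20.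
have e1 : r * a - Z1 = (r * s1 + t1) / 2 by rewrite /Z1 /a /b; field.
have e2 : r * a - Z2 = r * s1 + (r * s2 + t2) / 2 by rewrite /Z2 /a /b /c; field.
have e3 : Z1 - r * b = (r * s1 - t1) / 2 by rewrite /Z1 /a /b; field.
have e4 : r * b - Z2 = (r * s2 + t2) / 2 by rewrite /Z2 /b /c; field.
have e5 : Z1 - r * c = (r * s1 - t1) / 2 + r * s2 by rewrite /Z1 /a /b /c; field.
have e6 : Z2 - r * c = (r * s2 - t2) / 2 by rewrite /Z2 /b /c; field.
have s12 := addr_gt0 s10 s20.
have X0 : 0 < X by rewrite /X e1 e2; apply: divr_gt0; do ?apply: mulr_gt0 => //; lra.
have Y0 : 0 < Y by rewrite /Y e3 e4; apply: divr_gt0; do ?apply: mulr_gt0 => //; lra.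
have Z0 : 0 < Z by rewrite /Z e5 e6; apply: divr_gt0; do ?apply: mulr_gt0 => //; lra.
have nz : [/\ r != 0, s1 != 0, s2 != 0 & s1 + s2 != 0].
  by split; rewrite gt_eqF// addr_gt0.
exists a, b, c, (Num.sqrt X), (Num.sqrt Y), (Num.sqrt Z).
rewrite !sqr_sqrtr ?ltW// !sqrtr_gt0 X0 Y0 Z0.
have [rn s1n s2n s12n] := nz.
have E1 : X + Y + Z = r.
  rewrite /X /Y /Z /a /b /c; field; rewrite rn s1n s2n s12n//.
have E2 : a * X + b * Y + c * Z = - (Z1 + Z2).
  rewrite /X /Y /Z /a /b /c; field; rewrite rn s1n s2n s12n//.
have E3 : r * (a ^+ 2 * X + b ^+ 2 * Y + c ^+ 2 * Z - (a ^+ 2 + b ^+ 2 + c ^+ 2) / 2 * r) = Z1 * Z2.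
  rewrite /X /Y /Z /a /b /c; field; rewrite rn s1n s2n s12n//.
split; [by rewrite /a /b /c; field | by rewrite /a /b; field | by rewrite /b /c; field |].
split => //=.
rewrite /disc E2 -(mulrA 4) E3.
have -> : (- (Z1 + Z2)) ^+ 2 - 4 * (Z1 * Z2) = (Z1 - Z2) ^+ 2 by ring.
have ZZ : 0 <= Z1 - Z2 by rewrite /Z1 /Z2 /a /b /c; lra.
rewrite sqrtr_sqr ger0_norm//.
by split; rewrite /Z1 /Z2 /a /b /c; field.
Qed.

End RealAlgebra.

(** * Rotations of three-space *)

Section ThreeSpace.
Context (R : realType).
Implicit Types (A B S M : 'M[R]_3) (u v : 'cV[R]_3).

Lemma ord3P (P : 'I_3 -> Prop) : P 0 -> P 1 -> P 2 -> forall i, P i.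
Proof.
move=> P0 P1 P2 [[|[|[|//]]] h].
- by rewrite (_ : Ordinal h = 0)//; exact/val_inj.
- by rewrite (_ : Ordinal h = 1)//; exact/val_inj.
- by rewrite (_ : Ordinal h = 2)//; exact/val_inj.
Qed.

Lemma sum3 (V : nmodType) (F : 'I_3 -> V) : \sum_i F i = F 0 + F 1 + F 2.
Proof.
rewrite !big_ord_recl big_ord0 addr0 addrA; congr (F _ + F _ + F _); exact/val_inj.
Qed.

Definition mx3 (a b c d e f g h k : R) : 'M[R]_3 :=
  \matrix_(i, j) nth 0 (nth [::] [:: [:: a; b; c]; [:: d; e; f]; [:: g; h; k]] i) j.

Definition cv3 (a b c : R) : 'cV[R]_3 := \col_i nth 0 [:: a; b; c] i.

Lemma mx3E a b c d e f g h k (M := mx3 a b c d e f g h k) :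
  (((M 0 0 = a) * (M 0 1 = b) * (M 0 2 = c)) *
   ((M 1 0 = d) * (M 1 1 = e) * (M 1 2 = f)) *
   ((M 2 0 = g) * (M 2 1 = h) * (M 2 2 = k)))%type.
Proof. by rewrite /M; do !split; rewrite mxE. Qed.

Lemma cv3E a b c (v := cv3 a b c) : ((v 0 0 = a) * (v 1 0 = b) * (v 2 0 = c))%type.
Proof. by rewrite /v; do !split; rewrite mxE. Qed.

Lemma mx3_eta M : M = mx3 (M 0 0) (M 0 1) (M 0 2) (M 1 0) (M 1 1) (M 1 2) (M 2 0) (M 2 1) (M 2 2).
Proof. by apply/matrixP; apply: ord3P; apply: ord3P; rewrite mx3E. Qed.

Lemma cv3_eta v : v = cv3 (v 0 0) (v 1 0) (v 2 0).
Proof. by apply/colP; apply: ord3P; rewrite cv3E. Qed.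

Lemma mx3M a b c d e f g h k a' b' c' d' e' f' g' h' k' :
  mx3 a b c d e f g h k *m mx3 a' b' c' d' e' f' g' h' k' =
  mx3 (a * a' + b * d' + c * g') (a * b' + b * e' + c * h') (a * c' + b * f' + c * k')
      (d * a' + e * d' + f * g') (d * b' + e * e' + f * h') (d * c' + e * f' + f * k')
      (g * a' + h * d' + k * g') (g * b' + h * e' + k * h') (g * c' + h * f' + k * k').
Proof. by apply/matrixP; apply: ord3P; apply: ord3P; rewrite mxE sum3 !mx3E. Qed.

Lemma mx3_cv3 a b c d e f g h k x y z :
  mx3 a b c d e f g h k *m cv3 x y z =
  cv3 (a * x + b * y + c * z) (d * x + e * y + f * z) (g * x + h * y + k * z).
Proof. by apply/colP; apply: ord3P; rewrite mxE sum3 !mx3E !cv3E. Qed.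

Lemma mx3T a b c d e f g h k : (mx3 a b c d e f g h k)^T = mx3 a d g b e h c f k.
Proof. by apply/matrixP; apply: ord3P; apply: ord3P; rewrite mxE !mx3E. Qed.

Lemma mx3_1 : 1%:M = mx3 1 0 0 0 1 0 0 0 1.
Proof. by apply/matrixP; apply: ord3P; apply: ord3P; rewrite mxE mx3E. Qed.

Lemma mx3D a b c d e f g h k a' b' c' d' e' f' g' h' k' :
  mx3 a b c d e f g h k + mx3 a' b' c' d' e' f' g' h' k' =
  mx3 (a + a') (b + b') (c + c') (d + d') (e + e') (f + f') (g + g') (h + h') (k + k').
Proof. by apply/matrixP; apply: ord3P; apply: ord3P; rewrite mxE !mx3E. Qed.

Lemma mx3Z t a b c d e f g h k :
  t *: mx3 a b c d e f g h k =
  mx3 (t * a) (t * b) (t * c) (t * d) (t * e) (t * f) (t * g) (t * h) (t * k).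
Proof. by apply/matrixP; apply: ord3P; apply: ord3P; rewrite mxE !mx3E. Qed.

Lemma mx3N a b c d e f g h k :
  - mx3 a b c d e f g h k = mx3 (- a) (- b) (- c) (- d) (- e) (- f) (- g) (- h) (- k).
Proof. by apply/matrixP; apply: ord3P; apply: ord3P; rewrite mxE !mx3E. Qed.

Lemma tr_mx3 a b c d e f g h k : \tr (mx3 a b c d e f g h k) = a + e + k.
Proof. by rewrite /mxtrace sum3 !mx3E. Qed.

Lemma det_mx3 a b c d e f g h k :
  \det (mx3 a b c d e f g h k) =
  a * (e * k - f * h) - b * (d * k - f * g) + c * (d * h - e * g).
Proof.
rewrite (expand_det_row _ 0) sum3 /cofactor !mx3E.
have det2 (M : 'M[R]_2) : \det M = M 0 0 * M 1 1 - M 0 1 * M 1 0.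
  rewrite (expand_det_row _ 0) !big_ord_recl big_ord0 addr0 /cofactor !det_mx11 !mxE/=.
  rewrite expr0 mul1r expr1 mulN1r mulrN.
  by congr (M _ _ * M _ _ - M _ _ * M _ _); exact/val_inj.
rewrite !det2 !mxE/=; ring.
Qed.

Definition dot u v : R := (u^T *m v) 0 0.

Lemma dotE u v : dot u v = u 0 0 * v 0 0 + u 1 0 * v 1 0 + u 2 0 * v 2 0.
Proof. by rewrite /dot mxE sum3 !mxE. Qed.

Lemma dot_ge0 u : 0 <= dot u u.
Proof. by rewrite dotE -!expr2 !addr_ge0 ?sqr_ge0. Qed.

Lemma dot_eq0 u : dot u u = 0 -> u = 0.
Proof.
rewrite dotE -!expr2 => E.
have h0 := sqr_ge0 (u 0 0); have h1 := sqr_ge0 (u 1 0); have h2 := sqr_ge0 (u 2 0).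
have z0 : u 0 0 = 0 by apply/eqP; rewrite -sqrf_eq0; apply/eqP; lra.
have z1 : u 1 0 = 0 by apply/eqP; rewrite -sqrf_eq0; apply/eqP; lra.
have z2 : u 2 0 = 0 by apply/eqP; rewrite -sqrf_eq0; apply/eqP; lra.
by apply/colP; apply: ord3P; rewrite mxE.
Qed.

Lemma dotMl A u v : dot (A *m u) v = dot u (A^T *m v).
Proof. by rewrite /dot trmx_mul mulmxA. Qed.

Definition SO3 : set 'M[R]_3 := [set A | A^T *m A = 1%:M /\ \det A = 1].

Lemma SO3_1 : SO3 1%:M. Proof. by rewrite /SO3/= trmx1 mul1mx det1. Qed.

Lemma SO3_mul A B : SO3 A -> SO3 B -> SO3 (A *m B).
Proof.
move=> [AA dA] [BB dB]; split; last by rewrite det_mulmx dA dB mulr1.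
by rewrite trmx_mul -mulmxA (mulmxA A^T) AA mul1mx.
Qed.

Lemma SO3_mulT A : SO3 A -> A *m A^T = 1%:M.
Proof. by move=> [AA _]; exact: mulmx1C. Qed.

Lemma SO3_tr A : SO3 A -> SO3 A^T.
Proof. by move=> sA; split; [rewrite trmxK SO3_mulT | rewrite det_tr; case: sA]. Qed.

Lemma dot_SO3 A u v : SO3 A -> dot (A *m u) (A *m v) = dot u v.
Proof. by move=> [AA _]; rewrite dotMl mulmxA AA mul1mx. Qed.

Definition rotx (c s : R) := mx3 1 0 0 0 c (- s) 0 s c.
Definition rotz (c s : R) := mx3 c (- s) 0 s c 0 0 0 1.

Lemma rotx_SO3 c s : c ^+ 2 + s ^+ 2 = 1 -> SO3 (rotx c s).
Proof.
move=> cs; split; rewrite /rotx ?det_mx3 ?mx3T ?mx3M ?mx3_1; last by lra.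
by congr mx3; lra.
Qed.

Lemma rotz_SO3 c s : c ^+ 2 + s ^+ 2 = 1 -> SO3 (rotz c s).
Proof.
move=> cs; split; rewrite /rotz ?det_mx3 ?mx3T ?mx3M ?mx3_1; last by lra.
by congr mx3; lra.
Qed.

(** An induction principle for SO(3): rotations about two coordinate axes generate it, so a
    statement stable under products needs checking only on these. *)
Inductive axrot : 'M[R]_3 -> Prop :=
| axrot1 : axrot 1%:M
| axrotx c s A : c ^+ 2 + s ^+ 2 = 1 -> axrot A -> axrot (rotx c s *m A)
| axrotz c s A : c ^+ 2 + s ^+ 2 = 1 -> axrot A -> axrot (rotz c s *m A).

Lemma axrot_SO3 A : axrot A -> SO3 A.
Proof.
elim=> [|c s B cs _ IH|c s B cs _ IH]; first exact: SO3_1.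
- by apply: SO3_mul => //; exact: rotx_SO3.
- by apply: SO3_mul => //; exact: rotz_SO3.
Qed.

Lemma axrot_mul A B : axrot A -> axrot B -> axrot (A *m B).
Proof.
move=> + bB; elim=> [|c s A' cs _ IH|c s A' cs _ IH]; rewrite ?mul1mx -?mulmxA//.
- exact: axrotx.
- exact: axrotz.
Qed.

Lemma axrot_rotx c s : c ^+ 2 + s ^+ 2 = 1 -> axrot (rotx c s).
Proof. by move=> cs; rewrite -[rotx c s]mulmx1; apply: axrotx => //; exact: axrot1. Qed.

Lemma axrot_rotz c s : c ^+ 2 + s ^+ 2 = 1 -> axrot (rotz c s).
Proof. by move=> cs; rewrite -[rotz c s]mulmx1; apply: axrotz => //; exact: axrot1. Qed.

Lemma axrot_tr A : axrot A -> axrot A^T.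
Proof.
elim=> [|c s B cs _ IH|c s B cs _ IH]; first by rewrite trmx1; exact: axrot1.
- rewrite trmx_mul; apply: axrot_mul => //.
  rewrite (_ : (rotx c s)^T = rotx c (- s)); last by rewrite /rotx mx3T opprK.
  by apply: axrot_rotx; rewrite sqrrN.
- rewrite trmx_mul; apply: axrot_mul => //.
  rewrite (_ : (rotz c s)^T = rotz c (- s)); last by rewrite /rotz mx3T opprK.
  by apply: axrot_rotz; rewrite sqrrN.
Qed.

Lemma plane_rotation (y z : R) :
  exists c s, [/\ c ^+ 2 + s ^+ 2 = 1, s * y + c * z = 0 & 0 <= c * y - s * z].
Proof.
have yz : 0 <= y ^+ 2 + z ^+ 2 by rewrite addr_ge0 ?sqr_ge0.
have [E|n0] := eqVneq (y ^+ 2 + z ^+ 2) 0.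
  have hy := sqr_ge0 y; have hz := sqr_ge0 z.
  have y0 : y = 0 by apply/eqP; rewrite -sqrf_eq0; apply/eqP; lra.
  have z0 : z = 0 by apply/eqP; rewrite -sqrf_eq0; apply/eqP; lra.
  by exists 1, 0; rewrite y0 z0 !mulr0 expr1n expr0n/= !addr0 subr0.
set rho := Num.sqrt (y ^+ 2 + z ^+ 2).
have rho2 : rho ^+ 2 = y ^+ 2 + z ^+ 2 by rewrite sqr_sqrtr.
have rho0 : 0 < rho by rewrite sqrtr_gt0 lt_def n0.
have rhon : rho != 0 by rewrite gt_eqF.
exists (y / rho), (- z / rho); split.
- by rewrite !exprMn sqrrN -mulrDl -rho2 -exprMn mulfV// expr1n.
- by field.
- rewrite (_ : _ - _ = (y ^+ 2 + z ^+ 2) / rho); last by field.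
  by rewrite divr_ge0// ltW.
Qed.

(** A rotation about the first axis kills the third coordinate, then one about the third axis kills
    the second. *)
Lemma givens v : exists A, axrot A /\ exists2 rho, 0 <= rho & A *m v = cv3 rho 0 0.
Proof.
have [c [s [cs1 cs2 cs3]]] := plane_rotation (v 1 0) (v 2 0).
have [c' [s' [cs1' cs2' cs3']]] := plane_rotation (v 0 0) (c * v 1 0 - s * v 2 0).
exists (rotz c' s' *m rotx c s); split.
  by apply: axrotz => //; exact: axrot_rotx.
exists (c' * v 0 0 - s' * (c * v 1 0 - s * v 2 0)) => //.
rewrite -mulmxA {1}(cv3_eta v) /rotx /rotz !mx3_cv3; congr cv3; rewrite ?mul1r ?mul0r ?addr0 ?add0r.
- by ring.
- by rewrite -[RHS]cs2'; ring.
- by rewrite -[RHS]cs2; ring.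
Qed.

(** Givens rotations bring the first column to a nonnegative multiple of e1. Orthogonality makes it
    e1 itself, and what remains is a rotation about the first axis. *)
Lemma SO3_axrot A : SO3 A -> axrot A.
Proof.
move=> sA; have [B [aB [rho rho0 Bv]]] := givens (A *m cv3 1 0 0).
have sBA : SO3 (B *m A) := SO3_mul (axrot_SO3 aB) sA.
suff : axrot (B *m A).
  move=> aBA; rewrite -[A]mul1mx; have [<- _] := axrot_SO3 aB.
  by rewrite -mulmxA; apply: axrot_mul => //; exact: axrot_tr.
have Me : (B *m A) *m cv3 1 0 0 = cv3 rho 0 0 by rewrite -mulmxA.
have [MM dM] := sBA; have MMT := SO3_mulT sBA.
move: (B *m A) MM MMT dM Me => {aB Bv sBA} M.
rewrite (mx3_eta M).
move: (M 0 0) (M 0 1) (M 0 2) (M 1 0) (M 1 1) (M 1 2) (M 2 0) (M 2 1) (M 2 2).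
move=> a b c d e f g h k.
rewrite mx3T !mx3M mx3_cv3 mx3_1 det_mx3.
rewrite !mulr1 !mulr0 !addr0 => E1 E2 dM E.
have d0 : d = 0 by move/(congr1 (fun v => v 1 0)) : E; rewrite !cv3E.
have g0 : g = 0 by move/(congr1 (fun v => v 2 0)) : E; rewrite !cv3E.
have ar : a = rho by move/(congr1 (fun v => v 0 0)) : E; rewrite !cv3E.
have e11 := congr1 (fun M => M 0 0) E1; have e12 := congr1 (fun M => M 0 1) E1.
have e13 := congr1 (fun M => M 0 2) E1; have e22 := congr1 (fun M => M 1 1) E1.
have e23 := congr1 (fun M => M 1 2) E1; have e33 := congr1 (fun M => M 2 2) E1.
have f22 := congr1 (fun M => M 1 1) E2.
rewrite !mx3E d0 g0 in e11 e12 e13 e22 e23 e33 f22.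
have a1 : a = 1 by rewrite ar in e11 *; nra.
have b0 : b = 0 by rewrite a1 in e12; lra.
have c0 : c = 0 by rewrite a1 in e13; lra.
rewrite a1 b0 c0 d0 g0 in e22 e23 e33 f22 dM *.
have det1 : e * k - f * h = 1 by lra.
(* The two column norms add up to 2 and the determinant, counted twice, subtracts 2. *)
have sq0 : (e - k) ^+ 2 + (f + h) ^+ 2 = 0 by lra.
have h1 := sqr_ge0 (e - k); have h2 := sqr_ge0 (f + h).
have /eqP : (e - k) ^+ 2 = 0 by lra.
have /eqP : (f + h) ^+ 2 = 0 by lra.
rewrite !sqrf_eq0 subr_eq0 addr_eq0 => /eqP fh /eqP ek.
rewrite fh -ek; rewrite -/(rotx e h); apply: axrot_rotx.
by lra.
Qed.

End ThreeSpace.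

(** * The largest eigenvalue *)

Section TopEigenvalue.
Context (R : realType).
Implicit Types (A B S : 'M[R]_3) (u v : 'cV[R]_3) (M : R).

Lemma continuous_dot (T : topologicalType) (f g : T -> 'cV[R]_3) :
  continuous f -> continuous g -> continuous (fun x => dot (f x) (g x)).
Proof.
move=> fc gc; rewrite (_ : (fun x => _) =
  fun x => f x 0 0 * g x 0 0 + f x 1 0 * g x 1 0 + f x 2 0 * g x 2 0); last first.
  by apply/funext => x; exact: dotE.
by do !apply: continuous_add; apply: continuous_mul; exact: continuous_entry.
Qed.

Definition quad S v := dot v (S *m v).

(** The maximum of the Rayleigh quotient, for symmetric [S] the largest eigenvalue. This variational
    form gives continuity and invariance without choosing eigenvectors; the smallest eigenvalue is
    obtained as [- lam (- S)]. *)
Definition is_top S M := (forall v, quad S v <= M * dot v v) /\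
  exists2 v, v != 0 & quad S v = M * dot v v.

Lemma dot_gt0 v : v != 0 -> 0 < dot v v.
Proof.
by move=> v0; rewrite lt_def dot_ge0 andbT; apply: contra_neq v0; exact: dot_eq0.
Qed.

Lemma quadZ S (t : R) v : quad S (t *: v) = t ^+ 2 * quad S v.
Proof. by rewrite /quad /dot linearZ -scalemxAl -!scalemxAr !mxE expr2 mulrA. Qed.

Lemma dotZ (t : R) v : dot (t *: v) (t *: v) = t ^+ 2 * dot v v.
Proof. by rewrite !dotE !mxE; ring. Qed.

Lemma top_exists S : exists M, is_top S M.
Proof.
pose D := [set v : 'cV[R]_3 | dot v v = 1].
have Dco : compact D.
  apply: (@mx_bounded_closed_compact _ _ _ _ 1).
    move=> v Dv i j; rewrite ord1 {j}.
    suff : v i 0 ^+ 2 <= 1 by move=> h; rewrite ler_norml; apply/andP; split; nra.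
    move: Dv; rewrite /D/= dotE -!expr2 => E.
    have h0 := sqr_ge0 (v 0 0); have h1 := sqr_ge0 (v 1 0); have h2 := sqr_ge0 (v 2 0).
    by move: i; apply: ord3P; lra.
  apply: (@closed_comp _ _ (fun v => dot v v) [set x | x = 1]); last exact: closed_eq.
  by move=> v _; apply: continuous_dot; exact: continuous_idfun.
have D0 : D !=set0 by exists (cv3 1 0 0); rewrite /D/= dotE !cv3E; ring.
have qc : {within D, continuous (quad S)}.
  apply: continuous_subspaceT; apply: continuous_dot; first exact: continuous_idfun.
  by apply: continuous_mulmx; [exact: continuous_cst | exact: continuous_idfun].
have [c] := compact_EVT_max D0 Dco qc.
rewrite inE => Dc cmax; exists (quad S c); split; last first.
  exists c; last by rewrite Dc mulr1.
  by apply: contra_eq_neq Dc => ->; rewrite dotE !mxE !mulr0 !addr0 eq_sym oner_eq0.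
move=> v; have [->|v0] := eqVneq v 0.
  by rewrite /quad !dotE !mxE !mul0r !addr0 mulr0.
have dv := dot_gt0 v0.
pose t := (Num.sqrt (dot v v))^-1.
have t2 : t ^+ 2 * dot v v = 1 by rewrite /t exprVn sqr_sqrtr ?ltW// mulVf// gt_eqF.
have := cmax (t *: v); rewrite inE /D/= dotZ t2 => /(_ erefl); rewrite quadZ => H.
have := ler_wpM2r (ltW dv) H.
by rewrite mulrAC t2 mul1r.
Qed.

Definition lam S : R := xget 0 (is_top S).

Lemma lamP S : is_top S (lam S).
Proof. by have [M HM] := top_exists S; exact: (xgetI 0 HM). Qed.

(** Evaluate at a vector where [S] attains its maximum. The case e = 0 gives uniqueness, and e
    proportional to the norm of the difference gives the Lipschitz bound. *)
Lemma top_le S S' M M' (e : R) : is_top S M -> is_top S' M' ->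
  (forall v, quad S v <= quad S' v + e * dot v v) -> M <= M' + e.
Proof.
move=> [_ [v v0 E]] [H _] SS.
rewrite -(ler_pM2r (dot_gt0 v0)) -E mulrDl.
by apply: le_trans (SS v) _; rewrite lerD2r.
Qed.

Lemma lam_eq S M : is_top S M -> lam S = M.
Proof.
move=> H; have L := lamP S; have z v : quad S v <= quad S v + 0 * dot v v.
  by rewrite mul0r addr0.
by apply/eqP; rewrite eq_le -[X in _ <= X]addr0 (top_le L H z) -[X in _ <= X]addr0 (top_le H L z).
Qed.

Lemma quad_conj A S v : quad (A *m S *m A^T) v = quad S (A^T *m v).
Proof. by rewrite /quad -!mulmxA [RHS]dotMl trmxK. Qed.

Lemma lam_SO3 A S : SO3 A -> lam (A *m S *m A^T) = lam S.
Proof.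
move=> sA; apply: lam_eq; have [H [v v0 E]] := lamP S.
have AA := SO3_mulT sA; have [AtA _] := sA.
split; first by move=> u; rewrite quad_conj -(dot_SO3 u u (SO3_tr sA)).
exists (A *m v); last by rewrite quad_conj mulmxA AtA mul1mx dot_SO3.
by apply: contra_neq v0 => /(congr1 (mulmx A^T)); rewrite mulmxA AtA mul1mx mulmx0.
Qed.

(** Each of the nine terms is at most [|S| (v_i^2 + v_j^2) / 2]; in the sum every [v_i^2] is counted
    three times. *)
Lemma quad_le_norm S v : quad S v <= 3 * `|S| * dot v v.
Proof.
rewrite /quad !dotE !mxE !sum3.
have ent i j : S i j * (v i 0 * v j 0) <= `|S| * ((v i 0 ^+ 2 + v j 0 ^+ 2) / 2).
  apply: le_trans (ler_norm _) _; rewrite normrM; apply: ler_pM => //.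
    exact: entry_le_mxnorm.
  have h1 := sqr_ge0 (v i 0 - v j 0); have h2 := sqr_ge0 (v i 0 + v j 0).
  by rewrite ler_norml; apply/andP; split; lra.
have := (ent 0 0, ent 0 1, ent 0 2, (ent 1 0, ent 1 1, ent 1 2), (ent 2 0, ent 2 1, ent 2 2)).
move=> [[[[h1 h2] h3] [[h4 h5] h6]] [[h7 h8] h9]].
lra.
Qed.

Lemma lam_lipschitz S S' : `|lam S - lam S'| <= 3 * `|S - S'|.
Proof.
have H (A B : 'M[R]_3) : lam A <= lam B + 3 * `|A - B|.
  apply: (top_le (lamP A) (lamP B)) => v.
  rewrite -lerBlDl; apply: le_trans (quad_le_norm _ _).
  by rewrite /quad mulmxBl /dot mulmxBr !mxE.
have H1 := H S S'; have H2 := H S' S; rewrite distrC in H2.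
by rewrite ler_norml; apply/andP; split; lra.
Qed.

Lemma continuous_lam : continuous (lam : 'M[R]_3 -> R).
Proof.
move=> S; apply/(cvgrPdist_lt (FF := nbhs_filter S)) => e e0.
have e3 : 0 < e / 3 by rewrite divr_gt0.
apply/nbhs_ballP; exists (e / 3) => //= S'; rewrite -ball_normE/= => SS'.
by apply: le_lt_trans (lam_lipschitz _ _) _; rewrite mulrC -ltr_pdivlMr.
Qed.

Definition diag3 (a b c : R) := mx3 a 0 0 0 b 0 0 0 c.

Lemma quad_diag3 a b c x y z : quad (diag3 a b c) (cv3 x y z) = a * x ^+ 2 + b * y ^+ 2 + c * z ^+ 2.
Proof. by rewrite /quad mx3_cv3 dotE !cv3E; ring. Qed.

Lemma lam_diag3 a b c : b <= a -> c <= a -> lam (diag3 a b c) = a.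
Proof.
move=> ba ca; apply: lam_eq; split.
  move=> v; rewrite (cv3_eta v) quad_diag3 dotE !cv3E.
  set x := v 0 0; set y := v 1 0; set z := v 2 0.
  have := mulr_ge0 (sqr_ge0 y) (_ : 0 <= a - b); have := mulr_ge0 (sqr_ge0 z) (_ : 0 <= a - c).
  by rewrite !subr_ge0 => /(_ ca) h1 /(_ ba) h2; lra.
exists (cv3 1 0 0); last by rewrite quad_diag3 dotE !cv3E; ring.
by apply/eqP => /(congr1 (fun v => v 0 0)); rewrite cv3E mxE => /eqP; rewrite oner_eq0.
Qed.

Lemma mx3_sym S : S^T = S -> S = mx3 (S 0 0) (S 0 1) (S 0 2) (S 0 1) (S 1 1) (S 1 2) (S 0 2) (S 1 2) (S 2 2).
Proof.
move=> sS; rewrite {1}(mx3_eta S).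
by congr mx3; rewrite -[in LHS]sS mxE.
Qed.

Lemma conj_sym A S : S^T = S -> (A *m S *m A^T)^T = A *m S *m A^T.
Proof. by move=> sS; rewrite !trmx_mul trmxK sS mulmxA. Qed.

(** The first-order condition at a maximum. Testing at [t = k / (|l| + 1)] already forces
    [k^2 <= 0]. *)
Lemma linear_le_quadratic_eq0 (k l : R) : (forall t : R, k * t <= l * t ^+ 2) -> k = 0.
Proof.
move=> H; have l0 : 0 <= `|l| + 1 by rewrite addr_ge0.
have l1 : 0 < `|l| + 1 by rewrite ltr_pwDr.
have := H (k / (`|l| + 1)); rewrite expr_div_n => {}H.
have k2 := sqr_ge0 k.
have : k ^+ 2 / (`|l| + 1) <= `|l| * (k ^+ 2 / (`|l| + 1) ^+ 2).
  rewrite {1}expr2 -mulrA; apply: (le_trans H).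
  by rewrite ler_wpM2r ?ler_norm// divr_ge0// sqr_ge0.
have -> : k ^+ 2 / (`|l| + 1) = (`|l| + 1) * (k ^+ 2 / (`|l| + 1) ^+ 2).
  by field; rewrite gt_eqF.
rewrite -subr_ge0 -mulrBl opprD addrA subrr sub0r mulN1r oppr_ge0.
rewrite pmulr_lle0 ?invr_gt0 ?exprn_gt0// => h.
by apply/eqP; rewrite -sqrf_eq0 eq_le h k2.
Qed.

(** With e = (a - b)/2 and rho^2 = e^2 + d^2, the vector (rho + e, d) is an eigenvector, for rho, of
    the traceless part (e, d; d, -e); normalizing it gives (c, s). It vanishes only if d = 0 and a
    <= b, where a quarter turn exchanges the axes. *)
Lemma plane_diagonalization (a b d : R) : exists c s, [/\ c ^+ 2 + s ^+ 2 = 1,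
  (c ^+ 2 - s ^+ 2) * d + c * s * (b - a) = 0 &
  0 <= (c ^+ 2 - s ^+ 2) * (a - b) + 4 * c * s * d].
Proof.
pose e := (a - b) / 2; pose rho := Num.sqrt (e ^+ 2 + d ^+ 2).
have rho2 : rho ^+ 2 = e ^+ 2 + d ^+ 2 by rewrite sqr_sqrtr// addr_ge0 ?sqr_ge0.
have rho0 : 0 <= rho by rewrite sqrtr_ge0.
have re : 0 <= rho + e.
  have := sqr_ge0 d => d2; rewrite leNgt; apply/negP => h; nra.
have abe : a - b = 2 * e by rewrite /e; field.
have bae : b - a = - 2 * e by rewrite /e; field.
rewrite abe bae.
have [N0|Nn0] := eqVneq ((rho + e) ^+ 2 + d ^+ 2) 0.
  have h1 := sqr_ge0 (rho + e); have h2 := sqr_ge0 d.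
  have d0 : d = 0 by apply/eqP; rewrite -sqrf_eq0; apply/eqP; lra.
  have re0 : rho + e = 0 by apply/eqP; rewrite -sqrf_eq0; apply/eqP; lra.
  exists 0, 1; rewrite d0; split; [by ring | by ring | lra].
set N := (rho + e) ^+ 2 + d ^+ 2 in Nn0.
have N0 : 0 < N by rewrite lt_def Nn0 addr_ge0 ?sqr_ge0.
pose m := Num.sqrt N.
have m2 : m ^+ 2 = N by rewrite sqr_sqrtr// ltW.
have mn : m != 0 by rewrite gt_eqF// sqrtr_gt0.
exists ((rho + e) / m), (d / m); split.
- by rewrite !expr_div_n -mulrDl m2 mulfV.
- have -> : (((rho + e) / m) ^+ 2 - (d / m) ^+ 2) * d + (rho + e) / m * (d / m) * (-2 * e) =
     d * (rho ^+ 2 - (e ^+ 2 + d ^+ 2)) / m ^+ 2 by field.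
  by rewrite rho2 subrr mulr0 mul0r.
- have -> : (((rho + e) / m) ^+ 2 - (d / m) ^+ 2) * (2 * e) + 4 * ((rho + e) / m) * (d / m) * d =
     2 * ((rho + e) * (e * (rho + e) + 2 * d ^+ 2) - e * d ^+ 2) / m ^+ 2 by field.
  have d2 : d ^+ 2 = (rho - e) * (rho + e) by rewrite -subr_sqr rho2; ring.
  have -> : (rho + e) * (e * (rho + e) + 2 * d ^+ 2) - e * d ^+ 2 =
     (rho + e) * (2 * (e ^+ 2 + d ^+ 2)).
    by rewrite [X in _ - e * X]d2; ring.
  rewrite divr_ge0 ?sqr_ge0// mulr_ge0// mulr_ge0// mulr_ge0// addr_ge0 ?sqr_ge0//.
Qed.

(** A maximizer of the Rayleigh quotient is rotated to the first axis. The first-order conditions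
    there kill the entries (0,1) and (0,2), and a rotation about this axis diagonalizes the
    remaining 2 by 2 block. *)
Lemma spectral3 S : S^T = S -> exists A, SO3 A /\
  exists a b c, [/\ A *m S *m A^T = diag3 a b c, b <= a & c <= b].
Proof.
move=> sS; have [H [u u0 E]] := lamP S.
have [B [/axrot_SO3 sB [rho rho0 Bu]]] := givens u.
have sT := conj_sym B sS; set T := B *m S *m B^T in sT.
have HT v : quad T v <= lam S * dot v v.
  by rewrite quad_conj -(dot_SO3 v v (SO3_tr sB)).
have rhon : rho != 0.
  apply: contra_neq u0 => r0; have [BB _] := sB.
  rewrite -[u]mul1mx -BB -mulmxA Bu r0.
  by rewrite (_ : cv3 0 0 0 = 0) ?mulmx0//; apply/colP; apply: ord3P; rewrite cv3E mxE.
have T00 : T 0 0 = lam S.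
  have : quad T (cv3 rho 0 0) = lam S * dot (cv3 rho 0 0) (cv3 rho 0 0).
    rewrite -Bu quad_conj mulmxA; have [BB _] := sB.
    by rewrite BB mul1mx dot_SO3.
  rewrite {1}(mx3_eta T) /quad mx3_cv3 !dotE !cv3E => h.
  apply: (mulfI (mulf_neq0 rhon rhon)); lra.
(* Maximality at the first axis, tested on (1, x, y). *)
have off x y : 2 * (T 0 1 * x + T 0 2 * y) <= (lam S * (x ^+ 2 + y ^+ 2) -
    (T 1 1 * x ^+ 2 + 2 * T 1 2 * x * y + T 2 2 * y ^+ 2)).
  have := HT (cv3 1 x y); rewrite {1}(mx3_sym sT) /quad mx3_cv3 !dotE !cv3E T00; lra.
have T01 : T 0 1 = 0.
  have : 2 * T 0 1 = 0.
    apply: (@linear_le_quadratic_eq0 _ (lam S - T 1 1)) => t.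
    by have := off t 0; rewrite expr2; lra.
  lra.
have T02 : T 0 2 = 0.
  have : 2 * T 0 2 = 0.
    apply: (@linear_le_quadratic_eq0 _ (lam S - T 2 2)) => t.
    by have := off 0 t; rewrite expr2; lra.
  lra.
have [c [s [cs cs0 csp]]] := plane_diagonalization (T 1 1) (T 2 2) (T 1 2).
pose C := rotx c (- s).
have sC : SO3 C by apply: rotx_SO3; rewrite sqrrN.
exists (C *m B); split; first exact: SO3_mul.
have TE := mx3_sym sT; rewrite T00 T01 T02 in TE.
have CT : C *m B *m S *m (C *m B)^T = C *m T *m C^T.
  by rewrite trmx_mul /T !mulmxA.
have CTE : C *m T *m C^T = diag3 (lam S) (c ^+ 2 * T 1 1 + 2 * c * s * T 1 2 + s ^+ 2 * T 2 2)
   (s ^+ 2 * T 1 1 - 2 * c * s * T 1 2 + c ^+ 2 * T 2 2).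
  rewrite TE /C /rotx mx3T !mx3M /diag3 !mx3E; congr mx3; try ring.
  - by rewrite -[RHS]cs0; ring.
  - by rewrite -[RHS]cs0; ring.
exists (lam S), (c ^+ 2 * T 1 1 + 2 * c * s * T 1 2 + s ^+ 2 * T 2 2),
  (s ^+ 2 * T 1 1 - 2 * c * s * T 1 2 + c ^+ 2 * T 2 2).
split; first by rewrite CT.
- have := HT (cv3 0 c s).
  rewrite {1}TE /quad mx3_cv3 !dotE !cv3E.
  have -> : lam S * (0 * 0 + c * c + s * s) = lam S * (c ^+ 2 + s ^+ 2) by ring.
  rewrite cs mulr1; lra.
- lra.
Qed.

End TopEigenvalue.

(** * Invariants of a tensor and a vector *)

Section OrbitInvariant.
Context (R : realType).
Implicit Types (A B S : 'M[R]_3) (u v : 'cV[R]_3).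

Definition krylov S v : 'M[R]_3 := \matrix_(i, j) ((S ^+ j : 'M[R]_3) *m v) i 0.

Definition disc_of S v :=
  disc (dot v v) (dot v (S *m v)) (dot v (S *m S *m v)) (\tr (S *m S)).

(** Zero trace is built into the formulas: the middle eigenvalue is [- a - c], and [- r c], [- r a]
    stand for r (l1 + l2), r (l2 + l3). [w] is r (z1 - z2). *)
Definition invmap S v : 'cV[R]_5 :=
  let r := dot v v in let p := dot v (S *m v) in
  let w := Num.sqrt (disc_of S v) in
  let a := lam S in let c := - lam (- S) in let b := - a - c in
  \col_i nth 0 [:: - r * c + p - w; - r * a + p + w; r - (a - b); r - (b - c);
                   \det (krylov S v) * Num.sqrt r ^+ 3] i.

Lemma krylov_SO3 A S v : SO3 A ->
  krylov (A *m S *m A^T) (A *m v) = A *m krylov S v.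
Proof.
move=> [AA _].
have pow k : (A *m S *m A^T) ^+ k *m (A *m v) = A *m (S ^+ k *m v).
  elim: k => [|k IH]; first by rewrite !expr0 !mul1mx.
  rewrite !exprS -[X in X *m _ = _]/(_ *m _) -[X in _ = _ *m (X *m _)]/(S *m _).
  by rewrite -(mulmxA (A *m S *m A^T)) IH -!mulmxA (mulmxA A^T) AA mul1mx.
by apply/matrixP => i j; rewrite mxE pow [LHS]mxE [RHS]mxE; apply: eq_bigr => k _; rewrite [in RHS]mxE.
Qed.

Lemma invmap_SO3 A S v : SO3 A -> invmap (A *m S *m A^T) (A *m v) = invmap S v.
Proof.
move=> sA; have [AA dA] := sA; have AAT := SO3_mulT sA.
have E1 T u : (A *m T *m A^T) *m (A *m u) = A *m (T *m u).
  by rewrite -!mulmxA (mulmxA A^T) AA mul1mx.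
have E2 : A *m S *m A^T *m (A *m S *m A^T) = A *m (S *m S) *m A^T.
  by rewrite !mulmxA -(mulmxA (A *m S)) AA mulmx1.
have E3 : disc_of (A *m S *m A^T) (A *m v) = disc_of S v.
  by rewrite /disc_of E2 !E1 !dot_SO3// [\tr (A *m _ *m _)]mxtrace_mulC (mulmxA A^T) AA mul1mx.
have E4 : - (A *m S *m A^T) = A *m (- S) *m A^T by rewrite mulmxN mulNmx.
by rewrite /invmap E3 E1 E4 !dot_SO3// !lam_SO3// krylov_SO3// det_mulmx dA mul1r.
Qed.

Lemma diag3_sq a b c : diag3 a b c *m diag3 a b c = diag3 (a ^+ 2) (b ^+ 2) (c ^+ 2) :> 'M[R]_3.
Proof. by rewrite mx3M; congr mx3; ring. Qed.

Lemma det_krylov_diag a b c x y z :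
  \det (krylov (diag3 a b c) (cv3 x y z)) = - (x * y * z * ((a - b) * (b - c) * (a - c))) :> R.
Proof.
have e0 i : ((diag3 a b c) ^+ 0 *m cv3 x y z : 'cV[R]_3) i 0 = cv3 x y z i 0.
  by rewrite expr0 mul1mx.
have e1 i : ((diag3 a b c) ^+ 1 *m cv3 x y z : 'cV[R]_3) i 0 = cv3 (a * x) (b * y) (c * z) i 0.
  by rewrite expr1 mx3_cv3 !mul0r !addr0 !add0r.
have e2 i : ((diag3 a b c) ^+ 2 *m cv3 x y z : 'cV[R]_3) i 0 = cv3 (a ^+ 2 * x) (b ^+ 2 * y) (c ^+ 2 * z) i 0.
  by rewrite expr2 -[X in X *m _]/(_ *m _) diag3_sq mx3_cv3 !mul0r !addr0 !add0r.
have -> : krylov (diag3 a b c) (cv3 x y z) =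
   mx3 x (a * x) (a ^+ 2 * x) y (b * y) (b ^+ 2 * y) z (c * z) (c ^+ 2 * z).
  apply/matrixP => i; apply: ord3P; rewrite mxE ?e0 ?e1 ?e2; move: i; apply: ord3P;
    by rewrite cv3E mx3E.
by rewrite det_mx3; ring.
Qed.

Lemma invmap_diag a b c x y z : a + b + c = 0 -> b <= a -> c <= b ->
  let r := x ^+ 2 + y ^+ 2 + z ^+ 2 in
  let p := a * x ^+ 2 + b * y ^+ 2 + c * z ^+ 2 in
  let q := a ^+ 2 * x ^+ 2 + b ^+ 2 * y ^+ 2 + c ^+ 2 * z ^+ 2 in
  let w := Num.sqrt (disc r p q (a ^+ 2 + b ^+ 2 + c ^+ 2)) in
  invmap (diag3 a b c) (cv3 x y z) = \col_i nth 0
   [:: - r * c + p - w; - r * a + p + w; r - (a - b); r - (b - c);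
      - (x * y * z * ((a - b) * (b - c) * (a - c))) * Num.sqrt r ^+ 3] i.
Proof.
move=> tr0 ba cb r p q w.
have rE : dot (cv3 x y z) (cv3 x y z) = r by rewrite dotE !cv3E /r; ring.
have pE : dot (cv3 x y z) (diag3 a b c *m cv3 x y z) = p.
  by rewrite mx3_cv3 dotE !cv3E /p; ring.
have qE : dot (cv3 x y z) (diag3 a b c *m diag3 a b c *m cv3 x y z) = q.
  by rewrite diag3_sq mx3_cv3 dotE !cv3E /q; ring.
have lE : lam (diag3 a b c) = a by rewrite lam_diag3// (le_trans cb).
have lNE : lam (- diag3 a b c) = - c.
  (* [lam_diag3] wants the largest entry first. Each quarter turn swaps two neighbouring entries,
     and three swaps reverse the order. *)
  have -> : - diag3 a b c = rotx 0 1 *m (rotz 0 1 *m (rotx 0 1 *m diag3 (- c) (- b) (- a)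
     *m (rotx 0 1)^T) *m (rotz 0 1)^T) *m (rotx 0 1)^T.
    by rewrite /rotx /rotz !mx3T !mx3M mx3N; congr mx3; ring.
  rewrite !lam_SO3 ?lam_diag3//; rewrite ?lerN2// ?(le_trans cb)//;
    by [apply: rotx_SO3; ring | apply: rotz_SO3; ring].
rewrite /invmap /disc_of rE pE qE diag3_sq tr_mx3 lE lNE opprK -/w.
have -> : - a - c = b by lra.
by rewrite det_krylov_diag.
Qed.

Lemma continuous_det3 (T : topologicalType) (f : T -> 'M[R]_3) :
  continuous f -> continuous (fun x => \det (f x)).
Proof.
move=> fc; have e i j : continuous (fun x => f x i j) by exact: continuous_entry.
rewrite (_ : (fun x => _) = fun x =>
  f x 0 0 * (f x 1 1 * f x 2 2 - f x 1 2 * f x 2 1) -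
  f x 0 1 * (f x 1 0 * f x 2 2 - f x 1 2 * f x 2 0) +
  f x 0 2 * (f x 1 0 * f x 2 1 - f x 1 1 * f x 2 0)); last first.
  by apply/funext => x; rewrite {1}(mx3_eta (f x)) det_mx3.
have m i j k l i' j' k' l' : continuous (fun x => f x i j * f x k l - f x i' j' * f x k' l').
  by apply: continuous_sub; apply: continuous_mul; exact: e.
apply: continuous_add; last by apply: continuous_mul; [exact: e | exact: m].
by apply: continuous_sub; apply: continuous_mul; first [exact: e | exact: m].
Qed.

Lemma continuous_comp_real (T : topologicalType) (f : T -> R) (h : R -> R) :
  continuous f -> continuous h -> continuous (fun x => h (f x)).
Proof. by move=> fc hc x; exact: (continuous_cvg _ (hc (f x)) (fc x)). Qed.

Lemma invmap_continuous (T : topologicalType) (f : T -> 'M[R]_3) (g : T -> 'cV[R]_3) :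
  continuous f -> continuous g -> continuous (fun x => invmap (f x) (g x)).
Proof.
move=> fc gc.
have fg : continuous (fun x => f x *m g x) by exact: continuous_mulmx.
have ff : continuous (fun x => f x *m f x) by exact: continuous_mulmx.
have ffg : continuous (fun x => f x *m f x *m g x) by exact: continuous_mulmx.
have rc : continuous (fun x => dot (g x) (g x)) by exact: continuous_dot.
have pc : continuous (fun x => dot (g x) (f x *m g x)) by exact: continuous_dot.
have qc : continuous (fun x => dot (g x) (f x *m f x *m g x)) by exact: continuous_dot.
have tc : continuous (fun x => \tr (f x *m f x)).
  rewrite (_ : (fun x => _) = fun x => (f x *m f x) 0 0 + (f x *m f x) 1 1 + (f x *m f x) 2 2).
    by do !apply: continuous_add; exact: continuous_entry.
  by apply/funext => x; rewrite /mxtrace sum3.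
have wc : continuous (fun x => Num.sqrt (disc_of (f x) (g x))).
  apply: (continuous_comp_real _ (@sqrt_continuous R)); rewrite /disc_of /disc.
  apply: continuous_sub; first by apply: continuous_mul.
  apply: continuous_mul; first by apply: continuous_mul => //; exact: continuous_cst.
  by do ![apply: continuous_sub | apply: continuous_mul] => //; exact: continuous_cst.
have ac : continuous (fun x => lam (f x)).
  by move=> x; exact: (continuous_cvg _ (@continuous_lam R (f x)) (fc x)).
have cc : continuous (fun x => - lam (- f x)).
  move=> x; apply: (@cvgN _ _ _ _ (nbhs_filter x)).
  apply: (continuous_cvg _ (@continuous_lam R (- f x))).
  by apply: (@cvgN _ _ _ _ (nbhs_filter x)); exact: fc.
have dc : continuous (fun x => \det (krylov (f x) (g x))).
  apply: continuous_det3; apply: continuous_mx => i j.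
  under eq_fun do rewrite mxE.
  apply: continuous_entry; apply: continuous_mulmx => //.
  elim: (j : nat) => [|k IH]; first by under eq_fun do rewrite expr0; exact: continuous_cst.
  by under eq_fun do rewrite exprS; exact: continuous_mulmx.
have sc : continuous (fun x => Num.sqrt (dot (g x) (g x))).
  exact: (continuous_comp_real rc (@sqrt_continuous R)).
have oppc (h : T -> R) : continuous h -> continuous (fun x => - h x).
  by move=> hc x; apply: (@cvgN _ _ _ _ (nbhs_filter x)); exact: hc.
have bc : continuous (fun x => - lam (f x) - - lam (- f x)).
  by apply: continuous_sub => //; exact: oppc.
apply: continuous_mx => i j; rewrite /invmap; under eq_fun do rewrite mxE.
case: i => -[|[|[|[|[|//]]]]] /= _.
- by apply: continuous_sub => //; apply: continuous_add => //; apply: continuous_mul => //; exact: oppc.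
- by do 2?apply: continuous_add => //; apply: continuous_mul => //; exact: oppc.
- by do 2?apply: continuous_sub => //.
- by do 2?apply: continuous_sub => //.
- apply: continuous_mul => //; under eq_fun do rewrite !exprS expr0.
  by do 3?apply: continuous_mul => //; exact: continuous_cst.
Qed.

(** The diagonal sign matrices in SO(3) are diag(e1, e2, e1 e2), so two signs are free. The third
    can be chosen as well only when x or y vanishes. *)
Lemma flips (x y z : R) : exists e1 e2, [/\ e1 ^+ 2 = 1, e2 ^+ 2 = 1, 0 <= e1 * x, 0 <= e2 * y &
  x * y = 0 -> 0 <= e1 * e2 * z].
Proof.
have sg t : exists2 e : R, e ^+ 2 = 1 & 0 <= e * t.
  case: (lerP 0 t) => t0; first by exists 1; rewrite ?expr1n ?mul1r.
  by exists (-1); rewrite ?sqrrN ?expr1n// mulN1r oppr_ge0 ltW.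
have [e1 h1 x1] := sg x; have [e2 h2 y2] := sg y.
have [x0|xn] := eqVneq x 0.
  have [e h ze] := sg (e2 * z); exists e, e2; split => //; first by rewrite x0 mulr0.
  by rewrite -mulrA.
have [y0|yn] := eqVneq y 0.
  have [e h ze] := sg (e1 * z); exists e1, e; split => //; first by rewrite y0 mulr0.
  by move=> _; rewrite (mulrC e1) -mulrA.
exists e1, e2; split => //; by move/eqP; rewrite mulf_eq0 (negbTE xn) (negbTE yn).
Qed.

Lemma diag3_SO3 e1 e2 : e1 ^+ 2 = 1 -> e2 ^+ 2 = 1 -> SO3 (diag3 e1 e2 (e1 * e2) : 'M[R]_3).
Proof.
move=> h1 h2; split.
  rewrite /diag3 mx3T mx3M mx3_1; congr mx3; try ring.
  - by rewrite -h1; ring.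
  - by rewrite -h2; ring.
  - by rewrite -[RHS]mulr1 -{1}h1 -h2; ring.
by rewrite det_mx3 -[RHS]mulr1 -{1}h1 -h2; ring.
Qed.

(** Conditions that single out one representative in each orbit. The sign of z stays free when x y
    is nonzero and is then read off the determinant; a repeated eigenvalue lets a rotation of its
    eigenspace remove a coordinate. *)
Definition normal_form (a b c x y z : R) :=
  [/\ b <= a, c <= b, 0 <= x, 0 <= y &
   [/\ x * y = 0 -> 0 <= z, a = b -> y = 0 & b = c -> z = 0]].

(** After diagonalization only the stabilizer of the diagonal matrix may act on the vector: all of
    SO(3), a circle, or sign changes, according to how many eigenvalues coincide. The case split
    follows this. *)
Lemma normal_form_exists S v : S^T = S -> exists A, SO3 A /\
  exists a b c x y z, [/\ A *m S *m A^T = diag3 a b c, A *m v = cv3 x y z &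
    normal_form a b c x y z].
Proof.
move=> sS; have [A [sA [a [b [c [AE ba cb]]]]]] := spectral3 sS.
have conjM (B C T : 'M[R]_3) : B *m C *m T *m (B *m C)^T = B *m (C *m T *m C^T) *m B^T.
  by rewrite trmx_mul !mulmxA.
have step : exists B, SO3 B /\ exists x y z, [/\ B *m diag3 a b c *m B^T = diag3 a b c,
    B *m (A *m v) = cv3 x y z, a = b -> y = 0 & b = c -> z = 0].
  set u := A *m v.
  have [ab|ab] := eqVneq a b; have [bc|bc] := eqVneq b c.
  - have [B [/axrot_SO3 sB [rho _ Bu]]] := givens u.
    exists B; split => //; exists rho, 0, 0; split => //.
    rewrite -ab -bc -ab (_ : diag3 a a a = a%:M).
      by rewrite mul_mx_scalar -scalemxAl (SO3_mulT sB) scalemx1.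
    by rewrite -scalemx1 mx3_1 mx3Z; congr mx3; ring.
  - have [k [s [ks k0 _]]] := plane_rotation (u 0 0) (u 1 0).
    exists (rotz k s); split; first exact: rotz_SO3.
    exists (k * u 0 0 - s * u 1 0), 0, (u 2 0); split => //.
    + rewrite -ab /rotz /diag3 mx3T !mx3M; congr mx3; try ring.
      * by rewrite -[RHS]mulr1 -ks; ring.
      * by rewrite -[RHS]mulr1 -ks; ring.
    + by rewrite {1}(cv3_eta u) mx3_cv3; congr cv3; [ring | rewrite -[RHS]k0; ring | ring].
    + by move=> h; rewrite h eqxx in bc.
  - have [k [s [ks k0 _]]] := plane_rotation (u 1 0) (u 2 0).
    exists (rotx k s); split; first exact: rotx_SO3.
    exists (u 0 0), (k * u 1 0 - s * u 2 0), 0; split => //.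
    + rewrite -bc /rotx /diag3 mx3T !mx3M; congr mx3; try ring.
      * by rewrite -[RHS]mulr1 -ks; ring.
      * by rewrite -[RHS]mulr1 -ks; ring.
    + by rewrite {1}(cv3_eta u) mx3_cv3; congr cv3; [ring | ring | rewrite -[RHS]k0; ring].
    + by move=> h; rewrite h eqxx in ab.
  - exists 1%:M; split; first exact: SO3_1.
    exists (u 0 0), (u 1 0), (u 2 0); split.
    + by rewrite trmx1 mulmx1 mul1mx.
    + by rewrite mul1mx -cv3_eta.
    + by move=> h; rewrite h eqxx in ab.
    + by move=> h; rewrite h eqxx in bc.
have [B [sB [x [y [z [BD Bv y0 z0]]]]]] := step.
have [e1 [e2 [h1 h2 x1 y2 z12]]] := flips x y z.
exists (diag3 e1 e2 (e1 * e2) *m (B *m A)); split.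
  by apply: SO3_mul; [exact: diag3_SO3 | exact: SO3_mul].
exists a, b, c, (e1 * x), (e2 * y), (e1 * e2 * z); split.
- rewrite conjM conjM AE BD /diag3 mx3T !mx3M; congr mx3; try ring.
  + by rewrite -[RHS]mulr1 -h1; ring.
  + by rewrite -[RHS]mulr1 -h2; ring.
  + by rewrite -[RHS]mulr1 -[RHS]mulr1 -{1}h1 -h2; ring.
- by rewrite -!mulmxA Bv mx3_cv3; congr cv3; ring.
- split => //; split.
  + move=> h; apply: z12; have : (e1 * e2) ^+ 2 * (x * y) = 0.
      by rewrite -[RHS](mulr0 (e1 * e2)) -h; ring.
    by rewrite exprMn h1 h2 !mul1r.
  + by move/y0 => ->; rewrite mulr0.
  + by move/z0 => ->; rewrite mulr0.
Qed.

(** Inversion of a Vandermonde system: [(u - w)(u - v) P] is a combination of the three moments. *)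
Lemma moments_separate (a b c X Y Z X' Y' Z' : R) : a != b -> b != c -> a != c ->
  X + Y + Z = X' + Y' + Z' -> a * X + b * Y + c * Z = a * X' + b * Y' + c * Z' ->
  a ^+ 2 * X + b ^+ 2 * Y + c ^+ 2 * Z = a ^+ 2 * X' + b ^+ 2 * Y' + c ^+ 2 * Z' ->
  [/\ X = X', Y = Y' & Z = Z'].
Proof.
rewrite -subr_eq0 => ab; rewrite -subr_eq0 => bc; rewrite -subr_eq0 => ac E0 E1 E2.
have H (u v w U V W U' V' W' : R) : u - v != 0 -> u - w != 0 ->
    U + V + W = U' + V' + W' -> u * U + v * V + w * W = u * U' + v * V' + w * W' ->
    u ^+ 2 * U + v ^+ 2 * V + w ^+ 2 * W = u ^+ 2 * U' + v ^+ 2 * V' + w ^+ 2 * W' -> U = U'.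
  move=> uv uw F0 F1 F2; apply: (mulfI uv); apply: (mulfI uw).
  have E (P Q S : R) : (u - w) * ((u - v) * P) = (u ^+ 2 * P + v ^+ 2 * Q + w ^+ 2 * S)
      - (v + w) * (u * P + v * Q + w * S) + v * w * (P + Q + S) by ring.
  by rewrite (E U V W) (E U' V' W') F0 F1 F2.
split.
- exact: (H a b c X Y Z X' Y' Z').
- by apply: (H b a c Y X Z Y' X' Z') => //; rewrite -?[b - a]opprB ?oppr_eq0//; lra.
- by apply: (H c a b Z X Y Z' X' Y'); rewrite -?[c - a]opprB -?[c - b]opprB ?oppr_eq0//; lra.
Qed.

Lemma moments_separate2 (u v P Q P' Q' : R) : u != v -> P + Q = P' + Q' ->
  u * P + v * Q = u * P' + v * Q' -> P = P' /\ Q = Q'.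
Proof.
rewrite -subr_eq0 => uv E0 E1; suff PP : P = P' by split => //; lra.
apply: (mulfI uv).
have E (A B : R) : (u - v) * A = (u * A + v * B) - v * (A + B) by ring.
by rewrite (E P Q) (E P' Q') E0 E1.
Qed.

Lemma sqr_inj_ge0 (s t : R) : 0 <= s -> 0 <= t -> s ^+ 2 = t ^+ 2 -> s = t.
Proof. by move=> s0 t0 /eqP; rewrite eqrXn2// => /eqP. Qed.

(** The moments determine the squares of the surviving coordinates. Signs come from the normal form,
    except that of z when x y is nonzero and the eigenvalues are distinct, which comes from the
    determinant. *)
Lemma normal_form_eq a b c x y z x' y' z' :
  normal_form a b c x y z -> normal_form a b c x' y' z' ->
  x ^+ 2 + y ^+ 2 + z ^+ 2 = x' ^+ 2 + y' ^+ 2 + z' ^+ 2 ->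
  a * x ^+ 2 + b * y ^+ 2 + c * z ^+ 2 = a * x' ^+ 2 + b * y' ^+ 2 + c * z' ^+ 2 ->
  a ^+ 2 * x ^+ 2 + b ^+ 2 * y ^+ 2 + c ^+ 2 * z ^+ 2 =
    a ^+ 2 * x' ^+ 2 + b ^+ 2 * y' ^+ 2 + c ^+ 2 * z' ^+ 2 ->
  x * y * z * ((a - b) * (b - c) * (a - c)) = x' * y' * z' * ((a - b) * (b - c) * (a - c)) ->
  [/\ x = x', y = y' & z = z'].
Proof.
move=> [ba cb x0 y0 [zP yab zbc]] [_ _ x0' y0' [zP' yab' zbc']] E0 E1 E2 E3.
have [ab|ab] := eqVneq a b; have [bc|bc] := eqVneq b c.
- move: E0; rewrite (yab ab) (yab' ab) (zbc bc) (zbc' bc) expr0n/= !addr0 => E0.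
  by split => //; exact: sqr_inj_ge0.
- have [y1 y1'] := (yab ab, yab' ab).
  have z0 : 0 <= z by apply: zP; rewrite y1 mulr0.
  have z0' : 0 <= z' by apply: zP'; rewrite y1' mulr0.
  move: E0 E1; rewrite y1 y1' ab expr0n/= !mulr0 !addr0 => E0 E1.
  have [x2 z2] := moments_separate2 bc E0 E1.
  by split => //; exact: sqr_inj_ge0.
- have [z1 z1'] := (zbc bc, zbc' bc).
  move: E0 E1; rewrite z1 z1' -bc expr0n/= !mulr0 !addr0 => E0 E1.
  have [x2 y2] := moments_separate2 ab E0 E1.
  by split => //; exact: sqr_inj_ge0.
- have ac : a != c.
    by apply/eqP => ac; move: ab; rewrite eq_le ba andbT ac cb.
  have [x2 y2 z2] := moments_separate ab bc ac E0 E1 E2.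
  have xx := sqr_inj_ge0 x0 x0' x2; have yy := sqr_inj_ge0 y0 y0' y2.
  split => //; have [xy|xy] := eqVneq (x * y) 0.
    by apply: sqr_inj_ge0 => //; [exact: zP | apply: zP'; rewrite -xx -yy].
  have V : (a - b) * (b - c) * (a - c) != 0 by rewrite !mulf_neq0 ?subr_eq0.
  by move/(mulIf V) : E3; rewrite -xx -yy => /(mulfI xy).
Qed.

Lemma sum3_sqr_eq0 (u v k : R) : u ^+ 2 + v ^+ 2 + k ^+ 2 = 0 -> [/\ u = 0, v = 0 & k = 0].
Proof.
have h1 := sqr_ge0 u; have h2 := sqr_ge0 v; have h3 := sqr_ge0 k => h.
by split; apply/eqP; rewrite -sqrf_eq0; apply/eqP; lra.
Qed.

(* The first four coordinates recover rho_1, rho_2 and r - s_i; diag_gram makes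
   the fifth one determine r by monotonicity, hence all the invariants. *)
Lemma invmap_diag_inj a b c x y z a' b' c' x' y' z' :
  a + b + c = 0 -> a' + b' + c' = 0 ->
  normal_form a b c x y z -> normal_form a' b' c' x' y' z' ->
  invmap (diag3 a b c) (cv3 x y z) = invmap (diag3 a' b' c') (cv3 x' y' z') ->
  [/\ a = a', b = b' & c = c'] /\ [/\ x = x', y = y' & z = z'].
Proof.
move=> tr tr' nf nf'.
have [ba cb _ _ _] := nf; have [ba' cb' _ _ _] := nf'.
rewrite !invmap_diag//.
have D0 := disc_ge0 x y z tr ba cb; have D0' := disc_ge0 x' y' z' tr' ba' cb'.
have [B1 B2] := diag_bounds x y z tr ba cb; have [B1' B2'] := diag_bounds x' y' z' tr' ba' cb'.
have G := diag_gram x y z tr ba cb; have G' := diag_gram x' y' z' tr' ba' cb'.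
move: D0 D0' B1 B2 B1' B2' G G'.
set r := x ^+ 2 + y ^+ 2 + z ^+ 2; set r' := x' ^+ 2 + y' ^+ 2 + z' ^+ 2.
set p := a * x ^+ 2 + _ + _; set p' := a' * x' ^+ 2 + _ + _.
set q := a ^+ 2 * x ^+ 2 + _ + _; set q' := a' ^+ 2 * x' ^+ 2 + _ + _.
set t := a ^+ 2 + _ + _; set t' := a' ^+ 2 + _ + _.
set w := Num.sqrt _; set w' := Num.sqrt (disc r' _ _ _).
set d := x * y * z * _; set d' := x' * y' * z' * _.
move=> D0 D0' B1 B2 B1' B2' G G' E.
have F k := congr1 (fun v : 'cV[R]_5 => v k 0) E.
have := F 0; rewrite !mxE/= => F0.
have := F (inord 1); rewrite !mxE/= inordK//= => F1.
have := F (inord 2); rewrite !mxE/= inordK//= => F2.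
have := F (inord 3); rewrite !mxE/= inordK//= => F3.
have := F (inord 4); rewrite !mxE/= inordK//= => F4.
have r0 : 0 <= r by rewrite !addr_ge0 ?sqr_ge0.
have r0' : 0 <= r' by rewrite !addr_ge0 ?sqr_ge0.
have sq (u v : R) : 0 <= u -> (- v * Num.sqrt u ^+ 3) ^+ 2 = u ^+ 3 * v ^+ 2.
  by move=> u0; rewrite exprMn sqrrN -exprM mulnC exprM sqr_sqrtr// mulrC.
have F4' : r ^+ 3 * d ^+ 2 = r' ^+ 3 * d' ^+ 2 by rewrite -!sq// F4.
have rr : r = r'.
  (* Both sets of gaps are written as radius minus the same constants, the common third and fourth
     coordinates, to match [gram_radius_inj]. *)
  have e1 : a - b = r - (r - (a - b)) by ring.
  have e2 : b - c = r - (r - (b - c)) by ring.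
  have e1' : a' - b' = r' - (r - (a - b)) by rewrite F2; ring.
  have e2' : b' - c' = r' - (r - (b - c)) by rewrite F3; ring.
  have ab0 : 0 <= a - b by rewrite subr_ge0.
  have bc0 : 0 <= b - c by rewrite subr_ge0.
  have ab0' : 0 <= a' - b' by rewrite subr_ge0.
  have bc0' : 0 <= b' - c' by rewrite subr_ge0.
  rewrite -F0 in B1' G'; rewrite -F1 in B2' G'.
  rewrite e1 in ab0 B1 G; rewrite e2 in bc0 B2 G.
  rewrite e1' in ab0' B1' G'; rewrite e2' in bc0' B2' G'.
  apply: (gram_radius_inj r0 r0' ab0 bc0 ab0' bc0' B1 B2 B1' B2').
  by rewrite G G' F4'.
have [aa bb cc] : [/\ a = a', b = b' & c = c'].
  by move: tr tr' F2 F3 rr; clear; move=> *; split; lra.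
split=> //.
(* In the sum of the first two coordinates [w] cancels. *)
have pp : p = p' by rewrite -rr aa cc in F0 F1 *; lra.
have ww : w = w' by rewrite -rr aa cc in F0 F1 *; lra.
have DD : disc r p q t = disc r' p' q' t'.
  by rewrite -(sqr_sqrtr D0) -(sqr_sqrtr D0') -/w -/w' ww.
have tt : t = t' by rewrite /t /t' aa bb cc.
have [rz|rn] := eqVneq r 0.
  have [-> -> ->] := sum3_sqr_eq0 rz; rewrite rz in rr.
  by have [-> -> ->] := sum3_sqr_eq0 (esym rr).
have qq : q = q'.
  move: DD; rewrite /disc -rr pp tt => DD.
  have r4 : 4 * r != 0 by rewrite mulf_neq0.
  by apply: (mulfI r4); lra.
have dd : d = d'.
  have sn : Num.sqrt r ^+ 3 != 0 by rewrite expf_neq0// gt_eqF// sqrtr_gt0 lt_def rn.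
  by move: F4; rewrite -rr => /(mulIf sn) /oppr_inj.
rewrite -aa -bb -cc in nf'; rewrite /d' /p' /q' -aa -bb -cc in dd pp qq.
exact: (normal_form_eq nf nf' rr pp qq dd).
Qed.

Lemma invmap_separates S S' v v' : S^T = S -> S'^T = S' -> \tr S = 0 -> \tr S' = 0 ->
  invmap S v = invmap S' v' -> exists A, [/\ SO3 A, A *m S *m A^T = S' & A *m v = v'].
Proof.
move=> sS sS' tS tS' E.
have [A [sA [a [b [c [x [y [z [AS Av nf]]]]]]]]] := normal_form_exists v sS.
have [B [sB [a' [b' [c' [x' [y' [z' [BS Bv nf']]]]]]]]] := normal_form_exists v' sS'.
have trc (C T : 'M[R]_3) : SO3 C -> \tr (C *m T *m C^T) = \tr T.
  by move=> [CC _]; rewrite mxtrace_mulC mulmxA CC mul1mx.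
have tr : a + b + c = 0 by rewrite -(tr_mx3 a 0 0 0 b 0 0 0 c) -/(diag3 a b c) -AS trc.
have tr' : a' + b' + c' = 0 by rewrite -(tr_mx3 a' 0 0 0 b' 0 0 0 c') -/(diag3 a' b' c') -BS trc.
rewrite -(invmap_SO3 S v sA) -(invmap_SO3 S' v' sB) AS Av BS Bv in E.
have [[ea eb ec] [ex ey ez]] := invmap_diag_inj tr tr' nf nf' E.
have [BB _] := sB.
exists (B^T *m A); split; first by apply: SO3_mul => //; exact: SO3_tr.
- have -> : B^T *m A *m S *m (B^T *m A)^T = B^T *m (A *m S *m A^T) *m B.
    by rewrite trmx_mul trmxK !mulmxA.
  by rewrite AS ea eb ec -BS !mulmxA BB mul1mx -mulmxA BB mulmx1.
- by rewrite -mulmxA Av ex ey ez -Bv mulmxA BB mul1mx.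
Qed.

Lemma conj_diag3_entry A a b c i j : (A^T *m diag3 a b c *m A) i j =
  A 0 i * (A 0 j * a) + A 1 i * (A 1 j * b) + A 2 i * (A 2 j * c).
Proof.
have E : diag3 a b c *m A = \matrix_(k, l) (cv3 a b c k 0 * A k l).
  by apply/matrixP; apply: ord3P => l; rewrite [LHS]mxE sum3 !mx3E [RHS]mxE cv3E; ring.
have F k l : (diag3 a b c *m A) k l = cv3 a b c k 0 * A k l by rewrite E mxE.
rewrite -mulmxA mxE sum3 ![A^T _ _]mxE !F !cv3E.
by rewrite ![A _ j * _]mulrC.
Qed.

Lemma entry_SO3_le1 A i j : SO3 A -> `|A i j| <= 1.
Proof.
move=> [AA _]; suff : A i j ^+ 2 <= 1 by move=> h; rewrite ler_norml; apply/andP; split; nra.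
have := congr1 (fun M : 'M[R]_3 => M j j) AA; rewrite !mxE sum3 !mxE eqxx -!expr2 mulr1n => <-.
have h0 := sqr_ge0 (A 0 j); have h1 := sqr_ge0 (A 1 j); have h2 := sqr_ge0 (A 2 j).
by move: i; apply: ord3P; lra.
Qed.

(** [gram_radius_bounded] bounds r. Then s_i is at most r + L, the zero trace bounds the
    eigenvalues, and rotating back uses entries of absolute value at most 1. *)
Lemma invmap_bounded (K : R) : exists K' : R, forall S v, S^T = S -> \tr S = 0 ->
  (forall i, `|invmap S v i 0| <= K) ->
  (forall i j, `|S i j| <= K') /\ (forall i, `|v i 0| <= K').
Proof.
(* [r1] is the radius bound. [K'] dominates three times [r1 + L], for eigenvalues, and three times
   [r1 + 1], for coordinates whose squares are at most [r1]. *)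
pose L := `|K|; pose r1 := 10 * L + 10; pose K' := 9 * (r1 + L) + 3 * (r1 + 1).
exists K' => S v sS tS H.
have L0 : 0 <= L by exact: normr_ge0.
have [A [sA [a [b [c [x [y [z [AS Av nf]]]]]]]]] := normal_form_exists v sS.
have [ba cb _ _ _] := nf; have [AA _] := sA; have AAT := SO3_mulT sA.
have tr : a + b + c = 0.
  rewrite -(tr_mx3 a 0 0 0 b 0 0 0 c) -/(diag3 a b c) -AS mxtrace_mulC mulmxA AA mul1mx//.
rewrite -(invmap_SO3 S v sA) AS Av invmap_diag// in H.
have {}H k : `|invmap (diag3 a b c) (cv3 x y z) k 0| <= L.
  by rewrite invmap_diag//; apply: le_trans (H k) (ler_norm K).
rewrite invmap_diag// in H.
have G := diag_gram x y z tr ba cb; move: G H.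
set r := x ^+ 2 + y ^+ 2 + z ^+ 2; set p := a * x ^+ 2 + _ + _.
set w := Num.sqrt _; set d := x * y * z * _ => G H.
have := H 0; rewrite mxE/= => H0.
have := H (inord 1); rewrite mxE inordK//= => H1.
have := H (inord 2); rewrite mxE inordK//= => H2.
have := H (inord 3); rewrite mxE inordK//= => H3.
have := H (inord 4); rewrite mxE inordK//= => H4.
have r0 : 0 <= r by rewrite !addr_ge0 ?sqr_ge0.
have rr1 : r <= r1.
  apply: (gram_radius_bounded L0 H0 H1 H2 H3 H4).
  rewrite exprMn sqrrN -exprM mulnC exprM sqr_sqrtr// [d ^+ 2 * _]mulrC -G.
  by congr gram; ring.
move: H2 H3; rewrite !ler_norml => /andP[l2 u2] /andP[l3 u3].
have abd (t : R) : [\/ t = a, t = b | t = c] -> `|t| <= r1 + L.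
  move: r0 rr1 tr l2 u2 l3 u3 L0; rewrite ler_norml; move: (r1) (L) (r) => ? ? ?; clear.
  by move=> ? ? ? ? ? ? ? ? [] ->; apply/andP; split; lra.
have sq (t : R) : [\/ t = x, t = y | t = z] -> `|t| <= r1 + 1.
  have h0 := sqr_ge0 x; have h1 := sqr_ge0 y; have h2 := sqr_ge0 z => ht.
  have : t ^+ 2 <= r1 by apply: le_trans rr1; rewrite /r; case: ht => ->; lra.
  have r10 : 0 <= r1 by rewrite /r1; lra.
  by move=> tr1; rewrite ler_norml; apply/andP; split; nra.
have r10 : 0 <= r1 by rewrite /r1; lra.
have Aij i j := @entry_SO3_le1 A i j sA.
have pr (s t k : R) : `|s| <= 1 -> `|t| <= k -> `|s * t| <= k.
  by move=> h1 h2; rewrite normrM -[k]mul1r; apply: ler_pM.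
have tri (s t k l m n : R) : `|s| <= l -> `|t| <= m -> `|k| <= n -> `|s + t + k| <= l + m + n.
  move=> h1 h2 h3; apply: le_trans (ler_normD _ _) (lerD _ h3).
  exact: le_trans (ler_normD _ _) (lerD h1 h2).
have SE : S = A^T *m diag3 a b c *m A.
  by rewrite -AS !mulmxA AA mul1mx -mulmxA AA mulmx1.
have vE : v = A^T *m cv3 x y z by rewrite -Av mulmxA AA mul1mx.
split=> [i j|i].
  apply: (@le_trans _ _ ((r1 + L) + (r1 + L) + (r1 + L))); last by rewrite /K'; lra.
  rewrite SE conj_diag3_entry.
  apply: tri; (apply: (pr) => //; apply: (pr) => //; apply: (abd)).
  - by constructor 1.
  - by constructor 2.
  - by constructor 3.
apply: (@le_trans _ _ ((r1 + 1) + (r1 + 1) + (r1 + 1))); last by rewrite /K'; lra.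
rewrite vE mxE sum3 ![A^T _ _]mxE !cv3E; apply: tri; (apply: (pr) => //; apply: (sq)).
- by constructor 1.
- by constructor 2.
- by constructor 3.
Qed.

(** The radius and the diagonal data realize the first four coordinates and the square of the fifth.
    Changing the sign of z then adjusts the fifth alone. *)
Lemma invmap_realize (f0 f1 f2 f3 f4 : R) : f4 != 0 -> exists S v,
  [/\ S^T = S, \tr S = 0 & invmap S v = \col_i nth 0 [:: f0; f1; f2; f3; f4] i].
Proof.
move=> f40; have [r [r0 s1 s2 [h1 h2] G]] := gram_radius_exists f2 f3 f0 f1 f40.
have [a [b [c [x [y [z [tr ab bc [x0 y0 z0 rE [E0 E1]]]]]]]]] := diag_realize r0 s1 s2 h1 h2.
have ba : b <= a by rewrite -subr_ge0 ab ltW.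
have cb : c <= b by rewrite -subr_ge0 bc ltW.
have key e : e ^+ 2 = 1 -> invmap (diag3 a b c) (cv3 x y (e * z)) =
   \col_i nth 0 [:: f0; f1; f2; f3;
     - (e * (x * y * z * ((a - b) * (b - c) * (a - c)))) * Num.sqrt r ^+ 3] i.
  move=> e1; have ez : (e * z) ^+ 2 = z ^+ 2 by rewrite exprMn e1 mul1r.
  rewrite invmap_diag// ez rE E0 E1 ab bc.
  rewrite (_ : r - (r - f2) = f2); last by ring.
  rewrite (_ : r - (r - f3) = f3); last by ring.
  by apply/colP => i; rewrite !mxE; congr (nth _ [:: _; _; _; _; _] _); ring.
set m := x * y * z * ((a - b) * (b - c) * (a - c)) * Num.sqrt r ^+ 3.
have m2 : m ^+ 2 = f4 ^+ 2.
  have := diag_gram x y z tr ba cb; rewrite rE E0 E1 ab bc G.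
  move/(mulfI (_ : 64 != 0)) => ->; last by rewrite pnatr_eq0.
  by rewrite /m exprMn -exprM mulnC exprM sqr_sqrtr 1?ltW// mulrC ab bc.
have [e e1 em] : exists2 e : R, e ^+ 2 = 1 & - (e * m) = f4.
  move/eqP : m2; rewrite eqf_sqr => /orP[]/eqP ->.
    by exists (-1); rewrite ?sqrrN ?expr1n// mulN1r opprK.
  by exists 1; rewrite ?expr1n// mul1r opprK.
exists (diag3 a b c), (cv3 x y (e * z)); split.
- by rewrite /diag3 mx3T.
- by rewrite tr_mx3.
rewrite key//; apply/colP => i; rewrite !mxE; congr (nth _ [:: _; _; _; _; _] _).
by rewrite -em /m; ring.
Qed.

End OrbitInvariant.

(** * Irreducible representations of dimension 5 and 3 *)

Section VectorFamilies.
Context (R : realType) (n : nat).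
Implicit Types (U W : {vspace 'cV[R]_n}).

Lemma independent_le_dim d U (F : 'I_d -> 'cV[R]_n) : (forall i, F i \in U) ->
  (forall x : 'cV[R]_d, \sum_i x i 0 *: F i = 0 -> x = 0) -> (d <= \dim U)%N.
Proof.
move=> FU Find; pose X := [tuple F i | i < d].
have XE (i : 'I_d) : X`_i = F i by rewrite -tnth_nth tnth_mktuple.
have Xfree : free X.
  apply/freeP => k k0 i; have := Find (\col_j k j) _.
  under eq_bigr do rewrite mxE -XE.
  by move=> /(_ k0) /(congr1 (fun x : 'cV[R]_d => x i 0)); rewrite !mxE.
have XU : (<<X>> <= U)%VS by apply/span_subvP => _ /tnthP [i ->]; rewrite tnth_mktuple.
by have := dimvS XU; rewrite (eqnP Xfree) size_tuple.
Qed.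

Lemma independent_generates d U (F : 'I_d -> 'cV[R]_n) : (forall i, F i \in U) ->
  (forall x : 'cV[R]_d, \sum_i x i 0 *: F i = 0 -> x = 0) -> (\dim U <= d)%N ->
  forall u, u \in U -> exists x : 'cV[R]_d, u = \sum_i x i 0 *: F i.
Proof.
move=> FU Find dU u uU; pose X := [tuple F i | i < d].
have XE (i : 'I_d) : X`_i = F i by rewrite -tnth_nth tnth_mktuple.
have Xfree : free X.
  apply/freeP => k k0 i; have := Find (\col_j k j) _.
  under eq_bigr do rewrite mxE -XE.
  by move=> /(_ k0) /(congr1 (fun x : 'cV[R]_d => x i 0)); rewrite !mxE.
have XU : (<<X>> <= U)%VS by apply/span_subvP => _ /tnthP [i ->]; rewrite tnth_mktuple.
have bX : basis_of U X by rewrite basisEfree Xfree XU size_tuple.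
exists (\col_i coord X i u); rewrite {1}(coord_basis bX uU).
by apply: eq_bigr => i _; rewrite mxE XE.
Qed.

Lemma trmx_mul_eq0 m (w : 'cV[R]_m) : w^T *m w = 0 -> w = 0.
Proof.
move=> /(congr1 (fun M : 'M[R]_1 => M 0 0)); rewrite !mxE => E.
have : \sum_j w j 0 ^+ 2 = 0.
  by rewrite -[RHS]E; apply: eq_bigr => j _; rewrite mxE expr2.
move/eqP; rewrite psumr_eq0; last by move=> *; exact: sqr_ge0.
by move/allP => H; apply/colP => i; rewrite mxE; apply/eqP; rewrite -sqrf_eq0; exact: (H i (mem_index_enum i)).
Qed.

(** In any basis [B] of [U] the matrix [B^T E B] is skew of odd size, hence singular. A kernel
    vector x makes [E B x], which lies in [U], orthogonal to [U]. This provides the vector of weight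
    0 from which the representations are built. *)
Lemma odd_skew_kernel U (E : 'M[R]_n) : E^T = - E -> odd (\dim U) ->
  (forall u, u \in U -> E *m u \in U) ->
  exists v, [/\ v \in U, v != 0 & E *m v = 0].
Proof.
move=> Eskew odU EU; set d := \dim U in odU.
pose X : d.-tuple 'cV[R]_n := vbasis U.
have bX : basis_of U X := vbasisP U.
pose B : 'M[R]_(n, d) := \matrix_(i, j) X`_j i 0.
have BE (x : 'cV[R]_d) : B *m x = \sum_j x j 0 *: X`_j.
  apply/colP => i; rewrite mxE summxE; apply: eq_bigr => j _.
  by rewrite !mxE mulrC.
have BU x : B *m x \in U.
  rewrite BE; apply: memv_suml => j _; apply: memvZ; apply: vbasis_mem.
  by rewrite mem_nth// size_tuple.
have Binj (x : 'cV[R]_d) : B *m x = 0 -> x = 0.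
  rewrite BE => h; have H := freeP (basis_free bX) _ h; apply/colP => j.
  by rewrite mxE H.
have Bsurj u : u \in U -> exists x, u = B *m x.
  move=> uU; exists (\col_j coord X j u); rewrite BE {1}(coord_basis bX uU).
  by apply: eq_bigr => j _; rewrite mxE.
pose N := B^T *m E *m B.
have NT : N^T = - N by rewrite /N !trmx_mul trmxK Eskew mulNmx mulmxN mulmxA.
have /eqP/det0P [x x0 xN] : \det N = 0.
  have : \det N = - \det N.
    by rewrite -{1}det_tr NT -scaleN1r detZ -signr_odd odU expr1 mulN1r.
  by move/eqP; rewrite -addr_eq0 -mulr2n mulrn_eq0/= => /eqP.
have Nx : N *m x^T = 0.
  by apply: trmx_inj; rewrite trmx_mul trmxK NT mulmxN xN oppr0 trmx0.
exists (B *m x^T); split => //.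
  by apply: contra_neq x0 => /Binj /(congr1 trmx); rewrite trmxK trmx0.
have [y yE] := Bsurj _ (EU _ (BU x^T)).
rewrite yE; apply: trmx_mul_eq0.
rewrite trmx_mul -mulmxA [X in _ *m X](_ : _ = 0) ?mulmx0//.
by rewrite -yE -[RHS]Nx /N !mulmxA.
Qed.

End VectorFamilies.

(** * Weight strings of three matrices with the brackets of so(3) *)

Section So3Triple.
Context (R : realType) (n : nat) (E1 E2 E3 : 'M[R]_n).
Hypotheses (c12 : mxbracket E1 E2 = E3) (c23 : mxbracket E2 E3 = E1) (c31 : mxbracket E3 E1 = E2).
Implicit Types (u v a b p q : 'cV[R]_n) (U W : {vspace 'cV[R]_n}).

Let s12 u : E1 *m (E2 *m u) = E2 *m (E1 *m u) + E3 *m u.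
Proof. by rewrite -c12 /mxbracket mulmxBl !mulmxA addrC subrK. Qed.
Let s31 u : E3 *m (E1 *m u) = E1 *m (E3 *m u) + E2 *m u.
Proof. by rewrite -c31 /mxbracket mulmxBl !mulmxA addrC subrK. Qed.
Let s32 u : E3 *m (E2 *m u) = E2 *m (E3 *m u) - E1 *m u.
Proof. by rewrite -c23 /mxbracket mulmxBl !mulmxA opprB addrC subrK. Qed.

Definition vector_table v a b :=
  [/\ E1 *m v = a, E2 *m v = b & E3 *m v = 0] /\
  [/\ E1 *m a = - v, E2 *m a = 0 & E3 *m a = b] /\
  [/\ E1 *m b = 0, E2 *m b = - v & E3 *m b = - a].

(** Real weight basis for [E3]: v has weight 0, the pair (a, b) weight 1, the pair (p, q) weight 2.
    The coefficient -3 is half the eigenvalue -6 of E1^2 + E2^2 on v. *)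
Definition tensor_table v a b p q :=
  [/\ E1 *m v = a, E2 *m v = b & E3 *m v = 0] /\
  [/\ E1 *m a = 2^-1 *: p - 3 *: v, E2 *m a = 2^-1 *: q & E3 *m a = b] /\
  [/\ E1 *m b = 2^-1 *: q, E2 *m b = - 2^-1 *: p - 3 *: v & E3 *m b = - a] /\
  [/\ E1 *m p = -2 *: a, E2 *m p = 2 *: b & E3 *m p = 2 *: q] /\
  [/\ E1 *m q = -2 *: b, E2 *m q = -2 *: a & E3 *m q = -2 *: p].

Definition stable U := forall u, u \in U -> [/\ E1 *m u \in U, E2 *m u \in U & E3 *m u \in U].

Definition irreducible U := [/\ stable U, U != 0%VS &
  forall W, (W <= U)%VS -> stable W -> W = 0%VS \/ W = U].

Lemma killed_eq0 U u : irreducible U -> (1 < \dim U)%N -> u \in U ->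
  E1 *m u = 0 -> E2 *m u = 0 -> E3 *m u = 0 -> u = 0.
Proof.
move=> [_ _ irr] dU uU u1 u2 u3.
have [||W0|WU] := irr <[u]>%VS.
- by rewrite -memvE.
- by move=> _ /vlineP [k ->]; rewrite -!scalemxAr u1 u2 u3 scaler0 mem0v.
- by apply/eqP; rewrite -memv0 -W0 memv_line.
- by move: dU; rewrite -WU dim_vline; case: (u != 0).
Qed.

Section WeightString.
Variables (v a b p q : 'cV[R]_n).
Hypotheses (v3 : E3 *m v = 0) (v1 : E1 *m v = a) (v2 : E2 *m v = b).
Hypotheses (pE : E1 *m a - E2 *m b = p) (qE : E1 *m b + E2 *m a = q).

Let a3 : E3 *m a = b. Proof. by rewrite -v1 s31 v3 mulmx0 add0r v2. Qed.
Let b3 : E3 *m b = - a. Proof. by rewrite -v2 s32 v3 mulmx0 add0r v1. Qed.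
Let ba : E1 *m b = E2 *m a. Proof. by rewrite -v1 -v2 s12 v3 addr0. Qed.

Let p3 : E3 *m p = 2 *: q.
Proof.
rewrite -pE mulmxBr s31 s32 a3 b3 mulmxN -qE.
move: (E1 *m b) (E2 *m a) => x y.
by apply/colP => i; rewrite !mxE; ring.
Qed.

Let q3 : E3 *m q = -2 *: p.
Proof.
rewrite -qE mulmxDr s31 s32 a3 b3 mulmxN -pE.
move: (E1 *m a) (E2 *m b) => x y.
by apply/colP => i; rewrite !mxE; ring.
Qed.

(** Repeated application of [E3] separates the weights 0, 1 and 2, on which E3^2 is 0, -1 and -4.
    The alternative hypothesis lets the same lemma serve the three-dimensional case, where p and q
    do not enter. *)
Lemma weight_independent (al be ga de ep : R) : v != 0 -> a != 0 -> p != 0 \/ (de = 0 /\ ep = 0) ->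
  al *: v + be *: a + ga *: b + de *: p + ep *: q = 0 ->
  [/\ al = 0, be = 0, ga = 0, de = 0 & ep = 0].
Proof.
move=> v0 a0 p0 E0.
have E1' := congr1 (mulmx E3) E0.
rewrite mulmx0 !mulmxDr -!scalemxAr v3 a3 b3 p3 q3 scaler0 add0r in E1'.
have E2' := congr1 (mulmx E3) E1'.
rewrite mulmx0 !mulmxDr -!scalemxAr mulmxN b3 a3 p3 q3 in E2'.
have E3' := congr1 (mulmx E3) E2'.
rewrite mulmx0 !mulmxDr -!scalemxAr !mulmxN b3 a3 p3 q3 in E3'.
have sq2 (x y : R) (w : 'cV[R]_n) : (x ^+ 2 + y ^+ 2) *: w = 0 -> w != 0 -> x = 0 /\ y = 0.
  move=> /eqP; rewrite scaler_eq0 => /orP[/eqP h _|/eqP ->]; last by rewrite eqxx.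
  have hx := sqr_ge0 x; have hy := sqr_ge0 y.
  by split; apply/eqP; rewrite -sqrf_eq0; apply/eqP; lra.
(* The first and third images under [E3] are added: weight 1 cancels and only weight 2 remains. *)
have pq : de *: q = ep *: p.
  apply/colP => i; have := congr1 (fun w : 'cV[R]_n => w i 0) E1'.
  have := congr1 (fun w : 'cV[R]_n => w i 0) E3'; rewrite !mxE => h1 h2; lra.
have [de0 ep0] : de = 0 /\ ep = 0.
  case: p0 => // p0; apply: (sq2 _ _ p) => //.
  have h := congr1 (mulmx E3) pq; rewrite -!scalemxAr q3 p3 in h.
  apply/colP => i; have h1 := congr1 (fun w : 'cV[R]_n => w i 0) h.
  have h2 := congr1 (fun w : 'cV[R]_n => w i 0) pq.
  rewrite !mxE in h1 h2 *.
  have k1 : de * (de * p i 0) + ep * (ep * p i 0) = de * (de * p i 0) + ep * (de * q i 0) by rewrite h2.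
  have k2 : de * (de * p i 0) = de * (- (ep * q i 0)) by rewrite (_ : de * p i 0 = - (ep * q i 0))//; lra.
  have -> : (de ^+ 2 + ep ^+ 2) * p i 0 = de * (de * p i 0) + ep * (ep * p i 0) by ring.
  rewrite k1 k2; ring.
rewrite de0 ep0 !scale0r !addr0 in E0 E1'.
have ab : be *: b = ga *: a.
  by move/eqP : E1'; rewrite scalerN subr_eq0 => /eqP.
have [be0 ga0] : be = 0 /\ ga = 0.
  apply: (sq2 _ _ a) => //.
  have h := congr1 (mulmx E3) ab; rewrite -!scalemxAr b3 a3 in h.
  apply/colP => i; have h1 := congr1 (fun w : 'cV[R]_n => w i 0) h.
  have h2 := congr1 (fun w : 'cV[R]_n => w i 0) ab.
  rewrite !mxE in h1 h2 *.
  have k1 : be * (be * a i 0) = be * (- (ga * b i 0)) by rewrite (_ : be * a i 0 = - (ga * b i 0))//; lra.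
  have k2 : ga * (ga * a i 0) = ga * (be * b i 0) by rewrite h2.
  have -> : (be ^+ 2 + ga ^+ 2) * a i 0 = be * (be * a i 0) + ga * (ga * a i 0) by ring.
  rewrite k1 k2; ring.
move: E0; rewrite be0 ga0 !scale0r !addr0 => /eqP; rewrite scaler_eq0 (negbTE v0) orbF.
by move/eqP.
Qed.

Lemma string_a_neq0 U : irreducible U -> (1 < \dim U)%N -> v \in U -> v != 0 -> a != 0.
Proof.
move=> iU dU vU v0; apply/eqP => a0; move/eqP: v0; apply; apply: (killed_eq0 iU) => //.
- by rewrite v1.
- by rewrite v2 -a3 a0 mulmx0.
Qed.

(** If p vanishes then so does q, by [p3]. The commutators then show that [E1 a + v] is killed by
    all three matrices, so it is 0 by irreducibility. *)
Lemma string_short U : irreducible U -> (1 < \dim U)%N -> v \in U -> p = 0 ->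
  vector_table v a b.
Proof.
move=> iU dU vU p0; have [stU _ _] := iU.
have q0 : q = 0.
  by move/eqP: p3; rewrite p0 mulmx0 eq_sym scaler_eq0 pnatr_eq0 => /eqP.
have ab : E1 *m a = E2 *m b by apply/eqP; rewrite -subr_eq0 pE p0.
have b1 : E1 *m b = 0.
  have : 2 *: (E1 *m b) = 0 by rewrite scaler_nat mulr2n {2}ba qE q0.
  by move/eqP; rewrite scaler_eq0 pnatr_eq0 => /eqP.
have a2 : E2 *m a = 0 by rewrite -ba.
have aU : a \in U by rewrite -v1; case: (stU v vU).
have wU : E1 *m a \in U by case: (stU a aU).
have w1 : E1 *m (E1 *m a) = - a.
  by have := s12 b; rewrite b1 mulmx0 add0r b3 -ab.
have w2 : E2 *m (E1 *m a) = - b.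
  have := s12 a; rewrite a2 mulmx0 a3 => /esym/eqP.
  by rewrite addr_eq0 => /eqP ->.
have w3 : E3 *m (E1 *m a) = 0 by rewrite s31 a3 b1 a2 addr0.
have : E1 *m a + v = 0.
  apply: (killed_eq0 iU) => //; first exact: memvD.
  - by rewrite mulmxDr w1 v1 addNr.
  - by rewrite mulmxDr w2 v2 addNr.
  - by rewrite mulmxDr w3 v3 addr0.
move/eqP; rewrite addr_eq0 => /eqP av.
by split; [|split]; split => //; rewrite -ab.
Qed.

(** By dimension the five independent vectors form a basis. Weights fix the action up to one scalar
    mu, which the commutator of [E1] and [E2] on p determines. *)
Lemma string_long U : irreducible U -> \dim U = 5 -> v \in U -> v != 0 -> p != 0 ->
  tensor_table v a b p q.
Proof.
move=> iU dU vU v0 p0; have [stU _ _] := iU.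
have a0 : a != 0 by apply: (string_a_neq0 iU) => //; rewrite dU.
have [aU bU _] := stU v vU; rewrite v1 in aU; rewrite v2 in bU.
have [a1U a2U _] := stU a aU; have [b1U b2U _] := stU b bU.
have pU : p \in U by rewrite -pE memvB.
have qU : q \in U by rewrite -qE memvD.
have gen u : u \in U -> exists al be ga de ep : R,
    u = al *: v + be *: a + ga *: b + de *: p + ep *: q.
  pose F (i : 'I_5) := nth 0 [:: v; a; b; p; q] i.
  have FE (x : 'cV[R]_5) : \sum_i x i 0 *: F i =
    x 0 0 *: v + x (inord 1) 0 *: a + x (inord 2) 0 *: b + x (inord 3) 0 *: p + x (inord 4) 0 *: q.
    rewrite !big_ord_recl big_ord0 addr0 !addrA.
    by do ![congr (_ + _)]; congr (x _ _ *: _); apply: val_inj; rewrite /= ?inordK.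
  move=> uU; have [| | |x ->] := @independent_generates R n 5 U F _ _ _ u uU.
  - by case=> -[|[|[|[|[|//]]]]].
  - move=> x; rewrite FE => /weight_independent [||| x0 x1 x2 x3 x4] //; first by left.
    apply/colP => -[[|[|[|[|[|//]]]]] h]; rewrite mxE.
    + by rewrite -[RHS]x0; congr (x _ _); apply: val_inj.
    + by rewrite -[RHS]x1; congr (x _ _); apply: val_inj; rewrite /= inordK.
    + by rewrite -[RHS]x2; congr (x _ _); apply: val_inj; rewrite /= inordK.
    + by rewrite -[RHS]x3; congr (x _ _); apply: val_inj; rewrite /= inordK.
    + by rewrite -[RHS]x4; congr (x _ _); apply: val_inj; rewrite /= inordK.
  - by rewrite dU.
  - by rewrite FE; do 5!eexists.
have cancel0 (k x : R) : k != 0 -> k * x = 0 -> x = 0.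
  by move=> k0 /eqP; rewrite mulf_eq0 (negbTE k0) => /eqP.
(* E3-weights: E1 a + E2 b has weight 0, so it is a multiple of v, and
   E1 p - E2 q, E1 q + E2 p have weight 3, so they vanish. *)
have ker3 u : u \in U -> E3 *m u = 0 -> exists al : R, u = al *: v.
  move=> uU u3; have [al [be [ga [de [ep uE]]]]] := gen u uU.
  have h : 0 *: v + (- ga) *: a + be *: b + (-2 * ep) *: p + (2 * de) *: q = 0.
    rewrite -[RHS]u3 uE !mulmxDr -!scalemxAr v3 a3 b3 p3 q3.
    by apply/colP => i; rewrite !mxE; ring.
  have [_ ga0 be0 ep0 de0] := weight_independent v0 a0 (or_introl p0) h.
  have ga1 : ga = 0 by apply/eqP; rewrite -oppr_eq0 ga0.
  have [n2 n2'] : -2 != 0 :> R /\ 2 != 0 :> R by rewrite oppr_eq0 pnatr_eq0.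
  by exists al; rewrite uE be0 ga1 (cancel0 _ _ n2 ep0) (cancel0 _ _ n2' de0) !scale0r !addr0.
have weight3 s t : s \in U -> t \in U -> E3 *m s = 3 *: t -> E3 *m t = -3 *: s -> s = 0.
  move=> sU tU st ts; have [al [be [ga [de [ep sE]]]]] := gen s sU.
  have ss : E3 *m (E3 *m s) = -9 *: s by rewrite st -scalemxAr ts scalerA; congr (_ *: _); ring.
  (* [s] would satisfy E3^2 s = -9 s; adding 9 to the eigenvalues 0, -1, -4 gives the coefficients
     9, 8, 5, none of them zero. *)
  have h : (9 * al) *: v + (8 * be) *: a + (8 * ga) *: b + (5 * de) *: p + (5 * ep) *: q = 0.
    have -> : 0 = E3 *m (E3 *m s) + 9 *: s by rewrite ss scaleNr addNr.
    rewrite sE !mulmxDr -!scalemxAr v3 a3 b3 p3 q3 !mulmxN mulmx0 ?a3 ?b3 -?scalemxAr ?p3 ?q3.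
    by apply/colP => i; rewrite !mxE; ring.
  have [h1 h2 h3 h4 h5] := weight_independent v0 a0 (or_introl p0) h.
  have nz k : k.+1%:R != 0 :> R by rewrite pnatr_eq0.
  by rewrite sE (cancel0 _ _ (nz _) h1) (cancel0 _ _ (nz _) h2) (cancel0 _ _ (nz _) h3) (cancel0 _ _ (nz _) h4) (cancel0 _ _ (nz _) h5) !scale0r !addr0.
have [mu muE] : exists mu : R, E1 *m a + E2 *m b = mu *: v.
  apply: ker3; first exact: memvD.
  rewrite mulmxDr s31 s32 a3 b3 mulmxN -ba.
  by move: (E1 *m b) (E1 *m a) => x y; apply/colP => i; rewrite !mxE; ring.
have [p1U p2U _] := stU p pU; have [q1U q2U _] := stU q qU.
have pq12 : E1 *m p - E2 *m q = 0 /\ E1 *m q + E2 *m p = 0.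
  have t1 : E3 *m (E1 *m p - E2 *m q) = 3 *: (E1 *m q + E2 *m p).
    rewrite mulmxBr s31 s32 p3 q3 -!scalemxAr.
    by move: (E1 *m p) (E2 *m p) (E1 *m q) (E2 *m q) => x y z w; apply/colP => i; rewrite !mxE; ring.
  have t2 : E3 *m (E1 *m q + E2 *m p) = -3 *: (E1 *m p - E2 *m q).
    rewrite mulmxDr s31 s32 p3 q3 -!scalemxAr.
    by move: (E1 *m p) (E2 *m p) (E1 *m q) (E2 *m q) => x y z w; apply/colP => i; rewrite !mxE; ring.
  have z1 : E1 *m p - E2 *m q = 0 by apply: (weight3 _ _ _ _ t1 t2); rewrite ?memvB ?memvD.
  split => //; move/eqP : t1; rewrite z1 mulmx0 eq_sym scaler_eq0 pnatr_eq0 => /eqP//.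
have [pq1 pq2] := pq12.
have b1 : E1 *m b = 2^-1 *: q.
  by rewrite -qE -ba; move: (E1 *m b) => x; apply/colP => i; rewrite !mxE; field.
have a1 : E1 *m a = 2^-1 *: (p + mu *: v).
  by rewrite -pE -muE; move: (E1 *m a) (E2 *m b) => x y; apply/colP => i; rewrite !mxE; field.
have b2 : E2 *m b = 2^-1 *: (mu *: v - p).
  by rewrite -pE -muE; move: (E1 *m a) (E2 *m b) => x y; apply/colP => i; rewrite !mxE; field.
have a2 : E2 *m a = 2^-1 *: q by rewrite -ba.
(* E1 p + E2 q and E1 q - E2 p are computed from [E1, E2] = E3 on a and b. *)
have sa : 2^-1 *: (E1 *m q) = 2^-1 *: (E2 *m p + mu *: b) + b.
  by have := s12 a; rewrite a1 a2 a3 -!scalemxAr mulmxDr -!scalemxAr v2.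
have sb : 2^-1 *: (mu *: a - E1 *m p) = 2^-1 *: (E2 *m q) - a.
  by have := s12 b; rewrite b1 b2 b3 -!scalemxAr mulmxBr -!scalemxAr v1.
have q1 : E1 *m q = (1 + mu / 2) *: b.
  apply/colP => i; have := congr1 (fun w : 'cV[R]_n => w i 0) sa.
  have := congr1 (fun w : 'cV[R]_n => w i 0) pq2.
  move: (E1 *m p) (E2 *m p) (E1 *m q) (E2 *m q) => x y z w; rewrite !mxE => h1 h2; lra.
have p2 : E2 *m p = - (1 + mu / 2) *: b.
  by rewrite scaleNr -q1; apply/eqP; rewrite -addr_eq0 addrC pq2.
have p1 : E1 *m p = (1 + mu / 2) *: a.
  apply/colP => i; have := congr1 (fun w : 'cV[R]_n => w i 0) sb.
  have := congr1 (fun w : 'cV[R]_n => w i 0) pq1.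
  move: (E1 *m p) (E2 *m p) (E1 *m q) (E2 *m q) => x y z w; rewrite !mxE => h1 h2; lra.
have q2 : E2 *m q = (1 + mu / 2) *: a.
  by rewrite -p1; apply/eqP; rewrite eq_sym -subr_eq0 pq1.
have q0 : q != 0.
  apply/eqP => q0; move/eqP: q3; rewrite q0 mulmx0 eq_sym scaler_eq0 oppr_eq0 pnatr_eq0.
  by rewrite (negbTE p0).
(* On p the commutator of [E1] and [E2] is [- (1 + mu/2) q], while [E3 p = 2 q]. *)
have mu6 : mu = -6.
  have := s12 p; rewrite p1 p2 p3 -!scalemxAr b1 a2 => h.
  have /eqP : (mu / 2 + 3) *: q = 0.
    apply/colP => i; have := congr1 (fun w : 'cV[R]_n => w i 0) h.
    rewrite !mxE => h1; lra.
  rewrite scaler_eq0 (negbTE q0) orbF => /eqP; lra.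
have k : 1 + mu / 2 = -2 by rewrite mu6; field.
split; [|split; [|split; [|split]]]; split => //.
- by rewrite a1 mu6; apply/colP => i; rewrite !mxE; field.
- by rewrite b2 mu6; apply/colP => i; rewrite !mxE; field.
- by rewrite p1 k.
- by rewrite p2 k opprK.
- by rewrite q1 k.
- by rewrite q2 k.
Qed.

End WeightString.
End So3Triple.

(** * Explicit models: traceless symmetric tensors and vectors *)

Section Model.
Context (R : realType).
Implicit Types (S : 'M[R]_3) (w : 'cV[R]_3).

Definition L1 : 'M[R]_3 := mx3 0 0 0 0 0 (-1) 0 1 0.
Definition L2 : 'M[R]_3 := mx3 0 0 1 0 0 0 (-1) 0 0.
Definition L3 : 'M[R]_3 := mx3 0 (-1) 0 1 0 0 0 0 0.

(* The sixth entry of the diagonal and upper triangle is determined by the trace. *)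
Definition enc5 S : 'cV[R]_5 := \col_i nth 0 [:: S 0 0; S 1 1; S 0 1; S 0 2; S 1 2] i.

Definition enc k S w (c : 'cV[R]_k) : 'cV[R]_(5 + (3 + k)) := col_mx (enc5 S) (col_mx w c).

Definition dec5 (x : 'cV[R]_5) : 'M[R]_3 :=
  let y k := x (inord k) 0 in mx3 (y 0%N) (y 2%N) (y 3%N) (y 2%N) (y 1%N) (y 4%N) (y 3%N) (y 4%N) (- y 0%N - y 1%N).

Lemma enc5K S : S^T = S -> \tr S = 0 -> dec5 (enc5 S) = S.
Proof.
move=> sS; rewrite /mxtrace sum3 => tS.
have sym i j : S i j = S j i by rewrite -{1}sS mxE.
rewrite /dec5 !mxE !inordK//= [RHS]mx3_eta (sym 1 0) (sym 2 0) (sym 2 1).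
by congr mx3; lra.
Qed.

Lemma dec5_sym x : (dec5 x)^T = dec5 x.
Proof. by rewrite /dec5 mx3T. Qed.

Lemma dec5_tr x : \tr (dec5 x) = 0.
Proof. by rewrite /dec5 tr_mx3; ring. Qed.

Lemma dec5K x : enc5 (dec5 x) = x.
Proof.
apply/colP => -[[|[|[|[|[|//]]]]] h]; rewrite mxE /= mx3E; congr (x _ 0); apply: val_inj;
  by rewrite /= inordK.
Qed.

Lemma enc5_bracket (x : 'cV[R]_5) (y := fun k => x (inord k) 0) :
  [/\ enc5 (mxbracket L1 (dec5 x)) =
        \col_i nth 0 [:: 0; -2 * y 4%N; - y 3%N; y 2%N; y 0%N + 2 * y 1%N] i,
      enc5 (mxbracket L2 (dec5 x)) =
        \col_i nth 0 [:: 2 * y 3%N; 0; y 4%N; -2 * y 0%N - y 1%N; - y 2%N] i &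
      enc5 (mxbracket L3 (dec5 x)) =
        \col_i nth 0 [:: -2 * y 2%N; 2 * y 2%N; y 0%N - y 1%N; - y 4%N; y 3%N] i].
Proof.
rewrite /dec5 /mxbracket /L1 /L2 /L3 !mx3M !mx3N !mx3D /y.
move: (x (inord 0%N) 0) (x (inord 1%N) 0) (x (inord 2%N) 0) (x (inord 3%N) 0) (x (inord 4%N) 0).
move=> y0 y1 y2 y3 y4.
by split; apply/colP => -[[|[|[|[|[|//]]]]] h]; rewrite [LHS]mxE [RHS]mxE /= mx3E; ring.
Qed.

Section Family.
Context (n : nat).

Definition family_mx d (F : 'I_d -> 'cV[R]_n) : 'M[R]_(n, d) := \matrix_(i, j) F j i 0.

Lemma family_mxE d (F : 'I_d -> 'cV[R]_n) (x : 'cV[R]_d) :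
  family_mx F *m x = \sum_j x j 0 *: F j.
Proof.
apply/colP => i; rewrite mxE summxE; apply: eq_bigr => j _.
by rewrite !mxE mulrC.
Qed.

Variables (v a b p q : 'cV[R]_n).

(** The vector v corresponds to diag(1, 1, -2). The brackets then send a to the symmetric matrix
    with entry 3 at (1,2), b to that with -3 at (0,2), p to diag(6, -6, 0) and q to entry 6 at
    (0,1). The coefficients invert this correspondence. *)
Definition tensor_family (i : 'I_5) := nth 0 [:: 2^-1 *: v + 12^-1 *: p; 2^-1 *: v - 12^-1 *: p;
  6^-1 *: q; - (3^-1) *: b; 3^-1 *: a] i.

(** With v as the third unit vector, [L1] and [L2] send it to minus the second and to the first. *)
Definition vector_family (i : 'I_3) := nth 0 [:: b; - a; v] i.

Lemma tensor_familyE (x : 'cV[R]_5) (y := fun k => x (inord k) 0) :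
  \sum_i x i 0 *: tensor_family i =
  (2^-1 * (y 0%N + y 1%N)) *: v + (3^-1 * y 4%N) *: a + (- (3^-1) * y 3%N) *: b +
  (12^-1 * (y 0%N - y 1%N)) *: p + (6^-1 * y 2%N) *: q.
Proof.
rewrite !big_ord_recl big_ord0 addr0 /tensor_family /=.
have E k (h : (k < 5)%N) (o : 'I_5) : val o = k -> x o 0 = y k.
  by move=> <-; rewrite /y inord_val.
rewrite (E 0%N)// (E 1%N)// (E 2%N)// (E 3%N)// (E 4%N)//.
by move: (y 0%N) (y 1%N) (y 2%N) (y 3%N) (y 4%N) => y0 y1 y2 y3 y4; apply/colP => i; rewrite !mxE; ring.
Qed.

Lemma tensor_family_mem (U : {vspace 'cV[R]_n}) : v \in U -> a \in U -> b \in U ->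
  p \in U -> q \in U -> forall i, tensor_family i \in U.
Proof.
move=> vU aU bU pU qU [[|[|[|[|[|//]]]]] h]; rewrite /tensor_family/=.
- by apply: memvD; exact: memvZ.
- by apply: memvB; exact: memvZ.
- exact: memvZ.
- exact: memvZ.
- exact: memvZ.
Qed.

Lemma tensor_family_coef_eq0 (x : 'cV[R]_5) (y := fun k => x (inord k) 0) :
  [/\ 2^-1 * (y 0%N + y 1%N) = 0, 3^-1 * y 4%N = 0, - (3^-1) * y 3%N = 0,
      12^-1 * (y 0%N - y 1%N) = 0 & 6^-1 * y 2%N = 0] -> x = 0.
Proof.
rewrite /y => -[e0 e1 e2 e3 e4]; rewrite -[x]dec5K /dec5.
have z0 : x (inord 0%N) 0 = 0 by lra.
have z1 : x (inord 1%N) 0 = 0 by lra.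
have z2 : x (inord 2%N) 0 = 0 by lra.
have z3 : x (inord 3%N) 0 = 0 by lra.
have z4 : x (inord 4%N) 0 = 0 by lra.
rewrite z0 z1 z2 z3 z4 subr0 oppr0.
by apply/colP => -[[|[|[|[|[|//]]]]] h]; rewrite mxE /= mx3E mxE.
Qed.

Lemma vector_familyE w : \sum_i w i 0 *: vector_family i = w 2 0 *: v + (- w 1 0) *: a + w 0 0 *: b.
Proof. by rewrite sum3 /vector_family/=; apply/colP => i; rewrite !mxE; ring. Qed.

Variables (E1 E2 E3 : 'M[R]_n).

Lemma tensor_intertwines S : tensor_table E1 E2 E3 v a b p q -> S^T = S -> \tr S = 0 ->
  [/\ E1 *m (family_mx tensor_family *m enc5 S) = family_mx tensor_family *m enc5 (mxbracket L1 S),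
      E2 *m (family_mx tensor_family *m enc5 S) = family_mx tensor_family *m enc5 (mxbracket L2 S) &
      E3 *m (family_mx tensor_family *m enc5 S) = family_mx tensor_family *m enc5 (mxbracket L3 S)].
Proof.
move=> [[v1 v2 v3] [[a1 a2 a3] [[b1 b2 b3] [[p1 p2 p3] [q1 q2 q3]]]]] sS tS.
rewrite -(enc5K sS tS); set x := enc5 S; rewrite dec5K !family_mxE !tensor_familyE.
rewrite !mulmxDr -!scalemxAr v1 v2 v3 a1 a2 a3 b1 b2 b3 p1 p2 p3 q1 q2 q3.
have [-> -> ->] := enc5_bracket x.
have colE (l : seq R) k : (k < 5)%N -> (\col_(i < 5) nth 0 l i) (inord k) 0 = nth 0 l k.
  by move=> k5; rewrite mxE inordK.
rewrite !colE//=.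
move: (x (inord 0%N) 0) (x (inord 1%N) 0) (x (inord 2%N) 0) (x (inord 3%N) 0) (x (inord 4%N) 0).
move=> y0 y1 y2 y3 y4.
by split; apply/colP => i; rewrite !mxE; field.
Qed.

Lemma vector_intertwines w : vector_table E1 E2 E3 v a b ->
  [/\ E1 *m (family_mx vector_family *m w) = family_mx vector_family *m (L1 *m w),
      E2 *m (family_mx vector_family *m w) = family_mx vector_family *m (L2 *m w) &
      E3 *m (family_mx vector_family *m w) = family_mx vector_family *m (L3 *m w)].
Proof.
move=> [[v1 v2 v3] [[a1 a2 a3] [b1 b2 b3]]].
rewrite (cv3_eta w); move: (w 0 0) (w 1 0) (w 2 0) => x y z; rewrite /L1 /L2 /L3 !mx3_cv3 !family_mxE !vector_familyE !cv3E.
rewrite !mulmxDr -!scalemxAr v1 v2 v3 a1 a2 a3 b1 b2 b3.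
by split; apply/colP => i; rewrite !mxE; ring.
Qed.

End Family.

Section Decomposition.
Context (n : nat) (E1 E2 E3 : 'M[R]_n).
Hypotheses (c12 : mxbracket E1 E2 = E3) (c23 : mxbracket E2 E3 = E1) (c31 : mxbracket E3 E1 = E2).
Hypotheses (k1 : E1^T = - E1) (k2 : E2^T = - E2) (k3 : E3^T = - E3).
Implicit Types U : {vspace 'cV[R]_n}.

Let weight0 U : irreducible E1 E2 E3 U -> odd (\dim U) ->
  exists v, [/\ v \in U, v != 0 & E3 *m v = 0].
Proof.
by move=> [st _ _] oU; apply: odd_skew_kernel => // u /st [].
Qed.

(** If p were 0, the short string would span a stable subspace of dimension at most 3 inside [U]; so
    the long string applies. *)
Lemma tensor_component U : irreducible E1 E2 E3 U -> \dim U = 5 ->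
  exists F : 'I_5 -> 'cV[R]_n,
  [/\ forall x : 'cV[R]_5, family_mx F *m x \in U,
      forall x : 'cV[R]_5, family_mx F *m x = 0 -> x = 0,
      forall u, u \in U -> exists x : 'cV[R]_5, u = family_mx F *m x &
      forall S, S^T = S -> \tr S = 0 ->
  [/\ E1 *m (family_mx F *m enc5 S) = family_mx F *m enc5 (mxbracket L1 S),
      E2 *m (family_mx F *m enc5 S) = family_mx F *m enc5 (mxbracket L2 S) &
      E3 *m (family_mx F *m enc5 S) = family_mx F *m enc5 (mxbracket L3 S)]].
Proof.
move=> iU dU; have [|v [vU v0 v3]] := weight0 iU; first by rewrite dU.
have [st _ irr] := iU.
set a := E1 *m v; set b := E2 *m v; set p := E1 *m a - E2 *m b; set q := E1 *m b + E2 *m a.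
have dU1 : (1 < \dim U)%N by rewrite dU.
have a0 : a != 0 by apply: (string_a_neq0 c31 (v := v) (b := b) v3 erefl erefl iU).
have [aU bU _] := st v vU; have [a1U a2U _] := st a aU; have [b1U b2U _] := st b bU.
have p0 : p != 0.
  apply/eqP => p0.
  have [[v1 v2 _] [[a1 a2 a3] [b1 b2 b3]]] := string_short c12 c23 c31 v3 erefl erefl erefl erefl iU dU1 vU p0.
  pose W := <<[:: v; a; b]>>%VS.
  have vW : v \in W by rewrite memv_span// !inE eqxx.
  have aW : a \in W by rewrite memv_span// !inE eqxx orbT.
  have bW : b \in W by rewrite memv_span// !inE eqxx !orbT.
  have WU : (W <= U)%VS.
    by apply/span_subvP => u; rewrite !inE => /orP[|/orP[]] /eqP ->.
  have dW : (\dim W <= 3)%N by exact: dim_span.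
  have stW : stable E1 E2 E3 W.
    have base (E : 'M[R]_n) : E *m v \in W -> E *m a \in W -> E *m b \in W ->
        forall u, u \in W -> E *m u \in W.
      move=> hv ha hb u uW; rewrite (coord_span (X := [tuple v; a; b]) uW) mulmx_sumr.
      apply: memv_suml => i _; rewrite -scalemxAr; apply: memvZ.
      by case: i => -[|[|[|//]]].
    move=> u uW; split; apply: base => //.
    - by rewrite a1 memvN.
    - by rewrite b1 mem0v.
    - by rewrite a2 mem0v.
    - by rewrite b2 memvN.
    - by rewrite v3 mem0v.
    - by rewrite a3.
    - by rewrite b3 memvN.
  have [W0|WE] := irr W WU stW; last by move: dW; rewrite WE dU.
  by move/eqP: v0; apply; apply/eqP; rewrite -memv0 -W0.
have tab := string_long c12 c23 c31 v3 erefl erefl erefl erefl iU dU vU v0 p0.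
have pU : p \in U by exact: memvB.
have qU : q \in U by exact: memvD.
pose F := tensor_family v a b p q.
have FU : forall i, F i \in U by exact: tensor_family_mem.
have Find (x : 'cV[R]_5) : \sum_i x i 0 *: F i = 0 -> x = 0.
  rewrite tensor_familyE => /(weight_independent c23 c31 v3 erefl erefl erefl erefl v0 a0 (or_introl p0)).
  exact: tensor_family_coef_eq0.
exists F; split.
- by move=> x; rewrite family_mxE; apply: memv_suml => i _; apply: memvZ.
- by move=> x; rewrite family_mxE; exact: Find.
- move=> u uU; have [|x ->] := independent_generates FU Find _ uU; first by rewrite dU.
  by exists x; rewrite family_mxE.
- by move=> S sS tS; exact: tensor_intertwines.
Qed.

(** A nonzero p would give five independent vectors in a space of dimension 3; so the short string
    applies. *)
Lemma vector_component U : irreducible E1 E2 E3 U -> \dim U = 3 ->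
  exists F : 'I_3 -> 'cV[R]_n,
  [/\ forall x : 'cV[R]_3, family_mx F *m x \in U,
      forall x : 'cV[R]_3, family_mx F *m x = 0 -> x = 0,
      forall u, u \in U -> exists x : 'cV[R]_3, u = family_mx F *m x &
      forall w,
  [/\ E1 *m (family_mx F *m w) = family_mx F *m (L1 *m w),
      E2 *m (family_mx F *m w) = family_mx F *m (L2 *m w) &
      E3 *m (family_mx F *m w) = family_mx F *m (L3 *m w)]].
Proof.
move=> iU dU; have [|v [vU v0 v3]] := weight0 iU; first by rewrite dU.
have [st _ irr] := iU.
set a := E1 *m v; set b := E2 *m v; set p := E1 *m a - E2 *m b; set q := E1 *m b + E2 *m a.
have dU1 : (1 < \dim U)%N by rewrite dU.
have a0 : a != 0 by apply: (string_a_neq0 c31 (v := v) (b := b) v3 erefl erefl iU).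
have [aU bU _] := st v vU; have [a1U a2U _] := st a aU; have [b1U b2U _] := st b bU.
have pU : p \in U by exact: memvB.
have qU : q \in U by exact: memvD.
have indep := weight_independent c23 c31 v3 (erefl a) (erefl b) (erefl p) (erefl q).
have p0 : p = 0.
  apply/eqP; apply/negP => /negP p0.
  pose F := tensor_family v a b p q.
  have : (5 <= \dim U)%N.
    apply: (@independent_le_dim _ _ _ _ F); first exact: tensor_family_mem.
    move=> x; rewrite tensor_familyE => /(indep _ _ _ _ _ v0 a0 (or_introl p0)).
    exact: tensor_family_coef_eq0.
  by rewrite dU.
have tab := string_short c12 c23 c31 v3 erefl erefl erefl erefl iU dU1 vU p0.
pose F := vector_family v a b.
have FU i : F i \in U.
  by case: i => -[|[|[|//]]] h; rewrite /F /vector_family /= ?memvN.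
have Find (x : 'cV[R]_3) : \sum_i x i 0 *: F i = 0 -> x = 0.
  rewrite vector_familyE => E.
  have [||z2 z1 z0 _ _] := indep (x 2 0) (- x 1 0) (x 0 0) 0 0 v0 a0; first by right.
    by rewrite !scale0r !addr0.
  apply/colP; apply: ord3P; rewrite mxE //; lra.
exists F; split.
- by move=> x; rewrite family_mxE; apply: memv_suml => i _; apply: memvZ.
- by move=> x; rewrite family_mxE; exact: Find.
- move=> u uU; have [|x ->] := independent_generates FU Find _ uU; first by rewrite dU.
  by exists x; rewrite family_mxE.
- by move=> w; exact: vector_intertwines.
Qed.

(** A skew matrix with a real eigenvector kills it, because its quadratic form vanishes. *)
Lemma trivial_component U : irreducible E1 E2 E3 U -> \dim U = 1 ->
  exists u0, [/\ u0 \in U, u0 != 0, forall u, u \in U -> exists t : R, u = t *: u0 &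
    [/\ E1 *m u0 = 0, E2 *m u0 = 0 & E3 *m u0 = 0]].
Proof.
move=> [st U0 _] dU; exists (vpick U).
have u0U := memv_pick U; set u0 := vpick U in u0U *.
have u00 : u0 != 0 by rewrite vpick0.
have gen u : u \in U -> exists t : R, u = t *: u0.
  suff -> : U = <[u0]>%VS by move/vlineP.
  by apply/esym/eqP; rewrite eqEdim -memvE u0U dim_vline u00 dU.
have kill (E : 'M[R]_n) : E^T = - E -> E *m u0 \in U -> E *m u0 = 0.
  move=> kE /gen [t tE].
  have : u0^T *m (E *m u0) = - (u0^T *m (E *m u0)).
    set N := u0^T *m (E *m u0).
    have {1}<- : N^T = N by apply/matrixP => i j; rewrite !ord1 mxE.
    by rewrite /N !trmx_mul trmxK kE mulmxN mulNmx mulmxA.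
  move/eqP; rewrite -addr_eq0 -mulr2n -scaler_nat scaler_eq0 pnatr_eq0/= tE -scalemxAr scaler_eq0.
  move=> /orP[/eqP -> |/eqP /trmx_mul_eq0 h]; first by rewrite scale0r.
  by rewrite h eqxx in u00.
by have [h1 h2 h3] := st u0 u0U; split => //; split; exact: kill.
Qed.

Lemma standard_basis k (U : 'I_k.+2 -> {vspace 'cV[R]_n}) :
  (forall i, irreducible E1 E2 E3 (U i)) ->
  \dim (U ord0) = 5 -> \dim (U (lift ord0 ord0)) = 3 ->
  (forall j, \dim (U (lift ord0 (lift ord0 j))) = 1) ->
  directv (\sum_i U i) -> (\sum_i U i)%VS = fullv ->
  exists (P : 'M[R]_(n, 5 + (3 + k))) (Q : 'M[R]_(5 + (3 + k), n)),
  [/\ P *m Q = 1%:M, Q *m P = 1%:M &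
    forall S w (c : 'cV[R]_k), S^T = S -> \tr S = 0 ->
    [/\ E1 *m (P *m enc S w c) = P *m enc (mxbracket L1 S) (L1 *m w) 0,
        E2 *m (P *m enc S w c) = P *m enc (mxbracket L2 S) (L2 *m w) 0 &
        E3 *m (P *m enc S w c) = P *m enc (mxbracket L3 S) (L3 *m w) 0]].
Proof.
move=> iU d5 d3 d1 dir full.
have [F5 [F5U F5inj F5gen F5E]] := tensor_component (iU _) d5.
have [F3 [F3U F3inj F3gen F3E]] := vector_component (iU _) d3.
have /cid [z zP] : exists z : 'I_k -> 'cV[R]_n, forall j,
   [/\ z j \in U (lift ord0 (lift ord0 j)), z j != 0,
     forall u, u \in U (lift ord0 (lift ord0 j)) -> exists t : R, u = t *: z j &
    [/\ E1 *m z j = 0, E2 *m z j = 0 & E3 *m z j = 0]].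
  exists (fun j => sval (cid (trivial_component (iU (lift ord0 (lift ord0 j))) (d1 j)))) => j.
  by case: cid.
pose P := row_mx (family_mx F5) (row_mx (family_mx F3) (family_mx z)).
have PE (x : 'cV[R]_5) (y : 'cV[R]_3) (c : 'cV[R]_k) : P *m col_mx x (col_mx y c) =
    family_mx F5 *m x + (family_mx F3 *m y + \sum_j c j 0 *: z j).
  by rewrite /P !mul_row_col family_mxE !family_mxE.
have Psurj u : exists x : 'cV[R]_(5 + (3 + k)), P *m x = u.
  have : u \in fullv by rewrite memvf.
  rewrite -full => /memv_sumP [vs vsU ->].
  rewrite !big_ord_recl.
  have [x xE] := F5gen _ (vsU ord0 isT).
  have [y yE] := F3gen _ (vsU (lift ord0 ord0) isT).
  have cP j : exists t : R, vs (lift ord0 (lift ord0 j)) = t *: z j.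
    by have [_ _ g _] := zP j; apply: g; exact: vsU.
  exists (col_mx x (col_mx y (\col_j sval (cid (cP j))))).
  rewrite PE -xE -yE; congr (_ + (_ + _)); apply: eq_bigr => j _.
  by rewrite mxE; case: cid.
have Pinj (x : 'cV[R]_(5 + (3 + k))) : P *m x = 0 -> x = 0.
  rewrite -[x]vsubmxK -[dsubmx x]vsubmxK PE.
  set x5 := usubmx x; set x3 := usubmx _; set c := dsubmx _ => E.
  pose us (i : 'I_k.+2) := if unlift ord0 i is Some i' then
    (if unlift ord0 i' is Some j then c j 0 *: z j else family_mx F3 *m x3)
    else family_mx F5 *m x5.
  have us0 : us ord0 = family_mx F5 *m x5 by rewrite /us unlift_none.
  have us1 : us (lift ord0 ord0) = family_mx F3 *m x3 by rewrite /us liftK unlift_none.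
  have us2 j : us (lift ord0 (lift ord0 j)) = c j 0 *: z j by rewrite /us !liftK.
  have H := directv_sum_independent dir us.
  have {}H i : us i = 0.
    apply: H => // [{}i _|]; last first.
      by rewrite !big_ord_recl us0 us1 -[RHS]E; congr (_ + (_ + _)); apply: eq_bigr => j _; rewrite us2.
    case: (unliftP ord0 i) => [i' ->|->]; last by rewrite us0.
    case: (unliftP ord0 i') => [j ->|->]; last by rewrite us1.
    by rewrite us2; apply: memvZ; case: (zP j).
  have -> : x5 = 0 by apply: F5inj; rewrite -us0.
  have -> : x3 = 0 by apply: F3inj; rewrite -us1.
  have -> : c = 0.
    apply/colP => j; rewrite [RHS]mxE; have := H (lift ord0 (lift ord0 j)).
    rewrite us2 => /eqP; rewrite scaler_eq0; have [_ /negbTE -> _ _] := zP j.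
    by rewrite orbF => /eqP.
  by rewrite !col_mx0.
pose Q : 'M[R]_(5 + (3 + k), n) := \matrix_(i, j) (sval (cid (Psurj (delta_mx j 0)))) i 0.
have PQ : P *m Q = 1%:M.
  apply/matrixP => i j.
  have -> : (1%:M : 'M[R]_n) i j = (delta_mx j 0 : 'cV[R]_n) i 0 by rewrite !mxE eqxx andbT.
  rewrite -(svalP (cid (Psurj (delta_mx j 0)))) [LHS]mxE [RHS]mxE.
  by apply: eq_bigr => l _; rewrite [Q _ _]mxE.
(* The sizes [n] and [5 + (3 + k)] are not identified, so the second inverse identity is drawn from
   injectivity of [P]. *)
have QP : Q *m P = 1%:M.
  apply/eqP; rewrite -subr_eq0; apply/eqP.
  have H (M : 'M[R]_(5 + (3 + k))) : (forall j, col j M = 0) -> M = 0.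
    move=> M0; apply/matrixP => i j; have := congr1 (fun N : 'cV[R]_(5 + (3 + k)) => N i 0) (M0 j).
    by rewrite !mxE.
  apply: H => j; apply: Pinj.
  by rewrite colE mulmxA mulmxBr mulmxA PQ mul1mx mulmx1 subrr mul0mx.
exists P, Q; split => // S w c sS tS.
have [e1 e2 e3] := F5E S sS tS; have [f1 f2 f3] := F3E w.
have zk (E : 'M[R]_n) : (forall j, E *m z j = 0) -> E *m (\sum_j c j 0 *: z j) = 0.
  by move=> zE; rewrite mulmx_sumr big1// => j _; rewrite -scalemxAr zE scaler0.
have z0 : \sum_j (0 : 'cV[R]_k) j 0 *: z j = 0.
  by rewrite big1// => j _; rewrite mxE scale0r.
by split; rewrite /enc !PE !mulmxDr z0 ?e1 ?e2 ?e3 ?f1 ?f2 ?f3 zk // => j;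
  case: (zP j) => _ _ _ [].
Qed.

End Decomposition.
End Model.

(** * The action of SO(3) on tensors and vectors *)

Lemma linear_map0 (R : pzRingType) (U V : lmodType R) (f : U -> V) :
  (forall a u v, f (a *: u + v) = a *: f u + f v) -> f 0 = 0.
Proof.
by move=> fL; have /(congr1 (fun z => z - f 0)) := fL 1 0 0; rewrite !scale1r addr0 subrr addrK.
Qed.

Section ModelAction.
Context (R : realType) (k : nat).
Implicit Types (S A V : 'M[R]_3) (w : 'cV[R]_3) (c : 'cV[R]_k) (x : 'cV[R]_(5 + (3 + k))).

Definition tensor_part x : 'M[R]_3 := dec5 (usubmx x).
Definition vector_part x : 'cV[R]_3 := usubmx (dsubmx x).
Definition trivial_part x : 'cV[R]_k := dsubmx (dsubmx x).

Lemma enc_eta x : enc (tensor_part x) (vector_part x) (trivial_part x) = x.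
Proof. by rewrite /enc dec5K !vsubmxK. Qed.

Lemma tensor_part_enc S w c : S^T = S -> \tr S = 0 -> tensor_part (enc S w c) = S.
Proof. by move=> sS tS; rewrite /tensor_part col_mxKu enc5K. Qed.

Lemma vector_part_enc S w c : vector_part (enc S w c) = w.
Proof. by rewrite /vector_part col_mxKd col_mxKu. Qed.

Lemma trivial_part_enc S w c : trivial_part (enc S w c) = c.
Proof. by rewrite /trivial_part !col_mxKd. Qed.

Lemma tensor_part_sym x : (tensor_part x)^T = tensor_part x.
Proof. exact: dec5_sym. Qed.

Lemma tensor_part_tr x : \tr (tensor_part x) = 0.
Proof. exact: dec5_tr. Qed.

Lemma enc_linear (a : R) S w c S' w' c' :
  enc (a *: S + S') (a *: w + w') (a *: c + c') = a *: enc S w c + enc S' w' c'.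
Proof.
rewrite /enc !scale_col_mx !add_col_mx; congr col_mx.
by apply/colP => -[[|[|[|[|[|//]]]]] h]; rewrite !mxE.
Qed.

Lemma tensor_part_linear (a : R) x y :
  tensor_part (a *: x + y) = a *: tensor_part x + tensor_part y.
Proof.
by rewrite /tensor_part /dec5 !linearP/= mx3Z mx3D !mxE; congr mx3; ring.
Qed.

Lemma vector_part_linear (a : R) x y :
  vector_part (a *: x + y) = a *: vector_part x + vector_part y.
Proof. by rewrite /vector_part !linearP. Qed.

Lemma trivial_part_linear (a : R) x y :
  trivial_part (a *: x + y) = a *: trivial_part x + trivial_part y.
Proof. by rewrite /trivial_part !linearP. Qed.

Definition rotate A x := enc (A *m tensor_part x *m A^T) (A *m vector_part x) (trivial_part x).

(* The difference quotient at 1, in direction V and with step d, of the action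
   of A on x; at d = 0 it is the infinitesimal action. *)
Definition rotate_diff (d : R) V x :=
  let S := tensor_part x in
  enc (V *m S + S *m V^T + d *: (V *m S *m V^T)) (V *m vector_part x) (0 : 'cV[R]_k).

Definition rot_mx A : 'M[R]_(5 + (3 + k)) := family_mx (fun j => rotate A (delta_mx j 0)).

Definition diff_mx d V : 'M[R]_(5 + (3 + k)) :=
  family_mx (fun j => rotate_diff d V (delta_mx j 0)).

Lemma family_mx_linear m (f : 'cV[R]_m -> 'cV[R]_m) (x : 'cV[R]_m) :
  (forall a u v, f (a *: u + v) = a *: f u + f v) ->
  family_mx (fun j => f (delta_mx j 0)) *m x = f x.
Proof.
move=> fL.
have f0 : f 0 = 0 := linear_map0 fL.
have fD : {morph f : u v / u + v} by move=> u v; rewrite -[u]scale1r fL !scale1r.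
rewrite family_mxE [in RHS](matrix_sum_delta x) (big_morph f fD f0).
apply: eq_bigr => i _; rewrite big_ord1.
by have := fL (x i 0) (delta_mx i 0) 0; rewrite f0 !addr0.
Qed.

Lemma rot_mxE A x : rot_mx A *m x = rotate A x.
Proof.
apply: (family_mx_linear (f := rotate A)) => a u v.
rewrite /rotate tensor_part_linear vector_part_linear trivial_part_linear -enc_linear.
by rewrite !mulmxDr mulmxDl -!scalemxAr -scalemxAl.
Qed.

Lemma diff_mxE d V x : diff_mx d V *m x = rotate_diff d V x.
Proof.
apply: (family_mx_linear (f := rotate_diff d V)) => a u v.
rewrite /rotate_diff tensor_part_linear vector_part_linear -enc_linear; congr enc.
- move: (tensor_part u) (tensor_part v) => S S'.
  rewrite !mulmxDr !mulmxDl -!scalemxAr -!scalemxAl !scalerDr !scalerA (mulrC d a).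
  move: (V *m S) (S *m V^T) (V *m S *m V^T) => X1 X2 X3.
  by apply/matrixP => i j; rewrite !mxE; ring.
- by rewrite mulmxDr -scalemxAr.
- by rewrite scaler0 addr0.
Qed.

Lemma mulmx_ext m p (M M' : 'M[R]_(m, p)) : (forall x : 'cV[R]_p, M *m x = M' *m x) -> M = M'.
Proof.
move=> MM; apply/matrixP => i j; have := congr1 (fun x : 'cV[R]_m => x i 0) (MM (delta_mx j 0)).
by rewrite -!colE !mxE.
Qed.

Lemma rotate_enc A S w c : S^T = S -> \tr S = 0 ->
  rotate A (enc S w c) = enc (A *m S *m A^T) (A *m w) c.
Proof. by move=> sS tS; rewrite /rotate tensor_part_enc// vector_part_enc trivial_part_enc. Qed.

Lemma conj_tr A S : A^T *m A = 1%:M -> \tr (A *m S *m A^T) = \tr S.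
Proof. by move=> AA; rewrite mxtrace_mulC mulmxA AA mul1mx. Qed.

Lemma rot_mx1 : rot_mx 1%:M = 1%:M.
Proof.
by apply: mulmx_ext => x; rewrite rot_mxE /rotate trmx1 !mul1mx mulmx1 enc_eta.
Qed.

Lemma rot_mxM A B : B^T *m B = 1%:M -> rot_mx (A *m B) = rot_mx A *m rot_mx B.
Proof.
move=> BB; apply: mulmx_ext => x; rewrite -mulmxA !rot_mxE [rotate B x]/rotate rotate_enc.
- by rewrite /rotate trmx_mul !mulmxA.
- by rewrite !trmx_mul trmxK tensor_part_sym mulmxA.
- by rewrite conj_tr ?tensor_part_tr.
Qed.

(** An exact identity, the quadratic term in [d] being kept inside [diff_mx]. Rotations near 1
    therefore have literally the shape required by [cvg_compound_expmx]. *)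
Lemma rot_mx_diff (d : R) V : rot_mx (1%:M + d *: V) = 1%:M + d *: diff_mx d V.
Proof.
apply: mulmx_ext => x; rewrite mulmxDl mul1mx -scalemxAl rot_mxE diff_mxE /rotate /rotate_diff.
rewrite -[X in _ = X + _](enc_eta x) [RHS]addrC -enc_linear; congr enc; last by rewrite scaler0 add0r.
- rewrite linearD/= trmx1 linearZ/= !mulmxDl !mul1mx !mulmxDr !mulmx1 -!scalemxAr -!scalemxAl.
  move: (tensor_part x) => S.
  move: (V *m S) (S *m V^T) (V *m S *m V^T) => X1 X2 X3.
  by apply/matrixP => i j; rewrite !mxE; ring.
- by rewrite mulmxDl mul1mx -scalemxAl addrC.
Qed.

Lemma diff_mx0_enc V S w c : S^T = S -> \tr S = 0 ->
  diff_mx 0 V *m enc S w c = enc (V *m S + S *m V^T) (V *m w) 0.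
Proof.
by move=> sS tS; rewrite diff_mxE /rotate_diff tensor_part_enc// vector_part_enc scale0r addr0.
Qed.

Lemma rot_mx_diff0 A V V' : V' *m A = A *m V -> A^T *m A = 1%:M -> V^T = - V ->
  rot_mx A *m diff_mx 0 V = diff_mx 0 V' *m rot_mx A.
Proof.
move=> VA AA kV; apply: mulmx_ext => x; rewrite -!mulmxA rot_mxE [in LHS]diff_mxE rot_mxE.
rewrite /rotate_diff scale0r addr0; set S := tensor_part x.
have sS : S^T = S by exact: tensor_part_sym.
have tS : \tr S = 0 by exact: tensor_part_tr.
rewrite rotate_enc; first last.
- by rewrite linearD/= kV mulmxN linearN/= [\tr (S *m V)]mxtrace_mulC subrr.
- by rewrite linearD/= !trmx_mul trmxK sS addrC.
rewrite /rotate -/S diff_mx0_enc; first last.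
- by rewrite conj_tr.
- by rewrite !trmx_mul trmxK sS mulmxA.
have VA' : V^T *m A^T = A^T *m V'^T by rewrite -!trmx_mul VA.
by rewrite mulmxDr mulmxDl !mulmxA VA -!mulmxA VA'.
Qed.

Lemma continuous_col_mx (T : topologicalType) m p (u : T -> 'cV[R]_m) (v : T -> 'cV[R]_p) :
  continuous u -> continuous v -> continuous (fun t => col_mx (u t) (v t)).
Proof.
move=> uc vc; apply: continuous_mx => l j; rewrite -(splitK l); case: (fintype.split l) => o /=.
  by under eq_fun do rewrite col_mxEu; exact: continuous_entry.
by under eq_fun do rewrite col_mxEd; exact: continuous_entry.
Qed.

Lemma continuous_enc (T : topologicalType) (f : T -> 'M[R]_3) (g : T -> 'cV[R]_3)
    (h : T -> 'cV[R]_k) :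
  continuous f -> continuous g -> continuous h -> continuous (fun t => enc (f t) (g t) (h t)).
Proof.
move=> fc gc hc; apply: continuous_col_mx; last exact: continuous_col_mx.
by apply: continuous_mx => -[[|[|[|[|[|//]]]]] l] b; under eq_fun do rewrite mxE /=; exact: continuous_entry.
Qed.

Lemma continuous_trmx (T : topologicalType) m p (f : T -> 'M[R]_(m, p)) :
  continuous f -> continuous (fun t => (f t)^T).
Proof.
by move=> fc; apply: continuous_mx => i j; under eq_fun do rewrite mxE; exact: continuous_entry.
Qed.

Lemma continuous_rot_mx (T : topologicalType) (f : T -> 'M[R]_3) :
  continuous f -> continuous (fun t => rot_mx (f t)).
Proof.
move=> fc; apply: continuous_mx => i j; under eq_fun do rewrite mxE; apply: continuous_entry.
apply: continuous_enc; last exact: continuous_cst.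
- apply: continuous_mulmx; last exact: continuous_trmx.
  by apply: continuous_mulmx => //; exact: continuous_cst.
- by apply: continuous_mulmx => //; exact: continuous_cst.
Qed.

Lemma continuous_diff_mx (T : topologicalType) (d : T -> R) (f : T -> 'M[R]_3) :
  continuous d -> continuous f -> continuous (fun t => diff_mx (d t) (f t)).
Proof.
move=> dc fc; have fT := continuous_trmx fc.
have cc m p (M : 'M[R]_(m, p)) : continuous (fun _ : T => M) by exact: continuous_cst.
apply: continuous_mx => i j; under eq_fun do rewrite mxE; apply: continuous_entry.
apply: continuous_enc; [|exact: continuous_mulmx fc (cc _ _ _)|exact: cc].
set S := tensor_part _.
have c1 : continuous (fun t => f t *m S) := continuous_mulmx fc (cc _ _ S).
have c2 : continuous (fun t => S *m (f t)^T) := continuous_mulmx (cc _ _ S) fT.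
have c3 : continuous (fun t => f t *m S *m (f t)^T) := continuous_mulmx c1 fT.
apply: continuous_mx => a b.
have -> : (fun t => (f t *m S + S *m (f t)^T + d t *: (f t *m S *m (f t)^T)) a b) =
    (fun t => (f t *m S) a b + (S *m (f t)^T) a b + d t * (f t *m S *m (f t)^T) a b).
  by apply/funext => t; move: (f t *m S) (S *m _) (_ *m _) => X1 X2 X3; rewrite !mxE.
apply: continuous_add; first by apply: continuous_add; exact: continuous_entry.
by apply: continuous_mul => //; exact: continuous_entry.
Qed.

End ModelAction.

(** * Exponentials of infinitesimal rotations in the representation *)

Section Rodrigues.
Context (R : realType).
Implicit Types (L : 'M[R]_3) (t : R).

Lemma cvg_scaled_increment (f : R -> R) (l t : R) : is_derive (0 : R) (1 : R) f l ->
  (fun j : nat => j.+1%:R * (f (t * j.+1%:R^-1) - f 0)) @ \oo --> t * l.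
Proof.
move=> [df fl].
have [->|t0] := eqVneq t 0.
  by rewrite mul0r; under eq_fun do rewrite mul0r subrr mulr0; exact: cvg_cst.
pose h j := t * j.+1%:R^-1 : R.
have h0 j : h j != 0 by rewrite mulf_neq0// invr_neq0// pnatr_eq0.
have hc : h @ \oo --> 0.
  rewrite -[X in _ --> X](mulr0 t); apply: cvgMr.
  exact: cvg_harmonic.
have hd : h @ \oo --> (0 : R)^'.
  move=> A [e /= e0 eA]; move/cvgrPdist_lt : hc => /(_ e e0) [N _ NP].
  by exists N => // j Nj; apply: eA; [exact: NP|exact: h0].
have := cvg_comp _ _ hd df.
rewrite -/(derive _ _ _) fl => H.
have -> : (fun j : nat => j.+1%:R * (f (t * j.+1%:R^-1) - f 0)) =
    (fun j => t * ((h j)^-1 * (f (h j) - f 0))).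
  apply/funext => j; rewrite /h invfM invrK !mulrA divff// mul1r.
  done.
apply: cvgMr; apply: cvg_ext H => j /=.
by rewrite /= addr0 /GRing.scale/= mulr1.
Qed.

(** Rodrigues' closed form of exp(tL) for [L^3 = - L]. Only its one-parameter group law and its
    derivative at 0 are used, so no series is summed. *)
Definition rodrigues L t := 1%:M + sin t *: L + (1 - cos t) *: (L *m L).

Lemma rodrigues0 L : rodrigues L 0 = 1%:M.
Proof. by rewrite /rodrigues sin0 cos0 subrr !scale0r !addr0. Qed.

Lemma rodriguesD L s t : L *m L *m L = - L ->
  rodrigues L (s + t) = rodrigues L s *m rodrigues L t.
Proof.
move=> L3; rewrite /rodrigues sinD cosD; set X := L *m L.
have XL : X *m L = - L by [].
have LX : L *m X = - L by rewrite /X mulmxA.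
have XX : X *m X = - X by rewrite {2}/X mulmxA XL mulNmx.
rewrite !(mulmxDl, mulmxDr, mul1mx, mulmx1) -!scalemxAl -!scalemxAr XX LX XL -/X.
by move: X {XL LX XX} => X; apply/matrixP => i j; rewrite !mxE; ring.
Qed.

Lemma rodriguesT L t : L^T = - L -> (rodrigues L t)^T = rodrigues L (- t).
Proof.
move=> kL; rewrite /rodrigues sinN cosN !linearD/= trmx1 !linearZ/= trmx_mul kL.
by rewrite mulNmx mulmxN opprK scalerN scaleNr.
Qed.

Lemma rodrigues_orthogonal L t : L^T = - L -> L *m L *m L = - L ->
  (rodrigues L t)^T *m rodrigues L t = 1%:M.
Proof. by move=> kL L3; rewrite rodriguesT// -rodriguesD// addNr rodrigues0. Qed.

Context (n k : nat) (P : 'M[R]_(n, 5 + (3 + k))) (Q : 'M[R]_(5 + (3 + k), n)).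
Hypotheses (PQ : P *m Q = 1%:M) (QP : Q *m P = 1%:M).

Lemma rot_mx_exp L t m : L^T = - L -> L *m L *m L = - L ->
  (P *m rot_mx k (rodrigues L t) *m Q) ^+ m = P *m rot_mx k (rodrigues L (m%:R * t)) *m Q.
Proof.
move=> kL L3; elim: m => [|m IH].
  by rewrite expr0 mul0r rodrigues0 rot_mx1 mulmx1 PQ.
rewrite exprS IH -mulmxE !mulmxA -[P *m _ *m Q *m P]mulmxA QP mulmx1.
rewrite -[P *m _ *m rot_mx _ _]mulmxA -rot_mxM; last exact: rodrigues_orthogonal.
by rewrite -(rodriguesD _ _ L3) -nat1r mulrDl mul1r.
Qed.

Lemma diff_mx_scale L t : diff_mx k 0 (t *: L) = t *: diff_mx k 0 L.
Proof.
apply: mulmx_ext => x; rewrite -scalemxAl !diff_mxE /rotate_diff !scale0r !addr0.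
have := enc_linear t (L *m tensor_part x + tensor_part x *m L^T) (L *m vector_part x) (0 : 'cV[R]_k) 0 0 0.
rewrite !addr0 scaler0.
rewrite (_ : enc 0 0 0 = 0) ?addr0 => [<-|]; last first.
  have := enc_linear 1 (0 : 'M[R]_3) (0 : 'cV[R]_3) (0 : 'cV[R]_k) 0 0 0.
  rewrite !scaler0 !addr0 scale1r => /(congr1 (fun z => z - enc 0 0 0)).
  by rewrite subrr addrK.
by congr enc; rewrite ?linearZ/= -!scalemxAl -?scalemxAr ?scalerDr.
Qed.

(** Cut the rotation by t into j + 1 equal steps. Each step is 1 + Y_j / (j + 1) with Y_j converging
    to t times the infinitesimal action, while the full power does not depend on j. The compound
    limit identifies that constant as the exponential. *)
Lemma expmx_diff L t : L^T = - L -> L *m L *m L = - L ->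
  expmx (t *: (P *m diff_mx k 0 L *m Q)) = P *m rot_mx k (rodrigues L t) *m Q.
Proof.
move=> kL L3.
pose d (j : nat) : R := j.+1%:R^-1.
pose V j := (j.+1%:R * (sin (t * d j) - sin 0)) *: L +
  (- (j.+1%:R * (cos (t * d j) - cos 0))) *: (L *m L).
have VE j : 1%:M + d j *: V j = rodrigues L (t * d j).
  rewrite /V /rodrigues scalerDr !scalerA mulrN !mulrA mulVf ?pnatr_eq0// !mul1r.
  by rewrite sin0 cos0 subr0 opprB addrA.
have Vc : V @ \oo --> t *: L.
  rewrite -[X in _ --> X]addr0; apply: cvgD.
    apply: cvgZl; rewrite -[X in _ --> X]mulr1 -{2}cos0.
    exact: cvg_scaled_increment.
  rewrite -(scale0r (L *m L)); apply: cvgZl; rewrite -[X in _ --> X]oppr0; apply: cvgN.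
  by have := cvg_scaled_increment (t := t) (is_derive_cos 0); rewrite sin0 oppr0 mulr0.
have dc : d @ \oo --> 0 by exact: cvg_harmonic.
pose Y j := P *m diff_mx k (d j) (V j) *m Q.
have Yc : Y @ \oo --> t *: (P *m diff_mx k 0 L *m Q).
  rewrite scalemxAl scalemxAr -diff_mx_scale.
  pose g (x : R * 'M[R]_3) := P *m diff_mx k x.1 x.2 *m Q.
  have gc : continuous g.
    apply: continuous_mulmx; last exact: continuous_cst.
    apply: continuous_mulmx; first exact: continuous_cst.
    by apply: continuous_diff_mx => x; [exact: cvg_fst|exact: cvg_snd].
  have dV := @cvg_pair _ _ _ \oo (nbhs (0 : R)) (nbhs (t *: L)) eventually_filter (nbhs_filter _) (nbhs_filter _) d V dc Vc.
  exact: (cvg_comp _ _ dV (gc (0, t *: L))).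
have kc : (fun j : nat => j.+1) @ \oo --> \oo by move=> A [N _ NA]; exists N => // j Nj; apply: NA; exact: leqW.
have H := cvg_compound_expmx kc Yc.
have E : (fun j => (1%:M + (j.+1%:R)^-1 *: Y j) ^+ j.+1) =
    (fun=> P *m rot_mx k (rodrigues L t) *m Q).
  apply/funext => j.
  rewrite -[in LHS]PQ -[in X in X + _](mulmx1 P) scalemxAl scalemxAr -mulmxDl -mulmxDr.
  rewrite -rot_mx_diff VE (rot_mx_exp _ _ kL L3); congr (_ *m rot_mx _ (rodrigues _ _) *m _).
  by rewrite mulrCA divff ?mulr1// pnatr_eq0.
rewrite E in H.
have cc : (fun _ : nat => P *m rot_mx k (rodrigues L t) *m Q) @ \oo --> P *m rot_mx k (rodrigues L t) *m Q.
  exact: cvg_cst.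
exact: (cvg_unique _ H cc).
Qed.

End Rodrigues.

(** * The cross product and its automorphisms *)

Section Hat.
Context (R : realType).
Implicit Types (x y : 'cV[R]_3) (A M : 'M[R]_3).

(** The matrix of y |-> x × y, identifying R^3 under the cross product with so(3). *)
Definition hat x : 'M[R]_3 :=
  mx3 0 (- x 2 0) (x 1 0) (x 2 0) 0 (- x 0 0) (- x 1 0) (x 0 0) 0.

Lemma hat_skew x : (hat x)^T = - hat x.
Proof. by rewrite /hat mx3T mx3N !opprK oppr0. Qed.

Lemma hat_linear (a : R) x y : hat (a *: x + y) = a *: hat x + hat y.
Proof. by rewrite /hat mx3Z mx3D !mxE; congr mx3; ring. Qed.

Lemma hat_mulmx x y : hat x *m y =
  cv3 (x 1 0 * y 2 0 - x 2 0 * y 1 0) (x 2 0 * y 0 0 - x 0 0 * y 2 0) (x 0 0 * y 1 0 - x 1 0 * y 0 0).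
Proof. by rewrite /hat {1}(cv3_eta y) mx3_cv3; congr cv3; ring. Qed.

Lemma hat_bracket x y : hat (hat x *m y) = mxbracket (hat x) (hat y).
Proof.
rewrite hat_mulmx /mxbracket /hat !cv3E !mx3M mx3N mx3D.
by congr mx3; ring.
Qed.

Lemma hatE x : ((hat x 2 1 = x 0 0) * (hat x 0 2 = x 1 0) * (hat x 1 0 = x 2 0))%type.
Proof. by rewrite /hat !mx3E. Qed.

(** Rotations respect the cross product. The property passes to products, so only the two axis
    rotations need a computation. *)
Lemma hat_axrot A : axrot A -> forall x, hat (A *m x) *m A = A *m hat x.
Proof.
have gen B C : (forall x, hat (B *m x) *m B = B *m hat x) -> (forall x, hat (C *m x) *m C = C *m hat x) ->
    forall x, hat (B *m C *m x) *m (B *m C) = B *m C *m hat x.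
  by move=> hB hC x; rewrite -(mulmxA B C x) mulmxA hB -mulmxA hC mulmxA.
elim => [x|c s B E _ IH|c s B E _ IH]; first by rewrite !mul1mx mulmx1.
- apply: gen => // x; rewrite (cv3_eta x).
  move: (x 0 0) (x 1 0) (x 2 0) => a b d.
  have Em (y : R) : c ^+ 2 * y + s ^+ 2 * y = y by rewrite -mulrDl E mul1r.
  have Ea := Em a; have Eb := Em b; have Ed := Em d.
  by rewrite /rotx mx3_cv3 /hat !cv3E !mx3M; congr mx3; lra.
- apply: gen => // x; rewrite (cv3_eta x).
  move: (x 0 0) (x 1 0) (x 2 0) => a b d.
  have Em (y : R) : c ^+ 2 * y + s ^+ 2 * y = y by rewrite -mulrDl E mul1r.
  have Ea := Em a; have Eb := Em b; have Ed := Em d.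
  by rewrite /rotz mx3_cv3 /hat !cv3E !mx3M; congr mx3; lra.
Qed.

(** The columns are cyclic cross products of one another, hence pairwise orthogonal, and each
    squared length is the product of the other two. All are then 0 or all are 1, and the determinant
    is the squared length of the first column. *)
Lemma cross_hom_SO3 M : M != 0 -> (forall x y, hat (M *m x) *m (M *m y) = M *m (hat x *m y)) ->
  SO3 M.
Proof.
move=> M0 H.
have [e1 e2 e3] : [/\ hat (M *m cv3 1 0 0) *m (M *m cv3 0 1 0) = M *m cv3 0 0 1,
   hat (M *m cv3 0 1 0) *m (M *m cv3 0 0 1) = M *m cv3 1 0 0 &
   hat (M *m cv3 0 0 1) *m (M *m cv3 1 0 0) = M *m cv3 0 1 0].
  by split; rewrite H hat_mulmx !cv3E; congr (_ *m _); congr cv3; ring.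
move: M0 e1 e2 e3; rewrite (mx3_eta M); move: (M 0 0) (M 0 1) (M 0 2) (M 1 0) (M 1 1) (M 1 2) (M 2 0) (M 2 1) (M 2 2).
move=> {H} a1 b1 c1 a2 b2 c2 a3 b3 c3 M0; rewrite !hat_mulmx !mx3_cv3 !cv3E !mulr0 !mulr1 !addr0 !add0r.
have cvI (x y z x' y' z' : R) : cv3 x y z = cv3 x' y' z' :> 'cV[R]_3 -> [/\ x = x', y = y' & z = z'].
  by move=> E; split; [have := congr1 (fun v : 'cV_3 => v 0 0) E|have := congr1 (fun v : 'cV_3 => v 1 0) E|
    have := congr1 (fun v : 'cV_3 => v 2 0) E]; rewrite !cv3E.
move=> /cvI[p1 p2 p3] /cvI[q1 q2 q3] /cvI[r1 r2 r3].
pose a := a1 ^+ 2 + a2 ^+ 2 + a3 ^+ 2; pose b := b1 ^+ 2 + b2 ^+ 2 + b3 ^+ 2.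
pose c := c1 ^+ 2 + c2 ^+ 2 + c3 ^+ 2.
have ab : a1 * b1 + a2 * b2 + a3 * b3 = 0 by rewrite -q1 -q2 -q3; ring.
have ac : a1 * c1 + a2 * c2 + a3 * c3 = 0 by rewrite -p1 -p2 -p3; ring.
have bc : b1 * c1 + b2 * c2 + b3 * c3 = 0 by rewrite -p1 -p2 -p3; ring.
(* Lagrange's identity for the squared length of a cross product. *)
have cE : c = a * b.
  rewrite /c -p1 -p2 -p3; transitivity (a * b - (a1 * b1 + a2 * b2 + a3 * b3) ^+ 2).
    by rewrite /a /b; ring.
  by rewrite ab expr0n subr0.
have aE : a = b * c.
  rewrite {1}/a -q1 -q2 -q3; transitivity (b * c - (b1 * c1 + b2 * c2 + b3 * c3) ^+ 2).
    by rewrite /c /b; ring.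
  by rewrite bc expr0n subr0.
have bE : b = a * c.
  rewrite {1}/b -r1 -r2 -r3; transitivity (a * c - (a1 * c1 + a2 * c2 + a3 * c3) ^+ 2).
    by rewrite /c /a; ring.
  by rewrite ac expr0n subr0.
have pos (x y z : R) : 0 <= x ^+ 2 + y ^+ 2 + z ^+ 2 by rewrite !addr_ge0 ?sqr_ge0.
have a0 : 0 <= a := pos _ _ _. have b0 : 0 <= b := pos _ _ _. have c0 : 0 <= c := pos _ _ _.
have az : a != 0.
  apply: contra_neq M0 => a00.
  have b00 : b = 0 by rewrite bE a00 mul0r.
  have c00 : c = 0 by rewrite cE a00 mul0r.
  have z (x y t : R) : x ^+ 2 + y ^+ 2 + t ^+ 2 = 0 -> [/\ x = 0, y = 0 & t = 0].
    move=> E; have := sqr_ge0 x; have := sqr_ge0 y; have := sqr_ge0 t => ht hy hx.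
    by split; apply/eqP; rewrite -sqrf_eq0 eq_le sqr_ge0 andbT; lra.
  have [-> -> ->] := z _ _ _ a00; have [-> -> ->] := z _ _ _ b00; have [-> -> ->] := z _ _ _ c00.
  by rewrite [RHS]mx3_eta !mxE.
have c1' : c = 1.
  have : c ^+ 2 = 1.
    by apply: (mulfI az); rewrite mulr1 expr2 mulrA -bE -aE.
  by move/eqP; rewrite sqrf_eq1 => /orP[/eqP //|/eqP]; lra.
have b1' : b = 1.
  have ba : b = a by rewrite bE c1' mulr1.
  have : b ^+ 2 = 1 by rewrite expr2 {1}ba -cE.
  by move/eqP; rewrite sqrf_eq1 => /orP[/eqP //|/eqP]; lra.
have a1' : a = 1 by rewrite aE b1' c1' mulr1.
split.
  rewrite mx3T mx3M mx3_1; move: a1' b1' c1' ab ac bc; rewrite /a /b /c; clear.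
  by move=> ha hb hc ab ac bc; congr mx3; lra.
rewrite det_mx3; transitivity a => //.
transitivity (a1 * (b2 * c3 - b3 * c2) + a2 * (b3 * c1 - b1 * c3) + a3 * (b1 * c2 - b2 * c1)); first by ring.
by rewrite q1 q2 q3 /a; ring.
Qed.

End Hat.

(** * Identification of the group *)

Section RotationGroup.
Context (R : realType) (n k : nat) (G : orthoGroup R n).
Context (P : 'M[R]_(n, 5 + (3 + k))) (Q : 'M[R]_(5 + (3 + k), n)).
Hypotheses (Gclosed : closed (G : set 'M[R]_n)) (PQ : P *m Q = 1%:M) (QP : Q *m P = 1%:M).

Definition infrot (x : 'cV[R]_3) := P *m diff_mx k 0 (hat x) *m Q.
Definition rotact (A : 'M[R]_3) := P *m rot_mx k A *m Q.

Hypothesis lieE : forall X, lie_alg G X <-> exists x, X = infrot x.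

Lemma axis_rotation_mem (x : 'cV[R]_3) t : hat x *m hat x *m hat x = - hat x ->
  og_set G (rotact (rodrigues (hat x) t)).
Proof.
move=> x3; rewrite /rotact -expmx_diff//; last exact: hat_skew.
by have /lieE := ex_intro (fun y => infrot x = infrot y) x erefl; exact.
Qed.

Lemma angle_exists (c s : R) : c ^+ 2 + s ^+ 2 = 1 -> exists t, cos t = c /\ sin t = s.
Proof.
move=> cs.
have c1 : -1 <= c <= 1 by rewrite -ler_norml -(@ler_pXn2r _ 2)// ?nnegrE// real_normK ?num_real// expr1n; have := sqr_ge0 s; lra.
have E : Num.sqrt (1 - c ^+ 2) = `|s| by rewrite -sqrtr_sqr; congr Num.sqrt; lra.
have [s0|s0] := leP 0 s.
  by exists (acos c); rewrite acosK ?in_itv// sin_acos// E ger0_norm.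
by exists (- acos c); rewrite cosN sinN acosK ?in_itv// sin_acos// E ltr0_norm ?opprK.
Qed.

Lemma rotact_mul A B : B^T *m B = 1%:M -> rotact (A *m B) = rotact A *m rotact B.
Proof.
by move=> BB; rewrite /rotact rot_mxM// !mulmxA -[P *m _ *m Q *m P]mulmxA QP mulmx1.
Qed.

Lemma rotact1 : rotact 1%:M = 1%:M.
Proof. by rewrite /rotact rot_mx1 mulmx1. Qed.

Lemma rotact_mem A : SO3 A -> og_set G (rotact A).
Proof.
move=> /SO3_axrot; elim => [|c s B cs rB IH|c s B cs rB IH].
- by rewrite rotact1; exact: og_one.
- rewrite rotact_mul; last by case: (axrot_SO3 rB).
  apply: og_mul => //; have [t [<- <-]] := angle_exists cs.
  rewrite (_ : rotx _ _ = rodrigues (hat (cv3 1 0 0)) t).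
    apply: axis_rotation_mem; rewrite /hat !cv3E !mx3M mx3N; congr mx3; ring.
  by rewrite /rodrigues /hat /rotx !cv3E !mx3M mx3_1 !mx3Z !mx3D; congr mx3; ring.
- rewrite rotact_mul; last by case: (axrot_SO3 rB).
  apply: og_mul => //; have [t [<- <-]] := angle_exists cs.
  rewrite (_ : rotz _ _ = rodrigues (hat (cv3 0 0 1)) t).
    apply: axis_rotation_mem; rewrite /hat !cv3E !mx3M mx3N; congr mx3; ring.
  by rewrite /rodrigues /hat /rotz !cv3E !mx3M mx3_1 !mx3Z !mx3D; congr mx3; ring.
Qed.

Definition vector_emb : 'M[R]_(5 + (3 + k), 3) := col_mx 0 (col_mx 1%:M 0).

Lemma vector_embE (w : 'cV[R]_3) : vector_emb *m w = enc 0 w 0.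
Proof.
rewrite /vector_emb !mul_col_mx !mul0mx mul1mx /enc; congr col_mx.
by apply/colP => -[[|[|[|[|[|//]]]]] h]; rewrite !mxE.
Qed.

Lemma vector_emb_ortho : vector_emb^T *m vector_emb = 1%:M.
Proof. by rewrite /vector_emb !tr_col_mx !mul_row_col !trmx0 !mul0mx trmx1 mul1mx add0r addr0. Qed.

Lemma diff_mx_vector V : diff_mx k 0 V *m vector_emb = vector_emb *m V.
Proof.
apply: mulmx_ext => w; rewrite -!mulmxA !vector_embE diff_mx0_enc ?trmx0 ?linear0//.
by rewrite ?mulmx0 mul0mx addr0.
Qed.

Definition block (X : 'M[R]_n) : 'M[R]_3 := vector_emb^T *m (Q *m X *m P *m vector_emb).

Lemma conj_infrot x : Q *m infrot x *m P = diff_mx k 0 (hat x).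
Proof. by rewrite /infrot !mulmxA QP mul1mx -mulmxA QP mulmx1. Qed.

Lemma block_infrot x : block (infrot x) = hat x.
Proof. by rewrite /block conj_infrot diff_mx_vector mulmxA vector_emb_ortho mul1mx. Qed.

Lemma block_infrot_mul x y : block (infrot x *m infrot y) = hat x *m hat y.
Proof.
rewrite /block (_ : Q *m _ *m P = diff_mx k 0 (hat x) *m diff_mx k 0 (hat y)).
  by rewrite -mulmxA diff_mx_vector (mulmxA (diff_mx k 0 _)) diff_mx_vector !mulmxA vector_emb_ortho mul1mx.
by rewrite -!conj_infrot -!mulmxA (mulmxA P Q) PQ mul1mx.
Qed.

(** Reads off the axis from the action on the vector summand. Being defined on all matrices, it
    makes [adjoint] a continuous function on the whole matrix space. *)
Definition vee (X : 'M[R]_n) := cv3 (block X 2 1) (block X 0 2) (block X 1 0).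

Lemma vee_infrot x : vee (infrot x) = x.
Proof. by rewrite /vee block_infrot !hatE -cv3_eta. Qed.

Lemma infrot_inj x y : infrot x = infrot y -> x = y.
Proof. by move=> E; rewrite -[x]vee_infrot E vee_infrot. Qed.

Lemma infrot_linear a x y : infrot (a *: x + y) = a *: infrot x + infrot y.
Proof.
rewrite /infrot hat_linear scalemxAl scalemxAr -mulmxDl -mulmxDr; congr (_ *m _ *m _).
apply: mulmx_ext => z; rewrite mulmxDl -scalemxAl !diff_mxE /rotate_diff !scale0r !addr0.
rewrite -enc_linear; congr enc; rewrite ?scaler0 ?addr0//.
- rewrite linearD/= linearZ/= !mulmxDl !mulmxDr -!scalemxAl -!scalemxAr scalerDr.
  by rewrite addrACA.
- by rewrite mulmxDl -scalemxAl.
Qed.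

Lemma infrot0 : infrot 0 = 0.
Proof. exact: linear_map0 infrot_linear. Qed.

Lemma infrot_sum (x : 'cV[R]_3) (F : 'I_3 -> 'cV[R]_3) :
  infrot (\sum_j x j 0 *: F j) = \sum_j x j 0 *: infrot (F j).
Proof.
have combZ a u : infrot (a *: u) = a *: infrot u.
  by have := infrot_linear a u 0; rewrite !addr0 infrot0 addr0.
have combD u v : infrot (u + v) = infrot u + infrot v.
  by have := infrot_linear 1 u v; rewrite !scale1r.
by rewrite sum3 combD combD !combZ sum3.
Qed.

(** The bracket is known to be some [infrot z], since the Lie algebra is closed under brackets; z is
    then read off the 3 by 3 block, with no computation on tensors. *)
Lemma infrot_bracket x y : mxbracket (infrot x) (infrot y) = infrot (hat x *m y).
Proof.
have [z E] : exists z, mxbracket (infrot x) (infrot y) = infrot z.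
  by apply/lieE; apply: lie_alg_bracket => //; apply/lieE; [exists x|exists y].
rewrite E; congr infrot.
have blockB X Y : block (X - Y) = block X - block Y.
  by rewrite /block mulmxBr !mulmxBl mulmxBr.
have : hat z = hat (hat x *m y).
  by rewrite hat_bracket -block_infrot -E /mxbracket blockB !block_infrot_mul.
by move=> H; rewrite (cv3_eta z) -!hatE H !hatE -cv3_eta.
Qed.

(** For [g] in the group, the matrix of Ad(g) in the coordinates [infrot]; it is the R(g) of the
    overview. *)
Definition adjoint (g : 'M[R]_n) : 'M[R]_3 :=
  \matrix_(i, j) vee (g *m infrot (delta_mx j 0) *m g^T) i 0.

Lemma adjointE g x : og_set G g -> g *m infrot x *m g^T = infrot (adjoint g *m x).
Proof.
move=> Gg; pose y j := vee (g *m infrot (delta_mx j 0) *m g^T).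
have yP j : g *m infrot (delta_mx j 0) *m g^T = infrot (y j).
  have [z zE] : exists z, g *m infrot (delta_mx j 0) *m g^T = infrot z.
    by apply/lieE; apply: lie_alg_conj => //; apply/lieE; exists (delta_mx j 0).
  by rewrite /y zE vee_infrot.
have -> : adjoint g *m x = \sum_j x j 0 *: y j.
  by apply/colP => i; rewrite mxE summxE; apply: eq_bigr => j _; rewrite [adjoint g i j]mxE [RHS]mxE mulrC.
have xE : x = \sum_j x j 0 *: delta_mx j 0.
  by rewrite [LHS]matrix_sum_delta; apply: eq_bigr => j _; rewrite big_ord1.
rewrite {1}xE !infrot_sum mulmx_sumr mulmx_suml; apply: eq_bigr => j _.
by rewrite -yP -scalemxAr -scalemxAl.
Qed.

(** Conjugation preserves brackets, which are cross products in these coordinates, and it is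
    invertible, so [cross_hom_SO3] applies. *)
Lemma adjoint_SO3 g : og_set G g -> SO3 (adjoint g).
Proof.
move=> Gg; apply: cross_hom_SO3 => [|x y].
  apply/eqP => A0; have := adjointE (cv3 1 0 0) Gg.
  rewrite A0 mul0mx => E.
  have : infrot (cv3 1 0 0) = infrot 0.
    rewrite infrot0 in E *; move: (infrot _) E => X E; have := congr1 (fun M => g^T *m M *m g) E.
    by rewrite mulmx0 mul0mx -!mulmxA (og_ortho Gg) mulmx1 mulmxA (og_ortho Gg) mul1mx => ->.
  by move=> /infrot_inj /(congr1 (fun v : 'cV[R]_3 => v 0 0)); rewrite cv3E mxE => /eqP; rewrite oner_eq0.
apply: infrot_inj; rewrite -infrot_bracket -!adjointE// -infrot_bracket /mxbracket.
move: (infrot x) (infrot y) => X Y; rewrite mulmxBr mulmxBl !mulmxA -(mulmxA _ g^T g) (og_ortho Gg) mulmx1.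
by rewrite -(mulmxA _ g^T g) (og_ortho Gg) mulmx1.
Qed.

Lemma rotact_infrot A x : SO3 A -> rotact A *m infrot x = infrot (A *m x) *m rotact A.
Proof.
move=> sA; rewrite /rotact /infrot !mulmxA -![_ *m Q *m P]mulmxA QP !mulmx1.
rewrite -!mulmxA; congr (_ *m _); rewrite !mulmxA; congr (_ *m _).
apply: rot_mx_diff0; [exact/hat_axrot/SO3_axrot|by case: sA|exact: hat_skew].
Qed.

Definition centralizes (z : 'M[R]_n) := forall x, z *m infrot x = infrot x *m z.

Lemma residual_centralizes g : og_set G g -> centralizes (rotact (adjoint g)^T *m g).
Proof.
move=> Gg x; have sA := adjoint_SO3 Gg.
have gx : g *m infrot x = infrot (adjoint g *m x) *m g.
  by rewrite -(adjointE _ Gg) -mulmxA (og_ortho Gg) mulmx1.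
rewrite -mulmxA gx mulmxA rotact_infrot; last exact: SO3_tr.
by rewrite [_^T *m _]mulmxA; case: sA => -> _; rewrite mul1mx mulmxA.
Qed.

(** Compactness of the unit sphere. The indices [i j] need not increase; [j <= i j] is enough to
    carry null sequences along. *)
Lemma sphere_subsequence (Y : nat -> 'M[R]_n) : (forall j, `|Y j| = 1) ->
  exists X (i : nat -> nat), [/\ `|X| = 1, forall j, (j <= i j)%N & Y \o i @ \oo --> X].
Proof.
move=> Y1.
have cS : compact [set M : 'M[R]_n | `|M| = 1].
  apply: (@mx_bounded_closed_compact _ _ _ _ 1) => [M /= M1 a b|].
    by apply: le_trans (entry_le_mxnorm _ _ _) _; rewrite M1.
  have -> : [set M : 'M[R]_n | `|M| = 1] = (fun M : 'M[R]_n => `|M|) @^-1` [set 1] by [].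
  apply: closed_comp; last exact: closed_eq.
  by move=> M _; exact: norm_continuous.
have [|X [X1 clX]] := cS (Y @ \oo) _; first by exists 0%N => // j _ /=.
have H j : exists i, (j <= i)%N /\ `|X - Y i| < j.+1%:R^-1.
  have [||_ [[i ji <-] XY]] := clX [set Y i | i in [set i | (j <= i)%N]] (ball X j.+1%:R^-1).
  - by exists j => // i /= ji; exists i.
  - exact: nbhsx_ballx.
  - by exists i; split => //; move: XY; rewrite -ball_normE.
have [i iP] := choice H; exists X, i; split => // [j|]; first by case: (iP j).
apply/cvgrPdist_lt => e e0.
have [N _ NP] := (cvgrPdist_lt _ _).1 (@cvg_harmonic R) e e0.
exists N => // j /= Nj; have [_ /lt_trans] := iP j; apply.
by have := NP _ Nj; rewrite /= sub0r normrN ger0_norm.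
Qed.

(** Otherwise centralizing elements z_j different from 1 tend to 1. A limit X of the normalized z_j
    - 1 has norm 1, lies in the Lie algebra and commutes with it; but the cross product has trivial
    centre, so X = 0. *)
Lemma centralizer_discrete : exists2 e : R, 0 < e &
  forall z, og_set G z -> centralizes z -> `|z - 1%:M| < e -> z = 1%:M.
Proof.
apply: contrapT => H.
have {}H j : exists z, [/\ og_set G z, centralizes z, `|z - 1%:M| < j.+1%:R^-1 & z != 1%:M].
  apply: contrapT => K; apply: H; exists j.+1%:R^-1 => [|z Gz cz zj]; first by rewrite invr_gt0 ltr0n.
  by apply: contrapT => /eqP z1; apply: K; exists z.
have [z zP] := choice H.
pose d j := `|z j - 1%:M|.
have d0 j : 0 < d j by rewrite normr_gt0 subr_eq0; case: (zP j).
have [|X [i [X1 ij XL]]] := @sphere_subsequence (fun j => (d j)^-1 *: (z j - 1%:M)).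
  by move=> j; rewrite normrZ ger0_norm ?invr_ge0 ?(ltW (d0 j))// mulVf// gt_eqF.
have LX : lie_alg G X.
  apply: (@lie_alg_limit _ _ _ Gclosed (z \o i) (d \o i)) => // [j|j|]; first by case: (zP (i j)).
    exact: d0.
  apply/cvgrPdist_lt => e e0.
  have [N _ NP] := (cvgrPdist_lt _ _).1 (@cvg_harmonic R) e e0.
  exists N => // j /= Nj; rewrite sub0r normrN ger0_norm ?ltW ?d0//.
  have [_ _ /lt_trans zi _] := zP (i j); apply: zi.
  by have := NP _ (leq_trans Nj (ij j)); rewrite /= sub0r normrN ger0_norm.
have XC x : X *m infrot x = infrot x *m X.
  have zC j : (d (i j))^-1 *: (z (i j) - 1%:M) *m infrot x = infrot x *m ((d (i j))^-1 *: (z (i j) - 1%:M)).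
    have [_ cz _ _] := zP (i j).
    by rewrite -scalemxAl -scalemxAr mulmxBl mulmxBr mul1mx mulmx1 cz.
  have c1 := cvg_mulmx eventually_filter XL (@cvg_cst _ (infrot x) _ \oo eventually_filter).
  have c2 := cvg_mulmx eventually_filter (@cvg_cst _ (infrot x) _ \oo eventually_filter) XL.
  have E : (fun j => (d (i j))^-1 *: (z (i j) - 1%:M) *m infrot x) =
    (fun j => infrot x *m ((d (i j))^-1 *: (z (i j) - 1%:M))) by apply/funext.
  rewrite /= E in c1; exact: (cvg_unique _ c1 c2).
move: X1; have [y yE] := (lieE X).1 LX; rewrite yE in XC *.
have y0 (x : 'cV[R]_3) : hat y *m x = 0.
  by apply: infrot_inj; rewrite -infrot_bracket infrot0 /mxbracket XC subrr.
have {}y0 : hat y = 0 by apply: mulmx_ext => x; rewrite y0 mul0mx.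
suff -> : y = 0 by rewrite infrot0 normr0 => /eqP; rewrite eq_sym oner_eq0.
by rewrite (cv3_eta y) -!hatE y0; apply/colP; apply: ord3P; rewrite !mxE.
Qed.

Lemma continuous_adjoint : continuous adjoint.
Proof.
have bc j : continuous (fun g : 'M[R]_n => block (g *m infrot (delta_mx j 0) *m g^T)).
  have cc m p (M : 'M[R]_(m, p)) : continuous (fun _ : 'M[R]_n => M) by exact: continuous_cst.
  have ci : continuous (fun g : 'M[R]_n => g) by exact: continuous_idfun.
  have c1 := continuous_mulmx (continuous_mulmx ci (cc _ _ (infrot (delta_mx j 0)))) (continuous_trmx ci).
  have c2 := continuous_mulmx (continuous_mulmx (cc _ _ Q) c1) (cc _ _ P).
  exact: (continuous_mulmx (cc _ _ vector_emb^T) (continuous_mulmx c2 (cc _ _ vector_emb))).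
apply: continuous_mx => i j; under eq_fun do rewrite mxE.
move: (bc j) => {}bc.
have be a b : continuous (fun g : 'M[R]_n => block (g *m infrot (delta_mx j 0) *m g^T) a b).
  exact: continuous_entry.
have ext (f h : 'M[R]_n -> R) : f =1 h -> continuous f -> continuous h by move=> /funext ->.
move: i; apply: ord3P.
- by apply: (ext _ _ _ (be 2 1)) => g; rewrite /vee cv3E.
- by apply: (ext _ _ _ (be 0 2)) => g; rewrite /vee cv3E.
- by apply: (ext _ _ _ (be 1 0)) => g; rewrite /vee cv3E.
Qed.

Lemma adjoint1 : adjoint 1%:M = 1%:M.
Proof.
apply: mulmx_ext => x; apply: infrot_inj.
by rewrite -(adjointE _ (og_one G)) trmx1 !mul1mx mulmx1.
Qed.

(** Within the group the set where [phi] equals 1 is closed by continuity, and open because values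
    of [phi] close to 1 are equal to 1. It contains the identity, hence is everything. *)
Lemma connected_rotations : connected (G : set 'M[R]_n) ->
  forall g, og_set G g <-> exists2 A, SO3 A & g = rotact A.
Proof.
move=> Gcon g; split => [|[A sA ->]]; last exact: rotact_mem.
pose phi (h : 'M[R]_n) := rotact (adjoint h)^T *m h.
have phic : continuous phi.
  apply: continuous_mulmx; last exact: continuous_idfun.
  apply: continuous_mulmx; last exact: continuous_cst.
  apply: continuous_mulmx; first exact: continuous_cst.
  exact/continuous_rot_mx/continuous_trmx/continuous_adjoint.
have [e e0 eP] := centralizer_discrete.
have phiG h : og_set G h -> `|phi h - 1%:M| < e -> phi h = 1%:M.
  move=> Gh; apply: eP; last exact: residual_centralizes.
  by apply: og_mul => //; apply/rotact_mem/SO3_tr/adjoint_SO3.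
have : [set h | og_set G h /\ phi h = 1%:M] = og_set G.
  apply: Gcon.
  - by exists 1%:M; split; [exact: og_one|rewrite /phi adjoint1 trmx1 rotact1 mul1mx].
  - exists (phi @^-1` ball (1%:M : 'M[R]_n) e).
      by apply: open_comp => [h _|]; [exact: phic|exact: ball_open].
    apply/seteqP; split => h /= [Gh].
      by move=> ->; split => //; exact: ballxx.
    by rewrite -ball_normE /= distrC => hp; split => //; exact: phiG.
  - exists (phi @^-1` [set (1%:M : 'M[R]_n)]).
      apply: closed_comp => [h _|]; first exact: phic.
      by apply: accessible_closed_set1; apply: hausdorff_accessible; exact: norm_hausdorff.
    by apply/seteqP; split => h /= [].
move=> /seteqP[_ /(_ g) H] /H /= [Gg p1].
have sA := adjoint_SO3 Gg; exists (adjoint g) => //.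
rewrite -[LHS]mul1mx -rotact1 -(SO3_mulT sA) rotact_mul; last by rewrite trmxK SO3_mulT.
by rewrite -mulmxA -[rotact _^T *m g]/(phi g) p1 mulmx1.
Qed.

End RotationGroup.

(** * Coordinates on su(2) in which the bracket is the cross product *)

Section PauliBasis.
Context (R : realType).

(** In Pauli matrices this is (i/2)(x_0 s_1 - x_1 s_2 + x_2 s_3). The factor 1/2 and the minus sign
    make the bracket exactly the cross product. *)
Definition pauli (x : 'cV[R]_3) : 'M[R[i]]_2 :=
  \matrix_(i, j) nth 0 (nth [::] [:: [:: (0 +i* (x 2 0 / 2))%C; (- (x 1 0 / 2) +i* (x 0 0 / 2))%C];
    [:: ((x 1 0 / 2) +i* (x 0 0 / 2))%C; (0 +i* (- (x 2 0 / 2)))%C]] i) j.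

Lemma complex_ext (a b : R[i]) : complex.Re a = complex.Re b -> complex.Im a = complex.Im b -> a = b.
Proof. by case: a b => [? ?] [? ?] /= -> ->. Qed.

Lemma conj_complexE (a b : R) : Num.conj (a +i* b)%C = (a +i* - b)%C.
Proof. by []. Qed.

Lemma ord2P (p : 'I_2 -> Prop) : p 0 -> p 1 -> forall i, p i.
Proof.
by move=> p0 p1 [[|[|//]] h]; [rewrite (_ : Ordinal h = 0)|rewrite (_ : Ordinal h = 1)] => //; apply: val_inj.
Qed.

Lemma pauli_su x : su R 2 (pauli x).
Proof.
split.
  apply/matrixP => i j; rewrite !mxE; move: i j; apply: ord2P; apply: ord2P => /=; rewrite !conj_complexE;
    apply: complex_ext => /=; rewrite ?oppr0 ?opprK //.
by rewrite /mxtrace !big_ord_recl big_ord0 !mxE /=; apply: complex_ext => /=; rewrite ?addr0 ?subrr// addrA subrr.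
Qed.

Lemma su_pauli A : su R 2 A -> exists x, A = pauli x.
Proof.
move=> [hA tA].
have h (i j : 'I_2) : Num.conj (A j i) = - A i j by have := congr1 (fun M : 'M[R[i]]_2 => M i j) hA; rewrite !mxE.
have := h 0 0; have := h 1 1; have := h 0 1.
move: tA; rewrite /mxtrace !big_ord_recl big_ord0 addr0.
rewrite (_ : lift ord0 ord0 = 1); last exact: val_inj.
rewrite -[ord0]/(0 : 'I_2).
case e00 : (A 0 0) => [a00 b00]; case e01 : (A 0 1) => [a01 b01].
case e10 : (A 1 0) => [a10 b10]; case e11 : (A 1 1) => [a11 b11].
have parts (a b : R[i]) : a = b -> complex.Re a = complex.Re b /\ complex.Im a = complex.Im b by move=> ->.
move=> /parts[/= t1 t2]; rewrite !conj_complexE => /parts[/= u1 u2] /parts[/= v1 v2] /parts[/= w1 w2].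
exists (cv3 (2 * b10) (2 * a10) (2 * b00)).
have half (y : R) : 2 * y / 2 = y by rewrite mulrC mulKf// pnatr_eq0.
apply/matrixP => i j; rewrite mxE !cv3E !half; move: i j; apply: ord2P; apply: ord2P; rewrite /= ?e00 ?e01 ?e10 ?e11; apply: complex_ext => /=; lra.
Qed.

Lemma pauli_linear (a : R) x y : pauli (a *: x + y) = real_complex R a *: pauli x + pauli y.
Proof.
apply/matrixP => i j; rewrite !mxE; move: i j; apply: ord2P; apply: ord2P => /=;
  apply: complex_ext => /=; lra.
Qed.

Lemma pauli_bracket x y : mxbracket (pauli x) (pauli y) = pauli (hat x *m y).
Proof.
rewrite hat_mulmx /mxbracket; apply/matrixP => i j.
rewrite [RHS]mxE !cv3E !mxE !big_ord_recl !big_ord0 !mxE.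
move: (x 0 0) (x 1 0) (x 2 0) (y 0 0) (y 1 0) (y 2 0) => x0 x1 x2 y0 y1 y2.
move: i j; apply: ord2P; apply: ord2P => /=; apply: complex_ext => /=; lra.
Qed.

(** [pauli] is pulled back along the isomorphism. Its injectivity is known only on the Lie algebra,
    so closure of the latter under sums and brackets is needed for the two identities. *)
Lemma lie_isomorphic_su2_basis n (G : orthoGroup R n) : closed (G : set 'M[R]_n) ->
  lie_isomorphic (lie_alg G) (su R 2) -> exists e : 'cV[R]_3 -> 'M[R]_n,
  [/\ forall X, lie_alg G X <-> exists x, X = e x,
      forall a x y, e (a *: x + y) = a *: e x + e y &
      forall x y, mxbracket (e x) (e y) = e (hat x *m y)].
Proof.
move=> Gcl [f [fbij flin fbr]].
have [fun_f inj_f surj_f] := fbij.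
have ex x : exists X, lie_alg G X /\ f X = pauli x.
  by have [X gX fX] := surj_f _ (pauli_su x); exists X.
have [e eP] := choice ex; exists e.
have fI X Y : lie_alg G X -> lie_alg G Y -> f X = f Y -> X = Y.
  by move=> gX gY; apply: inj_f; exact/mem_set.
split.
- move=> X; split => [gX|[x ->]]; last by case: (eP x).
  have [x xE] := su_pauli (fun_f _ gX); exists x.
  by have [gx fx] := eP x; apply: fI => //; rewrite fx.
- move=> a x y; have [gx fx] := eP x; have [gy fy] := eP y; have [gz fz] := eP (a *: x + y).
  apply: fI => //; first by apply: lie_algD => //; exact: lie_alg_oppZ.
  by rewrite fz flin// fx fy pauli_linear.
- move=> x y; have [gx fx] := eP x; have [gy fy] := eP y; have [gz fz] := eP (hat x *m y).
  apply: fI => //; first exact: lie_alg_bracket.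
  by rewrite fbr// fz fx fy pauli_bracket.
Qed.

End PauliBasis.

(** * The orbit space *)

Section OrbitSpaceOfRotations.
Context (R : realType) (n k : nat) (G : orthoGroup R n).
Context (P : 'M[R]_(n, 5 + (3 + k))) (Q : 'M[R]_(5 + (3 + k), n)).
Hypotheses (PQ : P *m Q = 1%:M) (QP : Q *m P = 1%:M).
Hypothesis rotations : forall g, og_set G g <-> exists2 A, SO3 A & g = rotact P Q A.

Definition orbit_map (u : 'cV[R]_n) : 'cV[R]_(5 + k) :=
  let x := Q *m u in col_mx (invmap (tensor_part x) (vector_part x)) (trivial_part x).

Lemma orbit_map_enc S w (c : 'cV[R]_k) : S^T = S -> \tr S = 0 ->
  orbit_map (P *m enc S w c) = col_mx (invmap S w) c.
Proof.
move=> sS tS; rewrite /orbit_map mulmxA QP mul1mx.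
by rewrite tensor_part_enc// vector_part_enc trivial_part_enc.
Qed.

Lemma rotact_enc A S w (c : 'cV[R]_k) : S^T = S -> \tr S = 0 ->
  rotact P Q A *m (P *m enc S w c) = P *m enc (A *m S *m A^T) (A *m w) c.
Proof.
by move=> sS tS; rewrite -rotate_enc// -rot_mxE /rotact -!mulmxA (mulmxA Q P) QP mul1mx.
Qed.

Lemma enc_exists u : exists S w (c : 'cV[R]_k), [/\ S^T = S, \tr S = 0 & u = P *m enc S w c].
Proof.
exists (tensor_part (Q *m u)), (vector_part (Q *m u)), (trivial_part (Q *m u)).
split; [exact: tensor_part_sym|exact: tensor_part_tr|].
by rewrite enc_eta mulmxA PQ mul1mx.
Qed.

Lemma continuous_orbit_map : continuous orbit_map.
Proof.
have cQ : continuous (fun u : 'cV[R]_n => Q *m u).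
  by apply: continuous_mulmx; [exact: continuous_cst|exact: continuous_idfun].
have cd m p (f : 'cV[R]_n -> 'cV[R]_(m + p)) : continuous f -> continuous (fun u => dsubmx (f u)).
  by move=> fc; apply: continuous_mx => i j; under eq_fun do rewrite mxE; exact: continuous_entry.
have cu m p (f : 'cV[R]_n -> 'cV[R]_(m + p)) : continuous f -> continuous (fun u => usubmx (f u)).
  by move=> fc; apply: continuous_mx => i j; under eq_fun do rewrite mxE; exact: continuous_entry.
apply: continuous_col_mx; last exact/cd/cd.
apply: invmap_continuous; last exact/cu/cd.
have c5 i : continuous (fun u : 'cV[R]_n => usubmx (Q *m u) i 0 : R).
  by apply: continuous_entry; exact: cu.
have c5' : continuous (fun u : 'cV[R]_n => - usubmx (Q *m u) (inord 0) 0 - usubmx (Q *m u) (inord 1) 0 : R).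
  apply: continuous_sub => // u.
  by have := @cvgN _ _ _ _ (nbhs_filter u) _ _ (c5 (inord 0) u).
apply: continuous_mx => i j.
have ext (f h : 'cV[R]_n -> R) : f =1 h -> continuous f -> continuous h by move=> /funext ->.
move: i j; apply: ord3P; apply: ord3P.
- by apply: (ext _ _ _ (c5 (inord 0))) => u; rewrite /tensor_part /dec5 mx3E.
- by apply: (ext _ _ _ (c5 (inord 2))) => u; rewrite /tensor_part /dec5 mx3E.
- by apply: (ext _ _ _ (c5 (inord 3))) => u; rewrite /tensor_part /dec5 mx3E.
- by apply: (ext _ _ _ (c5 (inord 2))) => u; rewrite /tensor_part /dec5 mx3E.
- by apply: (ext _ _ _ (c5 (inord 1))) => u; rewrite /tensor_part /dec5 mx3E.
- by apply: (ext _ _ _ (c5 (inord 4))) => u; rewrite /tensor_part /dec5 mx3E.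
- by apply: (ext _ _ _ (c5 (inord 3))) => u; rewrite /tensor_part /dec5 mx3E.
- by apply: (ext _ _ _ (c5 (inord 4))) => u; rewrite /tensor_part /dec5 mx3E.
- by apply: (ext _ _ _ c5') => u; rewrite /tensor_part /dec5 mx3E.
Qed.

Lemma orbit_map_fibers u v :
  orbit_map u = orbit_map v <-> exists2 A, og_set G A & A *m u = v.
Proof.
have [S [w [c [sS tS ->]]]] := enc_exists u.
have [S' [w' [c' [sS' tS' ->]]]] := enc_exists v.
rewrite !orbit_map_enc//; split.
  move=> /eq_col_mx[E <-]; have [A [sA AS Aw]] := invmap_separates sS sS' tS tS' E.
  by exists (rotact P Q A); [apply/rotations; exists A|rewrite rotact_enc// AS Aw].
move=> [_ /rotations[A sA ->]]; rewrite rotact_enc// => /(congr1 (mulmx Q)).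
rewrite !mulmxA QP !mul1mx => /eq_col_mx[ES /eq_col_mx[<- <-]].
have <- : A *m S *m A^T = S'.
  rewrite -[RHS]enc5K// -ES enc5K//; first by rewrite !trmx_mul trmxK sS mulmxA.
  by case: sA => AA _; rewrite conj_tr.
by rewrite invmap_SO3.
Qed.

Lemma orbit_map_proper (K : R) : exists K' : R, forall u : 'cV[R]_n,
  (forall i, `|orbit_map u i 0| <= K) -> forall i, `|u i 0| <= K'.
Proof.
have [K1 K1P] := @invmap_bounded R K.
exists ((\sum_i \sum_j `|P i j|) * Num.max K1 K) => u.
have [S [w [c [sS tS ->]]]] := enc_exists u; rewrite orbit_map_enc// => FK.
have [SK wK] : (forall i j, `|S i j| <= K1) /\ (forall i, `|w i 0| <= K1).
  by apply: K1P => // i; have := FK (lshift k i); rewrite col_mxEu.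
have cK i : `|c i 0| <= K by have := FK (rshift 5 i); rewrite col_mxEd.
set M := Num.max K1 K.
have eK i : `|enc S w c i 0| <= M.
  rewrite /enc -(splitK i); case: (fintype.split i) => o /=; rewrite ?col_mxEu ?col_mxEd.
    by rewrite /M le_max; case: o => -[|[|[|[|[|//]]]]] l; rewrite mxE /= SK.
  rewrite -(splitK o); case: (fintype.split o) => o' /=; rewrite ?col_mxEu ?col_mxEd /M le_max ?wK//.
  by rewrite cK orbT.
move=> i; rewrite mxE (le_trans (ler_norm_sum _ _ _))//.
have M0 : 0 <= M by apply: le_trans (eK (rshift 5 (lshift k 0))); exact: normr_ge0.
apply: (@le_trans _ _ ((\sum_j `|P i j|) * M)).
  by rewrite mulr_suml; apply: ler_sum => j _; rewrite normrM ler_wpM2l.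
rewrite ler_wpM2r// [leRHS](bigD1 i)//= lerDl sumr_ge0// => l _.
exact: sumr_ge0.
Qed.

Lemma orbit_map_dense (y : 'cV[R]_(5 + k)) (e : R) : 0 < e ->
  exists u : 'cV[R]_n, forall i, `|orbit_map u i 0 - y i 0| < e.
Proof.
move=> e0; pose f i := usubmx y (inord i) 0.
(* [invmap_realize] needs a nonzero fifth coordinate, so a zero one is moved by half the
   tolerance. *)
pose f4 := if f 4%N == 0 then e / 2 else f 4%N.
have f40 : f4 != 0 by rewrite /f4; case: ifP => [_|/negbT //]; lra.
have f4e : `|f4 - f 4%N| < e.
  rewrite /f4; case: eqP => [->|_]; last by rewrite subrr normr0.
  by rewrite subr0 ger0_norm; lra.
have [S [v [sS tS E]]] := invmap_realize (f 0%N) (f 1%N) (f 2%N) (f 3%N) f40.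
exists (P *m enc S v (dsubmx y)) => i; rewrite orbit_map_enc// E -[y in X in _ - X]vsubmxK.
rewrite -(splitK i); case: (fintype.split i) => o /=; rewrite ?col_mxEu ?col_mxEd ?subrr ?normr0//.
rewrite mxE; have fo : f o = usubmx y o 0 by rewrite /f inord_val.
rewrite -fo; case: o {fo} => -[|[|[|[|[|//]]]]] l //=; by rewrite subrr normr0.
Qed.

Lemma rotations_homeomorphic : homeomorphic (orbit_space G) 'cV[R]_(5 + k).
Proof.
exact: (invariant_map_homeomorphic continuous_orbit_map orbit_map_fibers orbit_map_proper orbit_map_dense).
Qed.

End OrbitSpaceOfRotations.

Lemma irreducible_of_lie (R : realType) n (g : set 'M[R]_n) (e : 'cV[R]_3 -> 'M[R]_n)
    (U : {vspace 'cV[R]_n}) :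
  (forall X, g X <-> exists x, X = e x) ->
  (forall a x y, e (a *: x + y) = a *: e x + e y) ->
  lie_irreducible g U -> irreducible (e (cv3 1 0 0)) (e (cv3 0 1 0)) (e (cv3 0 0 1)) U.
Proof.
move=> gE eL [stU U0 irrU].
have e0 : e 0 = 0 := linear_map0 eL.
have eE x : e x = x 0 0 *: e (cv3 1 0 0) + (x 1 0 *: e (cv3 0 1 0) + x 2 0 *: e (cv3 0 0 1)).
  rewrite -[x 2 0 *: e _]addr0 -e0 -!eL; congr e.
  by rewrite {1}(cv3_eta x); apply/colP; apply: ord3P; rewrite !mxE /=; ring.
have sE W : lie_stable g W <-> stable (e (cv3 1 0 0)) (e (cv3 0 1 0)) (e (cv3 0 0 1)) W.
  split=> [st u uW|st X u /gE[x ->] uW].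
    by split; apply: st => //; apply/gE; eexists.
  have [h1 h2 h3] := st u uW.
  by rewrite eE !mulmxDl -!scalemxAl; apply: memvD; [exact: memvZ|apply: memvD; exact: memvZ].
split => //; first exact/sE.
by move=> W WU /sE; exact: irrU.
Qed.

Lemma count_gt1_two (ns : seq nat) : count (fun m => 1 < m)%N ns = 2 ->
  nth 0%N ns 0 = 5 -> nth 0%N ns 1 = 3 -> (forall i, (i < size ns)%N -> nth 0%N ns i != 0%N) ->
  exists2 ms, ns = [:: 5, 3 & ms] & forall i, (i < size ms)%N -> nth 0%N ms i = 1%N.
Proof.
case: ns => [|a [|b ms]]//= + a5 b3; rewrite a5 b3 /= => -[c0] nz.
exists ms => // i im.
have : ~~ (1 < nth 0%N ms i)%N.
  apply/negP => h; have : has (fun m => 1 < m)%N ms by apply/hasP; exists (nth 0%N ms i) => //; exact: mem_nth.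
  by rewrite has_count -[count _ _]add0n c0.
by have := nz i.+2 im; rewrite /=; case: (nth _ _ _) => [|[|]].
Qed.

Lemma infrot_basis (R : realType) n k (P : 'M[R]_(n, 5 + (3 + k))) (Q : 'M[R]_(5 + (3 + k), n))
    (E : 'M[R]_n) x : P *m Q = 1%:M ->
  (forall S w (c : 'cV[R]_k), S^T = S -> \tr S = 0 ->
    E *m (P *m enc S w c) = P *m enc (mxbracket (hat x) S) (hat x *m w) 0) ->
  E = infrot P Q x.
Proof.
move=> PQ EP; rewrite -[LHS]mulmx1 -PQ mulmxA; congr (_ *m Q); apply: mulmx_ext => z.
rewrite -(enc_eta z) -!mulmxA EP; [|exact: tensor_part_sym|exact: tensor_part_tr].
rewrite diff_mx0_enc; [|exact: tensor_part_sym|exact: tensor_part_tr].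
by rewrite hat_skew mulmxN.
Qed.

Lemma hat_basis (R : realType) :
  [/\ hat (cv3 1 0 0) = L1 R, hat (cv3 0 1 0) = L2 R & hat (cv3 0 0 1) = L3 R].
Proof. by split; rewrite /hat !cv3E ?oppr0. Qed.

Theorem mainTheorem9 (R : realType) (n : nat) (G : orthoGroup R n)
    (ns : seq nat) (l : nat)
    (G_compact : compact (G : set 'M[R]_n))
    (G_su2 : lie_isomorphic (lie_alg G) (su R 2))
    (dims_V : irreducible_dims (lie_alg G) ns)
    (def_l : count (fun k => 1 < k)%N ns = l)
    (G_eq_G0 : (G : set 'M[R]_n) = connected_component G 1%:M)
    (l_eq2 : l = 2%N)
    (n1_eq5 : nth 0%N ns 0 = 5%N)
    (n2_eq3 : nth 0%N ns 1 = 3%N) :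
  homeomorphic (orbit_space G) 'cV[R]_(5 + (size ns - l)).
Proof.
have Gclosed : closed (G : set 'M[R]_n).
  by apply: compact_closed G_compact; exact: norm_hausdorff.
have Gconnected : connected (G : set 'M[R]_n).
  by rewrite G_eq_G0; exact: component_connected.
have [e [lieE eL ebr]] := lie_isomorphic_su2_basis Gclosed G_su2.
have [_ [U [irrU dimU dirU fullU]]] := dims_V.
have [|ms nsE ms1] := count_gt1_two (etrans def_l l_eq2) n1_eq5 n2_eq3.
  move=> i ins; rewrite -(dimU (Ordinal ins)) dimv_eq0.
  by have [_ U0 _] := irrU (Ordinal ins).
subst ns; rewrite l_eq2 /= subn2 /=; clear def_l dims_V n1_eq5 n2_eq3.
have [h1 h2 h3] := hat_basis R.
have skew x : (e x)^T = - e x by apply: (lie_alg_skew (G := G)) => //; apply/lieE; exists x.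
have [||||||||||||P [Q [PQ QP PE]]] := standard_basis (E1 := e (cv3 1 0 0)) (E2 := e (cv3 0 1 0)) (E3 := e (cv3 0 0 1)) _ _ _ _ _ _ (k := size ms) (U := U).
- by rewrite ebr hat_mulmx !cv3E; congr e; congr cv3; ring.
- by rewrite ebr hat_mulmx !cv3E; congr e; congr cv3; ring.
- by rewrite ebr hat_mulmx !cv3E; congr e; congr cv3; ring.
- exact: skew.
- exact: skew.
- exact: skew.
- by move=> i; apply: irreducible_of_lie (irrU i).
- by rewrite dimU.
- by rewrite dimU.
- by move=> j; rewrite dimU; exact: (ms1 j (ltn_ord j)).
- exact: dirU.
- exact: fullU.
(* [standard_basis] gives the agreement on the three generators only; linearity extends it. *)
have combE x : e x = infrot P Q x.
  have [b1 b2 b3] : [/\ e (cv3 1 0 0) = infrot P Q (cv3 1 0 0), e (cv3 0 1 0) = infrot P Q (cv3 0 1 0) &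
      e (cv3 0 0 1) = infrot P Q (cv3 0 0 1)].
    by split; apply: (infrot_basis PQ) => S w c sS tS; rewrite ?h1 ?h2 ?h3; case: (PE S w c sS tS).
  have e0 : e 0 = 0 := linear_map0 eL.
  have -> : x = x 0 0 *: cv3 1 0 0 + (x 1 0 *: cv3 0 1 0 + (x 2 0 *: cv3 0 0 1 + 0)).
    by rewrite {1}(cv3_eta x); apply/colP; apply: ord3P; rewrite !mxE /=; ring.
  by rewrite !eL !infrot_linear b1 b2 b3 e0 infrot0.
apply: (rotations_homeomorphic PQ QP).
apply: (connected_rotations Gclosed PQ QP _ Gconnected) => X; rewrite lieE.
by split=> -[x ->]; exists x; rewrite combE.
Qed.
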